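(* Let $\mathcal C$ be a groupoidant 2-category, and suppose there exists a DOF classifier $\mathrm S\in\mathcal C$ such that every SOF in $\mathcal C$ is $\mathrm S$-small. Then $\mathcal C$ is equivalent to the trivial (i.e. terminal) 2-category.
   Context: **Conventions.** All 2-categories are strict; $\mathcal C(X,Y)$ is the hom-category. Composites and whiskerings are written in diagrammatic order ($fg$ means first $f$, then $g$). The terminal 2-category has one object, one 1-cell and one 2-cell; ''equivalent'' is in the usual sense of equivalence of 2-categories (biequivalence). **Fibrations.** A functor $p:\mathbf C\to\mathbf D$ is an isofibration if every isomorphism $f:X\to Y$ in $\mathbf D$ and $\tilde X$ with $p(\tilde X)=X$ admit an isomorphism $\tilde f$ with domain $\tilde X$ and $p(\tilde f)=f$. It is a discrete opfibration (DOF) if the same holds with ''isomorphism'' replaced by ''morphism'' in both places and with $\tilde f$ unique. It is a setoidal opfibration (SOF) if it is faithful, every morphism $f:X\to Y$ and $\tilde X$ over $X$ admit a (not necessarily unique) lift with domain $\tilde X$, and for any two lifts $\tilde f_j:\tilde X\to\tilde Y_j$ ($j=0,1$) of $f$ there is a unique $g:\tilde Y_0\to\tilde Y_1$ with $\tilde f_0g=\tilde f_1$ and $p(g)=\mathrm{id}_Y$. A 1-cell $p:X\to Y$ in a 2-category $\mathcal C$ is an isofibration/DOF/SOF if $\mathcal C(A,X)\to\mathcal C(A,Y)$ is one for every $A\in\mathcal C$. $\mathrm{DOF}(A)$ is the category of DOFs over $A$; a morphism $(X,p)\to(Y,q)$ is a 1-cell $f:X\to Y$ with $fq=p$. $\mathrm{SOF}(A)$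 has as objects the SOFs over $A$, and as morphisms $(X,p)\to(Y,q)$ the 1-cells $f$ with $fq=p$, modulo identifying $f,f'$ when there is a 2-cell $\alpha:f\Rightarrow f'$ with $\alpha q=\mathrm{id}_p$. $\mathrm{DOF}(A)$ is a full subcategory of $\mathrm{SOF}(A)$. **Corepita 2-categories.** A strict pullback square (strict terminal object) is one sent by each $\mathcal C(A,-)$ to a pullback square of categories (the terminal category). A strict arrow object of $X$ is an object $X^{\to}$ with a 2-cell between 1-cells $\partial_0,\partial_1:X^\to\to X$ inducing an isomorphism $\mathcal C(A,X^{\to})\cong\mathcal C(A,X)^{\to}$ onto the arrow category for every $A$. More generally, a strict cotensor $X^J$ of $X$ by a category $J$ comes with a functor $J\to\mathcal C(X^J,X)$ inducing isomorphisms $\mathcal C(A,X^J)\cong\mathcal C(A,X)^J$. An object $X$ is groupoidal if $\mathcal C(A,X)$ is a groupoid for all $A$. A 1-cell $f:X\to Y$ is an arrow-wise iso if $\alpha f$ is invertible for every 2-cell $\alpha$ between 1-cells $A\to X$. A core of $X$ is a groupoidal object $X^{\mathrm{iso}}$ with an arrow-wise iso $i:X^{\mathrm{iso}}\to X$ through which every arrow-wise iso $A\to X$, and every invertible 2-cell between arrow-wise isos $A\to X$, factors uniquely. $\mathcal C$ is corepita if it has a strict terminal object, strict pullbacks of isofibrations, strict arrow objects, and cores of all objects. (Then it has strict cotensors by finite categories.) **Groupoidant 2-categories.** A gbo-congruence in $\mathcal C$ is a truncated simplicial diagram $C:\Delta_{\le 2}^{\mathrm{op}}\to\mathcal C$ which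 is an internal category in the underlying 1-category, with $C_1\to C_0\times C_0$ a DOF and $C_0,C_1,C_2$ groupoidal. For each $A$, the 1-cells $A\to C_0$ and $A\to C_1$ are the objects and arrows of a category; $A\to C_1$ is $C$-invertible if it is invertible there. There is a universal $C$-invertible $C_{\cong}\to C_1$ through which every $C$-invertible 1-cell factors uniquely; $C$ is a complete congruence if the factorization $C_0\to C_{\cong}$ of the identities map $e:C_0\to C_1$ is an equivalence. Let $\pi_j:C_1\to C_0$ and $\pi_{jk}:C_2\to C_1$ be induced by the injections $[0]\to[1]$, $[1]\to[2]$ with images $\{j\}$, $\{j,k\}$. A cocone with vertex $Y$ is $(g,\gamma)$ with $g:C_0\to Y$, $\gamma:\pi_0g\Rightarrow\pi_1g$, $e\gamma=\mathrm{id}_g$, and $\pi_{02}\gamma=(\pi_{01}\gamma)(\pi_{12}\gamma)$. It is a quotient if every cocone $(h,\eta)$ with vertex $Z$ equals $(gf,\gamma f)$ for a unique $f:Y\to Z$, and every morphism of cocones $\alpha:(h,\eta)\to(k,\kappa)$ with vertex $Z$ (a 2-cell $\alpha:h\Rightarrow k$ with $(\pi_0\alpha)\kappa=\eta(\pi_1\alpha)$) is $g\beta$ for a unique 2-cell $\beta$ between the induced 1-cells $Y\to Z$. The nerve $\mathrm{Nv}(X)$ is the complete congruence with $\mathrm{Nv}(X)_k=(X^{[k]})^{\mathrm{iso}}$, $k=0,1,2$; it has a canonical cocone with vertex $X$ given by the core inclusion $X^{\mathrm{iso}}\to X$ and the core inclusion of $X^{[1]}=X^\to$ whiskered with the universal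 2-cell. $\mathcal C$ is groupoidant if it is corepita, the canonical cocone under every nerve is a quotient, and every complete congruence is isomorphic to a nerve. **DOF classifiers.** Let $p:\mathrm S_*\to\mathrm S$ be a DOF. For $A\in\mathcal C$ let $\mathrm{El}^A:\mathcal C(A,\mathrm S)\to\mathrm{DOF}(A)$ send $f$ to the strict pullback $f^*p:f^*\mathrm S_*\to A$ (with projection $\pi_f:f^*\mathrm S_*\to\mathrm S_*$), and a 2-cell $\gamma:f\Rightarrow h$ to the unique morphism $g:f^*\mathrm S_*\to h^*\mathrm S_*$ in $\mathrm{DOF}(A)$ for which there is a 2-cell $\ddot\gamma:\pi_f\Rightarrow g\pi_h$ with $\ddot\gamma p=(f^*p)\gamma$. $\mathrm S$ (with $p$) is a DOF classifier if $\mathrm{El}^A$ is fully faithful for all $A$. A DOF over $A$ is $\mathrm S$-small if it is in the essential image of $\mathrm{El}^A$; a SOF over $A$ is $\mathrm S$-small if it is isomorphic in $\mathrm{SOF}(A)$ to an $\mathrm S$-small DOF. *)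

(* Defs.v *)
(* Strict 2-categories and their groupoidant structure, over MathComp's boot
   layer (used for finite ordinals only).

   All composites are in diagrammatic order.  Hom-types are dependent; an
   equation between arrows (or 2-cells) whose end points are only
   propositionally equal is written [f ≈ g] and means equality of the arrows
   packed together with their source and target. *)
From mathcomp Require Import all_boot.
From Stdlib Require Import ProofIrrelevance.

Set Implicit Arguments.
Unset Strict Implicit.
Unset Printing Implicit Defensive.
#[local] Obligation Tactic := idtac.

(** * Categories *)

Record category : Type := Category {
  ob :> Type;
  hom : ob -> ob -> Type;
  idm : forall x, hom x x;
  cmp : forall x y z, hom x y -> hom y z -> hom x z;
  cmp_idl : forall x y (f : hom x y), cmp (idm x) f = f;
  cmp_idr : forall x y (f : hom x y), cmp f (idm y) = f;
  cmp_assoc : forall x y z w (f : hom x y) (g : hom y z) (h : hom z w),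
    cmp (cmp f g) h = cmp f (cmp g h)
}.
Arguments hom {c} x y.
Arguments idm {c} x.
Arguments cmp {c x y z} f g.

Notation "f • g" := (cmp f g) (at level 40, left associativity).

Record arrow (K : category) : Type := Arrow {
  asrc : K;
  atgt : K;
  amor : hom asrc atgt
}.

Definition arr {K : category} {x y : K} (f : hom x y) : arrow K := Arrow f.

Notation "f ≈ g" := (arr f = arr g) (at level 70, no associativity).

Lemma arr_srcE (K : category) (x y x' y' : K) (f : hom x y) (g : hom x' y') :
  f ≈ g -> x = x' /\ y = y'.
Proof. by case. Qed.

Lemma arr_inj (K : category) (x y : K) (f g : hom x y) : f ≈ g -> f = g.
Proof.
move=> e; have := f_equal (fun a : arrow K => existT (fun p => hom p.1 p.2) (asrc a, atgt a) (amor a)) e.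
exact: (@inj_pair2 _ (fun p => hom p.1 p.2) (x, y)).
Qed.

Lemma arr_src_cast (K : category) (x x' y : K) (f : hom x y) :
  x = x' -> exists f' : hom x' y, f' ≈ f.
Proof. by case: x' /; exists f. Qed.

(* [c] is the composite of the arrows [a] and [b]; in particular the target of
   [a] is the source of [b]. *)
Definition is_composite {K : category} (a b c : arrow K) : Prop :=
  exists (x y z : K) (f : hom x y) (g : hom y z),
    [/\ a = arr f, b = arr g & c = arr (f • g)].

Definition is_iso {K : category} {x y : K} (f : hom x y) : Prop :=
  exists g : hom y x, f • g = idm x /\ g • f = idm y.

Definition isomorphic {K : category} (x y : K) : Prop :=
  exists f : hom x y, is_iso f.

Definition is_groupoid (K : category) : Prop :=
  forall (x y : K) (f : hom x y), is_iso f.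

Definition is_terminal_category (K : category) : Prop :=
  (exists! x : K, True) /\ (exists! a : arrow K, True).

Record functor (K L : category) : Type := Functor {
  fob :> K -> L;
  fmap : forall x y, hom x y -> hom (fob x) (fob y);
  fmap_id : forall x, fmap (idm x) = idm (fob x);
  fmap_cmp : forall x y z (f : hom x y) (g : hom y z),
    fmap (f • g) = fmap f • fmap g
}.
Arguments fmap {K L} F {x y} f : rename.

Definition fun_arr {K L : category} (F : functor K L) (a : arrow K) : arrow L :=
  arr (fmap F (amor a)).

Definition functor_eq {K L : category} (F G : functor K L) : Prop :=
  (forall x, F x = G x) /\ (forall a : arrow K, fun_arr F a = fun_arr G a).

Definition functor_id (K : category) : functor K K :=
  @Functor K K (fun x => x) (fun _ _ f => f) (fun _ => erefl) (fun _ _ _ _ _ => erefl).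

Program Definition functor_comp {K L M : category}
    (F : functor K L) (G : functor L M) : functor K M :=
  @Functor K M (fun x => G (F x)) (fun _ _ f => fmap G (fmap F f)) _ _.
Next Obligation. by move=> K L M F G x /=; rewrite !fmap_id. Qed.
Next Obligation. by move=> K L M F G x y z f g /=; rewrite !fmap_cmp. Qed.

Definition is_natural {K L : category} (F G : functor K L)
    (t : forall x, hom (F x) (G x)) : Prop :=
  forall (x y : K) (f : hom x y), fmap F f • t y = t x • fmap G f.

Definition natural_iso {K L : category} (F G : functor K L) : Prop :=
  exists t : forall x, hom (F x) (G x), is_natural t /\ forall x, is_iso (t x).

Definition is_equivalence_of_categories {K L : category} (F : functor K L) : Prop :=
  exists G : functor L K,
    natural_iso (functor_id K) (functor_comp F G) /\
    natural_iso (functor_comp G F) (functor_id L).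

Definition faithful {K L : category} (F : functor K L) : Prop :=
  forall (x y : K) (f g : hom x y), fmap F f = fmap F g -> f = g.

Definition fully_faithful {K L : category} (F : functor K L) : Prop :=
  forall (x y : K) (g : hom (F x) (F y)), exists! f : hom x y, fmap F f = g.

Definition in_essential_image {K L : category} (F : functor K L) (y : L) : Prop :=
  exists x : K, isomorphic (F x) y.

(* The square is a pullback of categories: it commutes and exhibits the objects
   and the arrows of [P] as the fibre products of those of [K] and [L]. *)
Definition is_pullback_of_categories {P K L M : category}
    (F : functor P K) (G : functor P L) (H : functor K M) (I : functor L M) : Prop :=
  [/\ functor_eq (functor_comp F H) (functor_comp G I),
      forall (x : K) (y : L), H x = I y -> exists! z : P, F z = x /\ G z = y
    & forall (a : arrow K) (b : arrow L), fun_arr H a = fun_arr I b ->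
        exists! c : arrow P, fun_arr F c = a /\ fun_arr G c = b].

(** ** Fibrations *)

Definition isofibration_functor {K L : category} (p : functor K L) : Prop :=
  forall (x' : K) (y : L) (f : hom (p x') y), is_iso f ->
    exists (y' : K) (f' : hom x' y'), is_iso f' /\ fmap p f' ≈ f.

Definition DOF_functor {K L : category} (p : functor K L) : Prop :=
  forall (x' : K) (y : L) (f : hom (p x') y),
    exists (y' : K) (f' : hom x' y'), fmap p f' ≈ f /\
      forall (y'' : K) (f'' : hom x' y''), fmap p f'' ≈ f -> f'' ≈ f'.

Definition SOF_functor {K L : category} (p : functor K L) : Prop :=
  [/\ faithful p,
      forall (x' : K) (y : L) (f : hom (p x') y),
        exists (y' : K) (f' : hom x' y'), fmap p f' ≈ f
    & forall (x' : K) (y : L) (f : hom (p x') y)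
        (y0 y1 : K) (f0 : hom x' y0) (f1 : hom x' y1),
        fmap p f0 ≈ f -> fmap p f1 ≈ f ->
        exists! g : hom y0 y1, f0 • g = f1 /\ fmap p g ≈ idm y].

(** ** Finite ordinals *)

(* [ordcat k] is the poset [k] = {0 < ... < k}. *)
Program Definition ordcat (k : nat) : category :=
  @Category 'I_k.+1 (fun i j => (i <= j)%N)
    (fun i => leqnn i) (fun i j l => @leq_trans j i l) _ _ _.
Next Obligation. by move=> *; apply: bool_irrelevance. Qed.
Next Obligation. by move=> *; apply: bool_irrelevance. Qed.
Next Obligation. by move=> *; apply: bool_irrelevance. Qed.

Definition ord_arrow {k : nat} (i j : 'I_k.+1) (le_ij : (i <= j)%N) :
    @hom (ordcat k) i j := le_ij.

Record monotone_map (m n : nat) : Type := MonotoneMap {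
  mfun :> 'I_m.+1 -> 'I_n.+1;
  mfun_le : forall i j : 'I_m.+1, (i <= j)%N -> (mfun i <= mfun j)%N
}.

Program Definition monotone_functor {m n : nat} (t : monotone_map m n) :
    functor (ordcat m) (ordcat n) :=
  @Functor (ordcat m) (ordcat n) t (fun i j => @mfun_le m n t i j) _ _.
Next Obligation. by move=> *; apply: bool_irrelevance. Qed.
Next Obligation. by move=> *; apply: bool_irrelevance. Qed.

Program Definition vertex {n : nat} (j : 'I_n.+1) : monotone_map 0 n :=
  @MonotoneMap 0 n (fun _ => j) _.
Next Obligation. by []. Qed.

Program Definition edge {n : nat} (j k : 'I_n.+1) (le_jk : (j <= k)%N) :
    monotone_map 1 n :=
  @MonotoneMap 1 n (fun i => if i == ord0 then j else k) _.
Next Obligation.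
move=> n j k le_jk i l le_il /=; case: eqP => [_|i0]; case: eqP => [l0|_] //.
by case: i0; apply: val_inj; move: le_il; rewrite l0 leqn0 => /eqP.
Qed.

Program Definition degeneracy : monotone_map 1 0 :=
  @MonotoneMap 1 0 (fun _ => ord0) _.
Next Obligation. by []. Qed.

(** * Strict 2-categories *)

(* [h1 f g] is the composite 1-cell, [wl f b] and [wr a g] are the whiskerings
   of a 2-cell by a 1-cell on the left and on the right. *)
Record two_category : Type := TwoCategory {
  ob2 :> Type;
  hc : ob2 -> ob2 -> category;
  id1 : forall X, hc X X;
  h1 : forall X Y Z, hc X Y -> hc Y Z -> hc X Z;
  wl : forall X Y Z (f : hc X Y) (g g' : hc Y Z), hom g g' -> hom (h1 f g) (h1 f g');
  wr : forall X Y Z (f f' : hc X Y), hom f f' -> forall g : hc Y Z, hom (h1 f g) (h1 f' g);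
  h1_idl : forall X Y (f : hc X Y), h1 (id1 X) f = f;
  h1_idr : forall X Y (f : hc X Y), h1 f (id1 Y) = f;
  h1_assoc : forall X Y Z W (f : hc X Y) (g : hc Y Z) (h : hc Z W),
    h1 (h1 f g) h = h1 f (h1 g h);
  wl_id : forall X Y Z (f : hc X Y) (g : hc Y Z), wl f (idm g) = idm (h1 f g);
  wr_id : forall X Y Z (f : hc X Y) (g : hc Y Z), wr (idm f) g = idm (h1 f g);
  wl_cmp : forall X Y Z (f : hc X Y) (g g' g'' : hc Y Z) (b : hom g g') (b' : hom g' g''),
    wl f (b • b') = wl f b • wl f b';
  wr_cmp : forall X Y Z (f f' f'' : hc X Y) (a : hom f f') (a' : hom f' f'') (g : hc Y Z),
    wr (a • a') g = wr a g • wr a' g;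
  interchange : forall X Y Z (f f' : hc X Y) (g g' : hc Y Z) (a : hom f f') (b : hom g g'),
    wr a g • wl f' b = wl f b • wr a g';
  wl_unit : forall X Y (f f' : hc X Y) (a : hom f f'), wl (id1 X) a ≈ a;
  wr_unit : forall X Y (f f' : hc X Y) (a : hom f f'), wr a (id1 Y) ≈ a;
  wl_assoc : forall X Y Z W (f : hc X Y) (g : hc Y Z) (h h' : hc Z W) (c : hom h h'),
    wl f (wl g c) ≈ wl (h1 f g) c;
  wr_assoc : forall X Y Z W (f f' : hc X Y) (a : hom f f') (g : hc Y Z) (h : hc Z W),
    wr (wr a g) h ≈ wr a (h1 g h);
  wlr_assoc : forall X Y Z W (f : hc X Y) (g g' : hc Y Z) (b : hom g g') (h : hc Z W),
    wr (wl f b) h ≈ wl f (wr b h)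
}.
Arguments hc {t} X Y.
Arguments id1 {t} X.
Arguments h1 {t X Y Z} f g.
Arguments wl {t X Y Z} f {g g'} b.
Arguments wr {t X Y Z f f'} a g.

Notation "f ⋅ g" := (h1 f g) (at level 39, left associativity).
Notation "f ◃ b" := (wl f b) (at level 38, right associativity).
Notation "a ▹ g" := (wr a g) (at level 37, left associativity).
Notation "f ⟹ g" := (hom f g) (at level 60, no associativity, only parsing).

(* The action of C(A,-) and of C(-,Z) on 1-cells. *)
Definition post {C : two_category} (A : C) {X Y : C} (p : hc X Y) :
    functor (hc A X) (hc A Y) :=
  @Functor (hc A X) (hc A Y) (fun f => f ⋅ p) (fun _ _ a => a ▹ p)
    (fun f => wr_id f p) (fun _ _ _ a a' => wr_cmp a a' p).

Definition pre {C : two_category} {A B : C} (f : hc A B) (Z : C) :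
    functor (hc B Z) (hc A Z) :=
  @Functor (hc B Z) (hc A Z) (fun g => f ⋅ g) (fun _ _ b => f ◃ b)
    (fun g => wl_id f g) (fun _ _ _ b b' => wl_cmp f b b').

Definition is_equivalence {C : two_category} {X Y : C} (f : hc X Y) : Prop :=
  exists g : hc Y X, isomorphic (f ⋅ g) (id1 X) /\ isomorphic (g ⋅ f) (id1 Y).

Definition equivalent_objects {C : two_category} (X Y : C) : Prop :=
  exists f : hc X Y, is_equivalence f.

(** ** Biequivalence *)

Record pseudofunctor (C D : two_category) : Type := Pseudofunctor {
  pf_ob :> C -> D;
  pf_hom : forall X Y : C, functor (hc X Y) (hc (pf_ob X) (pf_ob Y));
  pf_id : forall X : C, id1 (pf_ob X) ⟹ pf_hom X X (id1 X);
  pf_comp : forall (X Y Z : C) (f : hc X Y) (g : hc Y Z),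
    pf_hom X Y f ⋅ pf_hom Y Z g ⟹ pf_hom X Z (f ⋅ g);
  pf_id_iso : forall X, is_iso (pf_id X);
  pf_comp_iso : forall (X Y Z : C) (f : hc X Y) (g : hc Y Z), is_iso (pf_comp f g);
  pf_comp_natl : forall (X Y Z : C) (f f' : hc X Y) (a : f ⟹ f') (g : hc Y Z),
    fmap (pf_hom X Y) a ▹ pf_hom Y Z g • pf_comp f' g =
    pf_comp f g • fmap (pf_hom X Z) (a ▹ g);
  pf_comp_natr : forall (X Y Z : C) (f : hc X Y) (g g' : hc Y Z) (b : g ⟹ g'),
    pf_hom X Y f ◃ fmap (pf_hom Y Z) b • pf_comp f g' =
    pf_comp f g • fmap (pf_hom X Z) (f ◃ b);
  pf_unitl : forall (X Y : C) (f : hc X Y),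
    pf_id X ▹ pf_hom X Y f • pf_comp (id1 X) f ≈ idm (pf_hom X Y f);
  pf_unitr : forall (X Y : C) (f : hc X Y),
    pf_hom X Y f ◃ pf_id Y • pf_comp f (id1 Y) ≈ idm (pf_hom X Y f);
  pf_assoc : forall (X Y Z W : C) (f : hc X Y) (g : hc Y Z) (h : hc Z W),
    pf_comp f g ▹ pf_hom Z W h • pf_comp (f ⋅ g) h ≈
    pf_hom X Y f ◃ pf_comp g h • pf_comp f (g ⋅ h)
}.
Arguments pf_hom {C D} F X Y : rename.

Definition is_biequivalence {C D : two_category} (F : pseudofunctor C D) : Prop :=
  (forall X Y : C, is_equivalence_of_categories (pf_hom F X Y)) /\
  (forall Z : D, exists X : C, equivalent_objects (F X) Z).

Definition biequivalent (C D : two_category) : Prop :=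
  exists F : pseudofunctor C D, is_biequivalence F.

Program Definition terminal_category : category :=
  @Category unit (fun _ _ => unit) (fun _ => tt) (fun _ _ _ _ _ => tt) _ _ _.
Next Obligation. by move=> _ _ []. Qed.
Next Obligation. by move=> _ _ []. Qed.
Next Obligation. by []. Qed.

Program Definition terminal_two_category : two_category :=
  @TwoCategory unit (fun _ _ => terminal_category) (fun _ => tt)
    (fun _ _ _ _ _ => tt) (fun _ _ _ _ _ _ _ => tt) (fun _ _ _ _ _ _ _ => tt)
    _ _ _ _ _ _ _ _ _ _ _ _ _.
Solve All Obligations with by [| move=> ? ? [] | move=> ? ? [] [] []].

(** * Notions internal to a 2-category *)

Section Internal.
Context {C : two_category}.

Definition is_isofibration {X Y : C} (p : hc X Y) : Prop :=
  forall A : C, isofibration_functor (post A p).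

Definition is_DOF {X Y : C} (p : hc X Y) : Prop :=
  forall A : C, DOF_functor (post A p).

Definition is_SOF {X Y : C} (p : hc X Y) : Prop :=
  forall A : C, SOF_functor (post A p).

Definition is_groupoidal (X : C) : Prop :=
  forall A : C, is_groupoid (hc A X).

Definition is_arrowwise_iso {X Y : C} (f : hc X Y) : Prop :=
  forall (A : C) (a b : hc A X) (t : a ⟹ b), is_iso (t ▹ f).

Definition is_strict_terminal (T : C) : Prop :=
  forall A : C, is_terminal_category (hc A T).

Definition is_strict_pullback {P X Y Z : C}
    (p1 : hc P X) (p2 : hc P Y) (f : hc X Z) (g : hc Y Z) : Prop :=
  p1 ⋅ f = p2 ⋅ g /\
  forall A : C,
    is_pullback_of_categories (post A p1) (post A p2) (post A f) (post A g).

Definition is_strict_product {P X Y : C} (p1 : hc P X) (p2 : hc P Y) : Prop :=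
  forall A : C,
    (forall (x : hc A X) (y : hc A Y), exists! z : hc A P, z ⋅ p1 = x /\ z ⋅ p2 = y) /\
    (forall (a : arrow (hc A X)) (b : arrow (hc A Y)),
       exists! c : arrow (hc A P),
         fun_arr (post A p1) c = a /\ fun_arr (post A p2) c = b).

(* The two clauses say that C(A,XA) -> C(A,X)^-> is bijective on objects and
   fully faithful; a morphism of the arrow category is a commuting square. *)
Definition is_strict_arrow_object {X XA : C} {d0 d1 : hc XA X} (d : d0 ⟹ d1) : Prop :=
  forall A : C,
    (forall a : arrow (hc A X), exists! f : hc A XA, arr (f ◃ d) = a) /\
    (forall (f g : hc A XA) (u : f ⋅ d0 ⟹ g ⋅ d0) (v : f ⋅ d1 ⟹ g ⋅ d1),
       u • (g ◃ d) = (f ◃ d) • v ->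
       exists! t : f ⟹ g, t ▹ d0 = u /\ t ▹ d1 = v).

(* Likewise for C(A,XJ) -> C(A,X)^J. *)
Definition is_strict_cotensor {J : category} {X XJ : C} (U : functor J (hc XJ X)) : Prop :=
  forall A : C,
    (forall F : functor J (hc A X),
       exists! f : hc A XJ, functor_eq (functor_comp U (pre f X)) F) /\
    (forall (f g : hc A XJ)
        (t : forall j, functor_comp U (pre f X) j ⟹ functor_comp U (pre g X) j),
       is_natural t -> exists! s : f ⟹ g, forall j, s ▹ U j = t j).

Definition is_core {X Xi : C} (i : hc Xi X) : Prop :=
  [/\ is_groupoidal Xi,
      is_arrowwise_iso i,
      forall (A : C) (f : hc A X), is_arrowwise_iso f ->
        exists! f' : hc A Xi, f' ⋅ i = f
    & forall (A : C) (f g : hc A X) (a : f ⟹ g),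
        is_arrowwise_iso f -> is_arrowwise_iso g -> is_iso a ->
        exists! a' : arrow (hc A Xi), fun_arr (post A i) a' = arr a].

End Internal.

Definition corepita (C : two_category) : Prop :=
  [/\ exists T : C, is_strict_terminal T,
      forall (X Y Z : C) (f : hc X Z) (p : hc Y Z), is_isofibration p ->
        exists (P : C) (p1 : hc P X) (p2 : hc P Y), is_strict_pullback p1 p2 f p,
      forall X : C, exists (XA : C) (d0 d1 : hc XA X) (d : d0 ⟹ d1),
        is_strict_arrow_object d
    & forall X : C, exists (Xi : C) (i : hc Xi X), is_core i].

(** * Congruences *)

Definition dim0 : 'I_3 := @Ordinal 3 0 isT.
Definition dim1 : 'I_3 := @Ordinal 3 1 isT.
Definition dim2 : 'I_3 := @Ordinal 3 2 isT.

(* A functor from the opposite of the full subcategory of the simplex category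
   on [0], [1], [2].  The laws quantify over pointwise equal monotone maps, so
   that no extensionality axiom is involved. *)
Record simplicial2 (C : two_category) : Type := Simplicial2 {
  sob :> 'I_3 -> C;
  smap : forall m n : 'I_3, monotone_map m n -> hc (sob n) (sob m);
  smap_id : forall (n : 'I_3) (t : monotone_map n n),
    (forall i, t i = i) -> smap t = id1 (sob n);
  smap_comp : forall (l m n : 'I_3) (s : monotone_map l m) (t : monotone_map m n)
      (r : monotone_map l n),
    (forall i, r i = t (s i)) -> smap r = smap t ⋅ smap s
}.
Arguments smap {C} D {m n} t : rename.

Section Congruence.
Context {C : two_category} (D : simplicial2 C).

Definition pi0 : hc (D dim1) (D dim0) := @smap C D dim0 dim1 (vertex (@Ordinal 2 0 isT)).
Definition pi1 : hc (D dim1) (D dim0) := @smap C D dim0 dim1 (vertex (@Ordinal 2 1 isT)).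
Definition unit1 : hc (D dim0) (D dim1) := @smap C D dim1 dim0 degeneracy.
Definition pi01 : hc (D dim2) (D dim1) :=
  @smap C D dim1 dim2 (@edge 2 (@Ordinal 3 0 isT) (@Ordinal 3 1 isT) isT).
Definition pi02 : hc (D dim2) (D dim1) :=
  @smap C D dim1 dim2 (@edge 2 (@Ordinal 3 0 isT) (@Ordinal 3 2 isT) isT).
Definition pi12 : hc (D dim2) (D dim1) :=
  @smap C D dim1 dim2 (@edge 2 (@Ordinal 3 1 isT) (@Ordinal 3 2 isT) isT).

(* [h] is the composite of the generalized arrows [f] and [g]. *)
Definition internal_comp {A : C} (f g h : hc A (D dim1)) : Prop :=
  exists u : hc A (D dim2), [/\ u ⋅ pi01 = f, u ⋅ pi12 = g & u ⋅ pi02 = h].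

(* The unit laws are part of the simplicial identities; associativity is not,
   since the diagram stops at dimension 2. *)
Definition is_internal_category : Prop :=
  (forall (A : C) (f g : hc A (D dim1)), f ⋅ pi1 = g ⋅ pi0 ->
     exists! u : hc A (D dim2), u ⋅ pi01 = f /\ u ⋅ pi12 = g) /\
  (forall (A : C) (f g h fg gh l r : hc A (D dim1)),
     internal_comp f g fg -> internal_comp g h gh ->
     internal_comp fg h l -> internal_comp f gh r -> l = r).

Definition is_gbo_congruence : Prop :=
  [/\ is_internal_category,
      exists (P : C) (p0 p1 : hc P (D dim0)) (b : hc (D dim1) P),
        [/\ is_strict_product p0 p1, b ⋅ p0 = pi0, b ⋅ p1 = pi1 & is_DOF b]
    & forall k : 'I_3, is_groupoidal (D k)].

Definition internally_invertible {A : C} (f : hc A (D dim1)) : Prop :=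
  exists g : hc A (D dim1),
    internal_comp f g (f ⋅ pi0 ⋅ unit1) /\ internal_comp g f (f ⋅ pi1 ⋅ unit1).

Definition is_universal_invertible {E : C} (j : hc E (D dim1)) : Prop :=
  internally_invertible j /\
  forall (A : C) (f : hc A (D dim1)), internally_invertible f ->
    exists! f' : hc A E, f' ⋅ j = f.

Definition is_complete_congruence : Prop :=
  is_gbo_congruence /\
  exists (E : C) (j : hc E (D dim1)) (e' : hc (D dim0) E),
    [/\ is_universal_invertible j, e' ⋅ j = unit1 & is_equivalence e'].

Record cocone (Y : C) : Type := Cocone {
  coc1 : hc (D dim0) Y;
  coc2 : pi0 ⋅ coc1 ⟹ pi1 ⋅ coc1;
  coc_unit : unit1 ◃ coc2 ≈ idm coc1;
  coc_comp : is_composite (arr (pi01 ◃ coc2)) (arr (pi12 ◃ coc2)) (arr (pi02 ◃ coc2))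
}.

Definition is_cocone_morphism {Z : C} (h k : cocone Z) (a : coc1 h ⟹ coc1 k) : Prop :=
  (pi0 ◃ a) • coc2 k = coc2 h • (pi1 ◃ a).

Definition induces {Y Z : C} (g : cocone Y) (f : hc Y Z) (h : cocone Z) : Prop :=
  coc1 g ⋅ f = coc1 h /\ coc2 g ▹ f ≈ coc2 h.

Definition is_quotient {Y : C} (g : cocone Y) : Prop :=
  (forall (Z : C) (h : cocone Z), exists! f : hc Y Z, induces g f h) /\
  (forall (Z : C) (h k : cocone Z) (a : coc1 h ⟹ coc1 k), is_cocone_morphism a ->
     forall f f' : hc Y Z, induces g f h -> induces g f' k ->
       exists! b : f ⟹ f', coc1 g ◃ b ≈ a).

End Congruence.

Definition simplicial2_isomorphic {C : two_category} (D E : simplicial2 C) : Prop :=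
  exists (s : forall k : 'I_3, hc (D k) (E k)) (t : forall k : 'I_3, hc (E k) (D k)),
    [/\ forall k, s k ⋅ t k = id1 (D k),
        forall k, t k ⋅ s k = id1 (E k)
      & forall (m n : 'I_3) (r : monotone_map m n), smap D r ⋅ s m = s n ⋅ smap E r].

(* [nerve X D] exhibits [D] as Nv(X), for some choice of cotensors [nv_cot k] of
   [X] by [k] and of their cores [D k]; [nv_map t] is the 1-cell between
   cotensors induced by [t]. *)
Record nerve {C : two_category} (X : C) (D : simplicial2 C) : Type := Nerve {
  nv_cot : 'I_3 -> C;
  nv_univ : forall k : 'I_3, functor (ordcat k) (hc (nv_cot k) X);
  nv_univP : forall k, is_strict_cotensor (nv_univ k);
  nv_core : forall k : 'I_3, hc (D k) (nv_cot k);
  nv_coreP : forall k, is_core (nv_core k);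
  nv_map : forall m n : 'I_3, monotone_map m n -> hc (nv_cot n) (nv_cot m);
  nv_mapP : forall (m n : 'I_3) (t : monotone_map m n),
    functor_eq (functor_comp (nv_univ m) (pre (nv_map t) X))
               (functor_comp (monotone_functor t) (nv_univ n));
  nv_smap : forall (m n : 'I_3) (t : monotone_map m n),
    smap D t ⋅ nv_core m = nv_core n ⋅ nv_map t
}.

(* The cotensor of [X] by [0] is only isomorphic to [X], by its universal 1-cell
   [nv_univ N dim0 ord0]. *)
Definition is_canonical_cocone {C : two_category} {X : C} {D : simplicial2 C}
    (N : nerve X D) (c : cocone D X) : Prop :=
  coc1 c = nv_core N dim0 ⋅ nv_univ N dim0 ord0 /\
  coc2 c ≈ nv_core N dim1 ◃
    fmap (nv_univ N dim1) (@ord_arrow 1 (@Ordinal 2 0 isT) (@Ordinal 2 1 isT) isT).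

Lemma canonical_cocone_exists (C : two_category) (X : C) (D : simplicial2 C) (N : nerve X D) :
  exists c : cocone D X, is_canonical_cocone N c.
Proof.
pose u k := nv_univ N k.
pose g := nv_core N dim0 ⋅ u dim0 ord0.
have mapO (m n : 'I_3) (t : monotone_map m n) (j : 'I_m.+1) :
    smap D t ⋅ (nv_core N m ⋅ u m j) = nv_core N n ⋅ u n (t j).
  rewrite -h1_assoc nv_smap h1_assoc; congr (_ ⋅ _).
  by have [/(_ j) /= -> _] := nv_mapP N t.
have mapA (m n : 'I_3) (t : monotone_map m n) (i j : 'I_m.+1) (l : (i <= j)%N) :
    smap D t ◃ (nv_core N m ◃ fmap (u m) (@ord_arrow m i j l)) ≈
    nv_core N n ◃ fmap (u n) (@ord_arrow n _ _ (@mfun_le m n t i j l)).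
  rewrite wl_assoc nv_smap -wl_assoc.
  have [_ /(_ (arr (@ord_arrow m i j l)))] := nv_mapP N t.
  by move/(f_equal (fun_arr (pre (nv_core N n) X))).
have e0 : pi0 D ⋅ g = nv_core N dim1 ⋅ u dim1 (@Ordinal 2 0 isT) by apply: mapO.
have e1 : pi1 D ⋅ g = nv_core N dim1 ⋅ u dim1 (@Ordinal 2 1 isT) by apply: mapO.
pose a := nv_core N dim1 ◃ fmap (u dim1) (@ord_arrow 1 (@Ordinal 2 0 isT) (@Ordinal 2 1 isT) isT).
have [c cE] : exists c : hom (pi0 D ⋅ g) (pi1 D ⋅ g), c ≈ a.
  by rewrite e0 e1; exists a.
have wlE (Z : C) (t : hc Z (D dim1)) : t ◃ c ≈ t ◃ a.
  by apply: (f_equal (fun_arr (pre t X)) cE).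
have U : unit1 D ◃ c ≈ idm g.
  rewrite wlE mapA /g -wl_id -fmap_id; congr (arr (_ ◃ fmap _ _)); exact: bool_irrelevance.
have V : is_composite (arr (pi01 D ◃ c)) (arr (pi12 D ◃ c)) (arr (pi02 D ◃ c)).
  rewrite !wlE !mapA.
  pose F (i j : 'I_3) (l : (i <= j)%N) := nv_core N dim2 ◃ fmap (u dim2) (@ord_arrow 2 i j l).
  exists _, _, _, (F (@Ordinal 3 0 isT) (@Ordinal 3 1 isT) isT), (F (@Ordinal 3 1 isT) (@Ordinal 3 2 isT) isT).
  split; rewrite /F -?wl_cmp -?fmap_cmp; congr (arr (_ ◃ fmap _ _)); exact: bool_irrelevance.
by exists (Cocone U V).
Qed.

Definition groupoidant (C : two_category) : Prop :=
  [/\ corepita C,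
      forall (X : C) (D : simplicial2 C) (N : nerve X D),
        exists c : cocone D X, is_canonical_cocone N c /\ is_quotient c
    & forall D : simplicial2 C, is_complete_congruence D ->
        exists (X : C) (E : simplicial2 C),
          inhabited (nerve X E) /\ simplicial2_isomorphic D E].

(** * Classifiers *)

Section Slices.
Context {C : two_category}.

Record DOF_over (A : C) : Type := DOFOver {
  dof_dom : C;
  dof_map : hc dof_dom A;
  dof_is : is_DOF dof_map
}.

Definition DOF_hom {A : C} (X Y : DOF_over A) : Type :=
  {f : hc (dof_dom X) (dof_dom Y) | f ⋅ dof_map Y = dof_map X}.

Lemma DOF_hom_eq (A : C) (X Y : DOF_over A) (f g : DOF_hom X Y) :
  sval f = sval g -> f = g.
Proof.
case: f g => [f Hf] [g Hg] /= e; case: g / e Hg => Hg.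
by rewrite (proof_irrelevance _ Hf Hg).
Qed.

Definition DOF_hom_id {A : C} (X : DOF_over A) : DOF_hom X X :=
  exist _ (id1 (dof_dom X)) (h1_idl (dof_map X)).

Program Definition DOF_hom_comp {A : C} {X Y Z : DOF_over A}
    (f : DOF_hom X Y) (g : DOF_hom Y Z) : DOF_hom X Z :=
  exist _ (sval f ⋅ sval g) _.
Next Obligation.
by move=> A X Y Z [f Hf] [g Hg] /=; rewrite h1_assoc Hg.
Qed.

Program Definition DOF_category (A : C) : category :=
  @Category (DOF_over A) DOF_hom DOF_hom_id (@DOF_hom_comp A) _ _ _.
Next Obligation. by move=> *; apply: DOF_hom_eq; apply: h1_idl. Qed.
Next Obligation. by move=> *; apply: DOF_hom_eq; apply: h1_idr. Qed.
Next Obligation. by move=> *; apply: DOF_hom_eq; apply: h1_assoc. Qed.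

(* The relation by which morphisms [(X,p) -> (Y,q)] are identified in SOF(A). *)
Definition SOF_hom_eq {A X Y : C} (p : hc X A) (q : hc Y A) (f f' : hc X Y) : Prop :=
  exists a : f ⟹ f', a ▹ q ≈ idm p.

(* With reflexivity and transitivity, which are clear, this is an equivalence
   relation, so no generated equivalence is needed. *)
Lemma SOF_hom_eq_sym (A X Y : C) (p : hc X A) (q : hc Y A) (f f' : hc X Y) :
  is_SOF q -> SOF_hom_eq p q f f' -> SOF_hom_eq p q f' f.
Proof.
move=> sofq [a aE]; have [_ _ U] := sofq X; have [e e'] := arr_srcE aE.
have E : idm f ▹ q ≈ idm p by rewrite wr_id e.
have e1 : fmap (post X q) (idm f) ≈ idm (f ⋅ q) by rewrite /= wr_id.
have e2 : fmap (post X q) a ≈ idm (f ⋅ q) by rewrite /= aE e.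
have [b [[_ bE] _]] := U f _ (idm (f ⋅ q)) f' f a (idm f) e2 e1.
by exists b; rewrite -e.
Qed.

Definition SOF_isomorphic {A X Y : C} (p : hc X A) (q : hc Y A) : Prop :=
  exists (f : hc X Y) (g : hc Y X),
    [/\ f ⋅ q = p, g ⋅ p = q,
        SOF_hom_eq p p (f ⋅ g) (id1 X) & SOF_hom_eq q q (g ⋅ f) (id1 Y)].

(* The action of El^A on 2-cells is well defined. *)
Lemma El_action_unique (S' S A P Q : C) (p : hc S' S) (f h : hc A S)
    (q : hc P A) (r : hc Q A) (pf : hc P S') (ph : hc Q S') (c : hom f h) :
  is_DOF p -> is_strict_pullback q pf f p -> is_strict_pullback r ph h p ->
  exists! g : hc P Q, g ⋅ r = q /\
    exists c' : hom pf (g ⋅ ph), c' ▹ p ≈ q ◃ c.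
Proof.
move=> dofp [sqf _] [sqh pbh].
have [c0 c0E] := arr_src_cast (q ◃ c) sqf.
have [k [k' [k'E k'U]]] := dofp P pf (q ⋅ h) c0.
have [_ /= kp] := arr_srcE k'E.
have [_ /(_ q k (esym kp))[g [[/= gr gph] gU]] _] := pbh P.
exists g; split.
  by split=> //; rewrite gph; exists k'; rewrite -c0E.
move=> g' [g'r [c' c'E]]; apply: gU; split=> //=.
by have [] := arr_srcE (k'U _ c' (etrans c'E (esym c0E))).
Qed.

(* The functor El^A, for a choice of the strict pullbacks of [p] and of their
   projections [El_proj] to [S']. *)
Record El_functor {S' S : C} (p : hc S' S) (A : C) : Type := ElFunctor {
  El_fun :> functor (hc A S) (DOF_category A);
  El_proj : forall f : hc A S, hc (dof_dom (El_fun f)) S';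
  El_pullback : forall f : hc A S,
    is_strict_pullback (dof_map (El_fun f)) (El_proj f) f p;
  El_action : forall (f h : hc A S) (c : f ⟹ h),
    exists c' : El_proj f ⟹ sval (fmap El_fun c) ⋅ El_proj h,
      c' ▹ p ≈ dof_map (El_fun f) ◃ c
}.

End Slices.

Record DOF_classifier (C : two_category) : Type := DOFClassifier {
  cl_base : C;
  cl_total : C;
  cl_map : hc cl_total cl_base;
  cl_DOF : is_DOF cl_map;
  cl_El : forall A : C, El_functor cl_map A;
  cl_ff : forall A : C, fully_faithful (cl_El A)
}.

Definition DOF_small {C : two_category} (S : DOF_classifier C) {A : C}
    (X : DOF_over A) : Prop :=
  in_essential_image (cl_El S A) X.

Definition SOF_small {C : two_category} (S : DOF_classifier C) {A X : C}
    (q : hc X A) : Prop :=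
  exists Y : DOF_over A, DOF_small S Y /\ SOF_isomorphic q (dof_map Y).

(* Main.v *)
Require Import Defs.
From mathcomp Require Import all_boot.
From Stdlib Require Import IndefiniteDescription.

(** This is the Burali-Forti paradox, with rigidity in the role of well-foundedness.

    Read a groupoidal object [A] as a context, a DOF over [A] as a family of sets
    over [A], and a 1-cell [B -> A] as a generalized element of [A] at stage [B].
    Since every DOF is small, the classifier [S] is a universe of all sets, and
    full faithfulness of [El] says that a 2-cell between 1-cells into [S] is a map
    that is natural in the elements ([cell_of_generic], [cell_of_relation]).  In
    this language there are function sets, in the form of the DOF of 2-cells between
    two 1-cells ([cell_object]), and universal quantification, because the elements
    over which a map of sets becomes bijective form a subobject
    ([bijectivity_locus]).  Graphs, that is pairs of parallel maps of sets, are
    classified by a groupoidal object in which 2-cells are isomorphisms of graphs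
    ([graph_classifier_ex]).

    Fix a groupoidal [K] and a monic DOF [phi : F -> K]: a proposition [F] in
    context [K].  A vertex [x] of a graph has the segment of all [y < x].  A graph
    is called good if [<] is a transitive relation, if vertices with isomorphic
    segments are equal, and if each of the following implies [F]: that [x < x] for
    some vertex [x], and that the graph is isomorphic to one of its own segments.
    - A good graph has no automorphism but the identity, since an automorphism
      preserves the segment of each vertex ([good_rigid]).  Hence the projection to
      [K] from the object of good graphs is a SOF ([rep_sof]), and the smallness
      hypothesis on SOFs replaces it by a DOF [O] over [K]: the set of isomorphism
      classes of good graphs.
    - [O] is itself a graph, with [b < a] when [b] is a segment of [a].  Segments of
      segments are segments ([seg_included]), so each [a] in [O] is isomorphic, as a
      graph, to the segment of [O] below [a] ([elt_seg]).  It follows that [O] is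
      good ([aO_good]).
    - So [O] has a class in [O], and is isomorphic to its own segment below that
      class.  As [O] is good, [F] holds ([monic_dof_split]).

    Every proposition therefore holds in every groupoidal context.  Applied to
    diagonals, this makes every DOF over a groupoidal object invertible
    ([dof_split]); applied to the DOFs of 2-cells, it gives exactly one 2-cell
    between any two parallel 1-cells out of a groupoidal object ([cell_from_gpd]).
    Every object is a quotient of its nerve, which consists of groupoidal objects,
    so the same holds for all 1-cells ([cell_from_any]).  Then each [Z] is a SOF
    over the terminal object, hence equivalent to a DOF, hence has a point
    ([point_ex]), and every hom-category is equivalent to the terminal one. *)

Set Implicit Arguments.
Unset Strict Implicit.
Unset Printing Implicit Defensive.

(** * Arrows with propositionally equal ends *)

Section PackedArrows.
Context {K : category}.

Lemma arr_cmp {x y z x' y' z' : K} (f : hom x y) (g : hom y z)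
    (f' : hom x' y') (g' : hom y' z') :
  f ≈ f' -> g ≈ g' -> f • g ≈ f' • g'.
Proof.
move=> ef eg; have [ex ey] := arr_srcE ef; have [_ ez] := arr_srcE eg.
subst x' y' z'; by rewrite (arr_inj ef) (arr_inj eg).
Qed.

Lemma arr_cast {x y x' y' : K} (f : hom x y) :
  x = x' -> y = y' -> exists f' : hom x' y', f' ≈ f.
Proof. by move=> <- <-; exists f. Qed.

Lemma is_iso_arr {x y x' y' : K} (f : hom x y) (f' : hom x' y') :
  f ≈ f' -> is_iso f -> is_iso f'.
Proof.
move=> ef; have [ex ey] := arr_srcE ef; subst x' y'; by rewrite (arr_inj ef).
Qed.

Lemma iso_id (x : K) : is_iso (idm x).
Proof. by exists (idm x); rewrite cmp_idl. Qed.

Lemma iso_epi {x y z : K} (f : hom x y) (g h : hom y z) :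
  is_iso f -> f • g = f • h -> g = h.
Proof.
by move=> [f' [_ f'f]] e; rewrite -[g]cmp_idl -[h]cmp_idl -f'f !cmp_assoc e.
Qed.

Lemma iso_mono {x y z : K} (f : hom y z) (g h : hom x y) :
  is_iso f -> g • f = h • f -> g = h.
Proof.
by move=> [f' [ff' _]] e; rewrite -[g]cmp_idr -[h]cmp_idr -ff' -!cmp_assoc e.
Qed.

End PackedArrows.

Lemma fmap_arr {K L : category} (F : functor K L) {x y x' y' : K} (f : hom x y) (f' : hom x' y') :
  f ≈ f' -> fmap F f ≈ fmap F f'.
Proof. exact: (f_equal (fun_arr F)). Qed.

Lemma fmap_iso {K L : category} (F : functor K L) {x y : K} (f : hom x y) :
  is_iso f -> is_iso (fmap F f).
Proof.
by move=> [g [fg gf]]; exists (fmap F g); rewrite -!fmap_cmp fg gf !fmap_id.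
Qed.

(** * Transport of elements along 2-cells *)

Section Whiskering.
Context {C : two_category}.

Lemma wl_arr {X Y Z : C} (f : hc X Y) {g h g' h' : hc Y Z} (b : hom g h) (b' : hom g' h') :
  b ≈ b' -> f ◃ b ≈ f ◃ b'.
Proof. exact: (fmap_arr (pre f Z)). Qed.

Lemma wr_arr {X Y Z : C} {f g f' g' : hc X Y} (a : hom f g) (a' : hom f' g') (h : hc Y Z) :
  a ≈ a' -> a ▹ h ≈ a' ▹ h.
Proof. exact: (fmap_arr (post X h)). Qed.

Lemma wl_eq {X Y Z : C} (f f' : hc X Y) {g h : hc Y Z} (b : hom g h) : f = f' -> f ◃ b ≈ f' ◃ b.
Proof. by move=> ->. Qed.

Lemma wr_eq {X Y Z : C} {f g : hc X Y} (a : hom f g) (h h' : hc Y Z) : h = h' -> a ▹ h ≈ a ▹ h'.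
Proof. by move=> ->. Qed.

Lemma wr_iso {X Y Z : C} {f g : hc X Y} (a : hom f g) (h : hc Y Z) : is_iso a -> is_iso (a ▹ h).
Proof. exact: (fmap_iso (post X h)). Qed.

(** When [q] is a DOF, [carries q t] is the graph of the transport along [t], a
    function from the elements of [X] over [a] to those over [b].  It is a relation
    between 1-cells, so no equation between dependent 2-cells has to be cast. *)
Definition carries {A X B : C} (q : hc X A) {a b : hc B A} (t : hom a b) (x y : hc B X) : Prop :=
  exists c : hom x y, c ▹ q ≈ t.

Section Over.
Context {A X : C} (q : hc X A).

Lemma carries_ends {B : C} {a b : hc B A} (t : hom a b) (x y : hc B X) :
  carries q t x y -> x ⋅ q = a /\ y ⋅ q = b.
Proof. by move=> [c /arr_srcE]. Qed.

Lemma carries_as {B : C} {a b a' b' : hc B A} (t : hom a b) (t' : hom a' b') (x x' y y' : hc B X) :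
  carries q t x y -> t ≈ t' -> x = x' -> y = y' -> carries q t' x' y'.
Proof. by move=> [c cE] e <- <-; exists c; rewrite cE. Qed.

Lemma carries_arr {B : C} {a b a' b' : hc B A} (t : hom a b) (t' : hom a' b') (x y : hc B X) :
  t ≈ t' -> carries q t x y -> carries q t' x y.
Proof. by move=> e o; apply: carries_as o e _ _. Qed.

Lemma carries_id {B : C} (x : hc B X) (a : hc B A) : x ⋅ q = a -> carries q (idm a) x x.
Proof. by move=> <-; exists (idm x); rewrite wr_id. Qed.

Lemma carries_cmp {B : C} {a b c : hc B A} (s : hom a b) (t : hom b c) (x y z : hc B X) :
  carries q s x y -> carries q t y z -> carries q (s • t) x z.
Proof.
move=> [u uE] [v vE]; exists (u • v); rewrite wr_cmp; exact: arr_cmp.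
Qed.

Lemma carries_pre {B D : C} (f : hc D B) {a b : hc B A} (t : hom a b) (x y : hc B X) :
  carries q t x y -> carries q (f ◃ t) (f ⋅ x) (f ⋅ y).
Proof.
by move=> [c cE]; exists (f ◃ c); rewrite wlr_assoc; apply: wl_arr.
Qed.

Lemma carries_post {Y B : C} (u : hc X Y) (r : hc Y A) {a b : hc B A} (t : hom a b) (x y : hc B X) :
  u ⋅ r = q -> carries q t x y -> carries r t (x ⋅ u) (y ⋅ u).
Proof. by move=> <- [c cE]; exists (c ▹ u); rewrite wr_assoc. Qed.

Context (dofq : is_DOF q).

Lemma carries_ex {B : C} {a b : hc B A} (t : hom a b) (x : hc B X) :
  x ⋅ q = a -> exists y, carries q t x y.
Proof.
move=> e; subst a; have [y [c [cE _]]] := @dofq B x b t; by exists y, c.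
Qed.

(** The two lifts may have different targets, so that this also compares these
    targets. *)
Lemma lift_uniq {B : C} {a b : hc B A} (t : hom a b) (x y y' : hc B X) (c : hom x y) (c' : hom x y') :
  c ▹ q ≈ t -> c' ▹ q ≈ t -> c ≈ c'.
Proof.
move=> cE c'E; have [ea _] := arr_srcE cE; subst a.
have [z [d [_ U]]] := @dofq B x b t.
by rewrite (U _ c cE) (U _ c' c'E).
Qed.

Lemma carries_fun {B : C} {a b : hc B A} (t : hom a b) (x y y' : hc B X) :
  carries q t x y -> carries q t x y' -> y = y'.
Proof.
by move=> [c cE] [c' c'E]; have [_ ->] := arr_srcE (lift_uniq cE c'E).
Qed.

Lemma carries_inv {B : C} {a b : hc B A} (t : hom a b) (t' : hom b a) (x y : hc B X) :
  t • t' = idm a -> carries q t x y -> carries q t' y x.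
Proof.
move=> e o; have [ea eb] := carries_ends o.
have [z oz] := carries_ex t' eb.
have oxz := carries_cmp o oz; rewrite e in oxz.
by rewrite -(carries_fun oxz (carries_id ea)) in oz *.
Qed.

Lemma dof_faithful {B : C} (x y : hc B X) (c c' : hom x y) : c ▹ q = c' ▹ q -> c = c'.
Proof.
by move=> e; apply: arr_inj; apply: (lift_uniq (t := c' ▹ q)); rewrite ?e.
Qed.

End Over.
End Whiskering.

(** * Closure properties of DOFs, pullbacks and products *)

Section DOFClosure.
Context {C : two_category}.

Lemma dofI {A X : C} (q : hc X A) :
  (forall (B : C) (a b : hc B A) (t : hom a b) (x : hc B X), x ⋅ q = a -> exists y, carries q t x y) ->
  (forall (B : C) (a b : hc B A) (t : hom a b) (x y y' : hc B X) (c : hom x y) (c' : hom x y'),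
     c ▹ q ≈ t -> c' ▹ q ≈ t -> c ≈ c') ->
  is_DOF q.
Proof.
move=> ex uniq B x b t; have [y [c cE]] := ex B _ b t x erefl.
by exists y, c; split=> // y' c' c'E; apply: uniq c'E cE.
Qed.

(** A lift of the inverse, started at the target of [c], composes with [c] to a lift
    of an identity, which is an identity by uniqueness. *)
Lemma dof_conservative {A X B : C} (q : hc X A) (x y : hc B X) (c : hom x y) :
  is_DOF q -> is_iso (c ▹ q) -> is_iso c.
Proof.
move=> dofq [t' [tt' t't]].
have [z [c' c'E]] := carries_ex dofq t' (erefl (y ⋅ q)).
have e1 : (c • c') ▹ q ≈ idm (x ⋅ q) by rewrite wr_cmp -tt'; apply: arr_cmp.
have e := lift_uniq dofq e1 (f_equal arr (wr_id x q)).
have [_ ez] := arr_srcE e; subst z; have {}e := arr_inj e.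
exists c'; split=> //; apply: (dof_faithful dofq); rewrite wr_cmp wr_id -t't.
by rewrite (arr_inj c'E).
Qed.

Lemma dof_groupoidal {A X : C} (q : hc X A) : is_DOF q -> is_groupoidal A -> is_groupoidal X.
Proof. by move=> dofq gA B x y c; apply: dof_conservative dofq _; apply: gA. Qed.

Lemma dof_isofibration {A X : C} (q : hc X A) : is_DOF q -> is_isofibration q.
Proof.
move=> dofq B x b t iso_t; have [y [c [cE _]]] := dofq B x b t.
by exists y, c; split=> //; apply: dof_conservative dofq _; apply: is_iso_arr iso_t.
Qed.

Lemma dof_id (A : C) : is_DOF (id1 A).
Proof.
apply: dofI => [B a b t x|B a b t x y y' c c'].
  by rewrite h1_idr => e; subst a; exists b, t; rewrite wr_unit.
by rewrite !wr_unit => -> ->.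
Qed.

Lemma dof_comp {A X Y : C} (p : hc X Y) (q : hc Y A) : is_DOF p -> is_DOF q -> is_DOF (p ⋅ q).
Proof.
move=> dofp dofq; apply: dofI => [B a b t x|B a b t x y y' c c'].
  rewrite -h1_assoc => e; have [y [d dE]] := carries_ex dofq t e.
  have [z [c cE]] := carries_ex dofp d (erefl _).
  by exists z, c; rewrite -wr_assoc -dE; apply: wr_arr.
rewrite -!wr_assoc => e e'.
exact: (lift_uniq dofp erefl (esym (lift_uniq dofq e e'))).
Qed.

(** A lift along the composite, of the image of the cell to be lifted, is a lift
    of that cell itself by uniqueness of lifts along [q]. *)
Lemma dof_cancel {A X Y : C} (p : hc X Y) (q : hc Y A) : is_DOF (p ⋅ q) -> is_DOF q -> is_DOF p.
Proof.
move=> dofpq dofq; apply: dofI => [B a b t x|B a b t x y y' c c'] e.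
  have ea : x ⋅ (p ⋅ q) = a ⋅ q by rewrite -h1_assoc e.
  have [z [c cE]] := carries_ex dofpq (t ▹ q) ea.
  exists z, c; have {}cE : c ▹ p ▹ q ≈ t ▹ q by rewrite wr_assoc.
  by subst a; apply: (lift_uniq dofq cE).
move=> e'; apply: (lift_uniq (t := t ▹ q) dofpq); rewrite -wr_assoc; exact: wr_arr.
Qed.

(** Pullbacks in the underlying 1-category.  Where one leg is a DOF, transport of its
    elements accounts for 2-cells. *)
Definition pullback1 {P X Y Z : C} (p1 : hc P X) (p2 : hc P Y) (f : hc X Z) (g : hc Y Z) : Prop :=
  p1 ⋅ f = p2 ⋅ g /\
  forall (B : C) (u : hc B X) (v : hc B Y), u ⋅ f = v ⋅ g ->
    exists! w : hc B P, w ⋅ p1 = u /\ w ⋅ p2 = v.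

Section Pullback.
Context {P X Y Z : C} {p1 : hc P X} {p2 : hc P Y} {f : hc X Z} {g : hc Y Z}.

Lemma pb_ex (pb : pullback1 p1 p2 f g) {B : C} (u : hc B X) (v : hc B Y) :
  u ⋅ f = v ⋅ g -> exists w : hc B P, w ⋅ p1 = u /\ w ⋅ p2 = v.
Proof. by case: pb => _ U /U[w [? _]]; exists w. Qed.

Lemma pb_ext (pb : pullback1 p1 p2 f g) {B : C} (w w' : hc B P) :
  w ⋅ p1 = w' ⋅ p1 -> w ⋅ p2 = w' ⋅ p2 -> w = w'.
Proof.
case: pb => e U e1 e2; have /U[w0 [_ W]] : (w' ⋅ p1) ⋅ f = (w' ⋅ p2) ⋅ g.
  by rewrite !h1_assoc e.
by rewrite -(W w') // -(W w).
Qed.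

Lemma pb_sq (pb : pullback1 p1 p2 f g) {B : C} (w : hc B P) : w ⋅ p1 ⋅ f = w ⋅ p2 ⋅ g.
Proof. by case: pb => e _; rewrite !h1_assoc e. Qed.

Lemma strict_pb (pb : is_strict_pullback p1 p2 f g) : pullback1 p1 p2 f g.
Proof. by case: pb => e U; split=> // B u v /=; have [_ + _] := U B; apply. Qed.

(** The ends of the induced 2-cell are prescribed up to propositional equality. *)
Lemma strict_pb_cell (pb : is_strict_pullback p1 p2 f g) {B : C} (w w' : hc B P)
    {a b : hc B X} (s : hom a b) {c d : hc B Y} (t : hom c d) :
  w ⋅ p1 = a -> w ⋅ p2 = c -> w' ⋅ p1 = b -> w' ⋅ p2 = d ->
  s ▹ f ≈ t ▹ g -> exists r : hom w w', r ▹ p1 ≈ s /\ r ▹ p2 ≈ t.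
Proof.
move=> wa wc w'b w'd e; have [_ _ U] := pb.2 B.
have [[x y r] [[/= r1 r2] _]] := U (arr s) (arr t) e.
have [/= ea eb] := arr_srcE r1; have [/= ec ed] := arr_srcE r2.
have ex : x = w by apply: (pb_ext (strict_pb pb)); congruence.
have ey : y = w' by apply: (pb_ext (strict_pb pb)); congruence.
by subst x y; exists r.
Qed.

Lemma strict_pb_cell_ext (pb : is_strict_pullback p1 p2 f g) {B : C} {w x w' x' : hc B P}
    (r : hom w x) (r' : hom w' x') :
  r ▹ p1 ≈ r' ▹ p1 -> r ▹ p2 ≈ r' ▹ p2 -> r ≈ r'.
Proof.
move=> e1 e2; have [[_ sq] _ U] := pb.2 B.
have [[y z s] [_ S]] := U (arr (r ▹ p1)) (arr (r ▹ p2)) (sq (arr r)).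
by rewrite -(S (arr r)) // -(S (arr r')).
Qed.

Lemma strict_pb_dof : is_strict_pullback p1 p2 f g -> is_DOF g -> is_DOF p1.
Proof.
move=> pb dofg; apply: dofI => [B a b t x ea|B a b t x y y' c c' e e'].
  have eg : x ⋅ p2 ⋅ g = a ⋅ f by rewrite -ea (pb_sq (strict_pb pb)).
  have [v [c cE]] := carries_ex dofg (t ▹ f) eg.
  have [_ ev] := arr_srcE cE.
  have [y [y1 y2]] := pb_ex (strict_pb pb) (esym ev).
  have [r [r1 _]] := strict_pb_cell pb ea erefl y1 y2 (esym cE).
  by exists y, r.
apply: (strict_pb_cell_ext pb); first by rewrite e.
have sq (z : hc B P) (d : hom x z) : d ▹ p1 ≈ t -> d ▹ p2 ▹ g ≈ t ▹ f.
  by move=> dE; rewrite wr_assoc -pb.1 -wr_assoc; apply: wr_arr.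
exact: (lift_uniq dofg (sq _ _ e) (sq _ _ e')).
Qed.

End Pullback.

Definition monic {X Y : C} (f : hc X Y) : Prop :=
  forall (B : C) (u v : hc B X), u ⋅ f = v ⋅ f -> u = v.

Context (HC : corepita C).

Lemma dof_pb {A B X : C} (q : hc X A) (f : hc B A) : is_DOF q ->
  exists (P : C) (p1 : hc P B) (p2 : hc P X), is_DOF p1 /\ pullback1 p1 p2 f q.
Proof.
case: HC => _ pbs _ _ dofq.
have [P [p1 [p2 pb]]] := pbs _ _ _ f q (dof_isofibration dofq).
by exists P, p1, p2; split; [apply: strict_pb_dof pb dofq | apply: strict_pb].
Qed.

Lemma terminal_isofibration {X T : C} (t : hc X T) : is_strict_terminal T -> is_isofibration t.
Proof.
move=> TT B x y f _; exists x, (idm x); split; first exact: iso_id.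
by have [_ [a [_ U]]] := TT B; rewrite /= -(U (arr f)) // -(U (arr _)).
Qed.

(** A pullback over the terminal object, every 1-cell to which is an
    isofibration. *)
Lemma product_ex (X Y : C) : exists (P : C) (p1 : hc P X) (p2 : hc P Y), is_strict_product p1 p2.
Proof.
case: HC => [[T TT]] pbs _ _.
have [[x [_ _]] _] := TT X; have [[y [_ _]] _] := TT Y.
have [P [p1 [p2 [e pb]]]] := pbs _ _ _ x y (terminal_isofibration TT).
exists P, p1, p2 => A; have [_ U V] := pb A; have [[z [_ Z]] [c [_ W]]] := TT A.
split=> [u v|a b]; first by apply: U; rewrite -(Z (_ u)) // -(Z (_ v)).
by apply: V; rewrite -(W (fun_arr _ a)) // -(W (fun_arr _ b)).
Qed.

End DOFClosure.

Section Product.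
Context {C : two_category} {P X Y : C} {p1 : hc P X} {p2 : hc P Y} (pr : is_strict_product p1 p2).

Lemma prod_ex {B : C} (u : hc B X) (v : hc B Y) : exists w : hc B P, w ⋅ p1 = u /\ w ⋅ p2 = v.
Proof. by have [/(_ u v)[w [? _]] _] := pr B; exists w. Qed.

Lemma prod_ext {B : C} (w w' : hc B P) : w ⋅ p1 = w' ⋅ p1 -> w ⋅ p2 = w' ⋅ p2 -> w = w'.
Proof.
have [/(_ (w' ⋅ p1) (w' ⋅ p2))[w0 [_ W]] _] := pr B.
by move=> e1 e2; rewrite -(W w') // -(W w).
Qed.

Lemma prod_cell {B : C} {w w' : hc B P} {a b : hc B X} {c d : hc B Y} (s : hom a b) (t : hom c d) :
  w ⋅ p1 = a -> w ⋅ p2 = c -> w' ⋅ p1 = b -> w' ⋅ p2 = d ->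
  exists r : hom w w', r ▹ p1 ≈ s /\ r ▹ p2 ≈ t.
Proof.
move=> wa wc w'b w'd; have [_ U] := pr B.
have [[x y r] [[/= r1 r2] _]] := U (arr s) (arr t).
have [/= ea eb] := arr_srcE r1; have [/= ec ed] := arr_srcE r2.
have ex : x = w by apply: prod_ext; congruence.
have ey : y = w' by apply: prod_ext; congruence.
by subst x y; exists r.
Qed.

Lemma prod_cell_ext {B : C} {w x w' x' : hc B P} (r : hom w x) (r' : hom w' x') :
  r ▹ p1 ≈ r' ▹ p1 -> r ▹ p2 ≈ r' ▹ p2 -> r ≈ r'.
Proof.
move=> e1 e2; have [_ U] := pr B.
have [a [_ S]] := U (arr (r ▹ p1)) (arr (r ▹ p2)).
by rewrite -(S (arr r)) // -(S (arr r')).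
Qed.

Lemma prod_iso {B : C} {w w' : hc B P} (r : hom w w') :
  is_iso (r ▹ p1) -> is_iso (r ▹ p2) -> is_iso r.
Proof.
move=> [s [rs sr]] [t [rt tr]].
have [r' [r1 r2]] := prod_cell s t erefl erefl erefl erefl.
exists r'; split; apply: arr_inj; apply: prod_cell_ext; rewrite wr_cmp wr_id.
- by rewrite (arr_inj r1) rs.
- by rewrite (arr_inj r2) rt.
- by rewrite (arr_inj r1) sr.
by rewrite (arr_inj r2) tr.
Qed.

Lemma prod_groupoidal : is_groupoidal X -> is_groupoidal Y -> is_groupoidal P.
Proof. by move=> gX gY B w w' r; apply: prod_iso; [apply: gX | apply: gY]. Qed.

End Product.

(** * The object of 2-cells between two 1-cells *)

Section ArrowObject.
Context {C : two_category} {X XA : C} {d0 d1 : hc XA X} {d : d0 ⟹ d1}.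
Context (AO : is_strict_arrow_object d).

Lemma ao_ex {B : C} {a b : hc B X} (t : hom a b) : exists f : hc B XA, f ◃ d ≈ t.
Proof. by have [/(_ (arr t))[f [fE _]] _] := AO B; exists f. Qed.

Lemma ao_ext {B : C} (f g : hc B XA) : f ◃ d ≈ g ◃ d -> f = g.
Proof.
by have [/(_ (arr (g ◃ d)))[k [_ U]] _] := AO B => e; rewrite -(U f e) -(U g).
Qed.

Lemma ao_cell {B : C} {f g : hc B XA} (u : f ⋅ d0 ⟹ g ⋅ d0) (v : f ⋅ d1 ⟹ g ⋅ d1) :
  u • (g ◃ d) = (f ◃ d) • v -> exists t : f ⟹ g, t ▹ d0 = u /\ t ▹ d1 = v.
Proof. by have [_ U] := AO B => /U[t [? _]]; exists t. Qed.

Lemma ao_cell_ext {B : C} {f g : hc B XA} (s t : f ⟹ g) :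
  s ▹ d0 = t ▹ d0 -> s ▹ d1 = t ▹ d1 -> s = t.
Proof.
have [_ U] := AO B => e0 e1.
have [r [_ R]] := U f g (t ▹ d0) (t ▹ d1) (Defs.interchange t d).
by rewrite -(R s) // -(R t).
Qed.

Lemma ao_iso {B : C} {f g : hc B XA} (t : f ⟹ g) : is_iso (t ▹ d0) -> is_iso (t ▹ d1) -> is_iso t.
Proof.
move=> [u [tu ut]] [v [tv vt]].
have sq : u • (f ◃ d) = (g ◃ d) • v.
  apply: (@iso_epi _ _ _ _ (t ▹ d0)); first by exists u.
  rewrite -!cmp_assoc tu cmp_idl.
  apply: (@iso_mono _ _ _ _ (t ▹ d1)); first by exists v.
  by rewrite !cmp_assoc vt cmp_idr -Defs.interchange.
have [s [s0 s1]] := ao_cell sq.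
by exists s; split; apply: ao_cell_ext; rewrite wr_cmp wr_id ?s0 ?s1.
Qed.

(** An invertible pair of 2-cells out of the ends of an arrow is lifted by
    conjugating the arrow with it. *)
Lemma arrow_object_isofibration {P : C} {p0 p1 : hc P X} {m : hc XA P} :
  is_strict_product p0 p1 -> m ⋅ p0 = d0 -> m ⋅ p1 = d1 -> is_isofibration m.
Proof.
move=> pr m0 m1 B x y t iso_t; rewrite /= in t iso_t *.
have e0 : x ⋅ m ⋅ p0 = x ⋅ d0 by rewrite h1_assoc m0.
have e1 : x ⋅ m ⋅ p1 = x ⋅ d1 by rewrite h1_assoc m1.
have [u uE] := arr_cast (t ▹ p0) e0 erefl.
have [v vE] := arr_cast (t ▹ p1) e1 erefl.
have iso_u : is_iso u by apply: is_iso_arr (esym uE) _; apply: wr_iso.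
have iso_v : is_iso v by apply: is_iso_arr (esym vE) _; apply: wr_iso.
have [u' [uu' u'u]] := iso_u.
have [f fE] := ao_ex (u' • (x ◃ d) • v).
have [f0 f1] := arr_srcE fE.
have [u1 u1E] := arr_cast u erefl (esym f0).
have [v1 v1E] := arr_cast v erefl (esym f1).
have sq : u1 • (f ◃ d) = (x ◃ d) • v1.
  apply: arr_inj; rewrite (arr_cmp u1E fE) (arr_cmp erefl v1E).
  by rewrite cmp_assoc -cmp_assoc uu' cmp_idl.
have [s [s0 s1]] := ao_cell sq.
exists f, s; split.
  by apply: ao_iso; rewrite ?s0 ?s1; [apply: is_iso_arr (esym u1E) _|apply: is_iso_arr (esym v1E) _].
apply: (prod_cell_ext pr); rewrite wr_assoc.
  by rewrite m0 s0 u1E.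
by rewrite m1 s1 v1E.
Qed.

End ArrowObject.

Section HomObject.
Context {C : two_category} (HC : corepita C).

(** The universal property of the set of maps from [a] to [b], stated for stages [B]
    over [A]; [eta] is the generic map. *)
Definition represents_cells {A W H : C} (a b : hc A W) (h : hc H A) (eta : h ⋅ a ⟹ h ⋅ b) : Prop :=
  is_DOF h /\ forall (B : C) (f : hc B A) (t : f ⋅ a ⟹ f ⋅ b),
    exists! g : hc B H, g ⋅ h = f /\ g ◃ eta ≈ t.

(** The pullback of [W^-> -> W * W] along [(a, b)].  A 2-cell in the groupoidal base
    [A] is invertible, so it acts on maps from [a] to [b] by conjugation; this action
    is the unique lifting that makes the pullback a DOF. *)
Lemma cell_object {A W : C} (a b : hc A W) : is_groupoidal A ->
  exists (H : C) (h : hc H A) (eta : h ⋅ a ⟹ h ⋅ b), represents_cells eta.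
Proof.
move=> gA; case: (HC) => _ pbs /(_ W)[WA [d0 [d1 [d AO]]]] _.
have [P [p0 [p1 pr]]] := product_ex HC W W.
have [m [m0 m1]] := prod_ex pr d0 d1.
have [ab [ab0 ab1]] := prod_ex pr a b.
have [H [h [k pb]]] := pbs _ _ _ ab m (arrow_object_isofibration AO pr m0 m1).
have hk : h ⋅ ab = k ⋅ m := pb.1.
have ha : h ⋅ a = k ⋅ d0 by rewrite -ab0 -m0 -!h1_assoc hk.
have hb : h ⋅ b = k ⋅ d1 by rewrite -ab1 -m1 -!h1_assoc hk.
have [eta etaE] := arr_cast (k ◃ d) (esym ha) (esym hb).
have etaK (B : C) (g : hc B H) : g ◃ eta ≈ (g ⋅ k) ◃ d.
  by rewrite -wl_assoc; apply: wl_arr.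
have U (B : C) (f : hc B A) (t : f ⋅ a ⟹ f ⋅ b) :
    exists! g : hc B H, g ⋅ h = f /\ g ◃ eta ≈ t.
  have [l lE] := ao_ex AO t; have [l0 l1] := arr_srcE lE.
  have e : f ⋅ ab = l ⋅ m.
    by apply: (prod_ext pr); rewrite !h1_assoc ?ab0 ?ab1 ?m0 ?m1.
  have [g [gh gk]] := pb_ex (strict_pb pb) e.
  exists g; split=> [|g' [g'h g'E]]; first by rewrite etaK gk.
  apply: (pb_ext (strict_pb pb)); first by rewrite gh.
  by apply: (ao_ext AO); rewrite gk lE -etaK g'E.
exists H, h, eta; split=> //; apply: dofI => [B f f' t x ex|B f f' t x y y' c c' e e'].
  subst f; have iso_t : is_iso t by apply: gA.
  have [ta [tta _]] := wr_iso a iso_t.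
  have [xe xeE] := arr_cast (x ◃ eta) (esym (h1_assoc x h a)) (esym (h1_assoc x h b)).
  (* The map at the target of the lift is the conjugate of the map [x] by [t]. *)
  have [y [[yh yE] _]] := U B f' (ta • xe • (t ▹ b)).
  have x0 : x ⋅ h ⋅ a = x ⋅ k ⋅ d0 by rewrite !h1_assoc ha.
  have x1 : x ⋅ h ⋅ b = x ⋅ k ⋅ d1 by rewrite !h1_assoc hb.
  have y0 : f' ⋅ a = y ⋅ k ⋅ d0 by rewrite -yh !h1_assoc ha.
  have y1 : f' ⋅ b = y ⋅ k ⋅ d1 by rewrite -yh !h1_assoc hb.
  have [u uE] := arr_cast (t ▹ a) x0 y0.
  have [v vE] := arr_cast (t ▹ b) x1 y1.
  have [s [s0 s1]] : exists s : x ⋅ k ⟹ y ⋅ k, s ▹ d0 = u /\ s ▹ d1 = v.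
    apply: (ao_cell AO); apply: arr_inj.
    have xE : (x ⋅ k) ◃ d ≈ xe by rewrite -etaK.
    have {}yE : (y ⋅ k) ◃ d ≈ ta • xe • (t ▹ b) by rewrite -etaK.
    rewrite (arr_cmp uE yE) (arr_cmp xE vE).
    by rewrite -!cmp_assoc tta cmp_idl.
  have e : t ▹ ab ≈ s ▹ m.
    by apply: (prod_cell_ext pr); rewrite !wr_assoc ?ab0 ?ab1 ?m0 ?m1 ?s0 ?s1.
  have [r [r1 _]] := strict_pb_cell pb erefl erefl yh erefl e.
  by exists y, r.
have [ex' _] := arr_srcE e; subst f.
have [xe xeE] := arr_cast (x ◃ eta) (esym (h1_assoc x h a)) (esym (h1_assoc x h b)).
have det z (c0 : hom x z) (za : hom (f' ⋅ a) (f' ⋅ b)) : c0 ▹ h ≈ t -> z ◃ eta ≈ za ->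
    (t ▹ a) • za = xe • (t ▹ b).
  move=> c0E zE; apply: arr_inj.
  have -> : (t ▹ a) • za ≈ (c0 ▹ (h ⋅ a)) • (z ◃ eta).
    by apply: arr_cmp; [rewrite -wr_assoc; apply: wr_arr|].
  have -> : xe • (t ▹ b) ≈ (x ◃ eta) • (c0 ▹ (h ⋅ b)).
    by apply: arr_cmp; [|rewrite -wr_assoc; apply: wr_arr].
  by rewrite Defs.interchange.
have eb z (c0 : hom x z) : c0 ▹ h ≈ t -> z ⋅ h = f' by move/arr_srcE => [].
have [ye yeE] := arr_cast (y ◃ eta) (etrans (esym (h1_assoc y h a)) (f_equal (fun g => g ⋅ a) (eb _ _ e)))
                        (etrans (esym (h1_assoc y h b)) (f_equal (fun g => g ⋅ b) (eb _ _ e))).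
have [ye' ye'E] := arr_cast (y' ◃ eta) (etrans (esym (h1_assoc y' h a)) (f_equal (fun g => g ⋅ a) (eb _ _ e')))
                        (etrans (esym (h1_assoc y' h b)) (f_equal (fun g => g ⋅ b) (eb _ _ e'))).
(* Interchange forces the maps at the targets of the two lifts to be equal. *)
have eye : ye = ye'.
  apply: (@iso_epi _ _ _ _ (t ▹ a)); first by apply: wr_iso; apply: gA.
  by rewrite (det _ c) // (det _ c').
have ey : y = y'.
  have [w [_ Wu]] := U B f' ye.
  rewrite -(Wu y) ?(eb _ _ e) // -(Wu y') ?(eb _ _ e') // eye.
  by split=> //; rewrite ye'E.
subst y'.
apply: (strict_pb_cell_ext pb); first by rewrite e.
have kE (c0 : hom x y) : c0 ▹ h ≈ t -> c0 ▹ k ▹ d0 ≈ t ▹ a /\ c0 ▹ k ▹ d1 ≈ t ▹ b.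
  by move=> c0E; rewrite !wr_assoc -ha -hb -!wr_assoc; split; apply: wr_arr.
have [e0 e1] := kE _ e; have [e0' e1'] := kE _ e'.
by rewrite (ao_cell_ext AO (arr_inj (etrans e0 (esym e0'))) (arr_inj (etrans e1 (esym e1')))).
Qed.

Lemma represents_cells_ex {A W H : C} {a b : hc A W} {h : hc H A} {eta : h ⋅ a ⟹ h ⋅ b} :
  represents_cells eta -> forall (B : C) (f : hc B A) (t : f ⋅ a ⟹ f ⋅ b),
  exists g : hc B H, g ⋅ h = f /\ g ◃ eta ≈ t.
Proof. by move=> [_ U] B f t; have [g [? _]] := U B f t; exists g. Qed.

Lemma represents_cells_ext {A W H : C} {a b : hc A W} {h : hc H A} {eta : h ⋅ a ⟹ h ⋅ b} :
  represents_cells eta -> forall (B : C) (g g' : hc B H),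
  g ⋅ h = g' ⋅ h -> g ◃ eta ≈ g' ◃ eta -> g = g'.
Proof.
move=> [_ U] B g g' e eE.
have [t tE] := arr_cast (g' ◃ eta) (esym (h1_assoc g' h a)) (esym (h1_assoc g' h b)).
by have [k [_ K]] := U B _ t; rewrite -(K g) ?e ?tE // -(K g') ?tE.
Qed.

(** Transport in the set of maps is conjugation: the target of a lift is found by
    checking a naturality square. *)
Lemma represents_cells_carries {A W H : C} {a b : hc A W} {h : hc H A} {eta : h ⋅ a ⟹ h ⋅ b} :
  represents_cells eta -> forall (B : C) (f f' : hc B A) (t : f ⟹ f')
    (u : f ⋅ a ⟹ f ⋅ b) (u' : f' ⋅ a ⟹ f' ⋅ b) (g g' : hc B H),
  is_iso t -> g ⋅ h = f -> g ◃ eta ≈ u -> g' ⋅ h = f' -> g' ◃ eta ≈ u' ->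
  (t ▹ a) • u' = u • (t ▹ b) -> carries h t g g'.
Proof.
move=> rep B f f' t u u' g g' iso_t gh gE g'h g'E sq.
have [y o] := carries_ex rep.1 t gh; have [_ yh] := carries_ends o; have [c cE] := o.
suff -> : g' = y by [].
apply: (represents_cells_ext rep); first by rewrite g'h.
have [v vE] := arr_cast (y ◃ eta) (etrans (esym (h1_assoc y h a)) (f_equal (fun k => k ⋅ a) yh))
                        (etrans (esym (h1_assoc y h b)) (f_equal (fun k => k ⋅ b) yh)).
rewrite g'E -vE; congr arr; apply: (iso_epi (wr_iso a iso_t)); rewrite sq; apply: arr_inj.
have -> : u • (t ▹ b) ≈ (g ◃ eta) • (c ▹ (h ⋅ b)).
  by apply: arr_cmp; [|rewrite -wr_assoc; apply: wr_arr].
rewrite -Defs.interchange; apply: arr_cmp; last by [].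
by rewrite -wr_assoc; apply: wr_arr.
Qed.

End HomObject.

(** * Elements of small sets *)

Lemma dof_sof {C : two_category} {X Y : C} (q : hc X Y) : is_DOF q -> is_SOF q.
Proof.
move=> dofq A; split=> [x y f g|x y f|x y f y0 y1 f0 f1 e0 e1].
- exact: dof_faithful.
- by have [z [c [cE _]]] := dofq A x y f; exists z, c.
have e := lift_uniq dofq e0 e1; have [_ ey] := arr_srcE e; subst y1.
have [_ /= e2] := arr_srcE e0.
exists (idm y0); split=> [|g [_ gE]].
  by rewrite cmp_idr (arr_inj e) /= wr_id e2.
by apply: (dof_faithful dofq); apply: arr_inj; rewrite gE wr_id e2.
Qed.

(** SOF-morphisms into a DOF are identified only if they are equal, because the
    identity has only the identity as a lift. *)
Lemma sof_hom_eq_dof {C : two_category} {A X Y : C} (p : hc X A) (q : hc Y A) (f f' : hc X Y) :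
  is_DOF q -> SOF_hom_eq p q f f' -> f = f'.
Proof.
move=> dofq [a aE]; have [e _] := arr_srcE aE.
have o : carries q (idm p) f f' by exists a.
by rewrite (carries_fun dofq o (carries_id e)).
Qed.

Section Classifier.
Context {C : two_category} (S : DOF_classifier C).
Context (small : forall (A X : C) (q : hc X A), is_SOF q -> SOF_small S q).
Local Notation p := (cl_map S).
Local Notation El A := (cl_El S A).

(** An isomorphism in SOF(A) between two DOFs is a strict one, so that smallness
    exhibits [q] as a base change of [p]. *)
Lemma classify {A X : C} (q : hc X A) : is_DOF q ->
  exists (s : hc A (cl_base S)) (e : hc X (cl_total S)), pullback1 q e s p.
Proof.
move=> dofq; have [Y [[s [[i iY] [[j jE] [ij ji]]]] [f [g [fq gq fgE gfE]]]]] := small (dof_sof dofq).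
rewrite /= in i iY j jE ij ji.
have fg : f ⋅ g = id1 X := sof_hom_eq_dof dofq fgE.
have gf : g ⋅ f = id1 (dof_dom Y) := sof_hom_eq_dof (@dof_is _ _ Y) gfE.
have {}ij : i ⋅ j = id1 _ := f_equal sval ij.
have {}ji : j ⋅ i = id1 _ := f_equal sval ji.
pose F := El A; have pb : pullback1 _ _ s p := strict_pb (El_pullback F s).
have toE : f ⋅ j ⋅ dof_map (El A s) = q by rewrite h1_assoc jE fq.
have fromE : i ⋅ g ⋅ q = dof_map (El A s) by rewrite h1_assoc gq iY.
have tofrom : (f ⋅ j) ⋅ (i ⋅ g) = id1 X.
  by rewrite h1_assoc -(h1_assoc j) ji h1_idl fg.
have fromto : (i ⋅ g) ⋅ (f ⋅ j) = id1 _.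
  by rewrite h1_assoc -(h1_assoc g) gf h1_idl ij.
exists s, (f ⋅ j ⋅ El_proj F s); split; first by rewrite -{1}toE !h1_assoc pb.1.
move=> B a b e; have [w [w1 w2]] := pb_ex pb e.
exists (w ⋅ (i ⋅ g)); split=> [|w' [w'1 w'2]].
  split; first by rewrite h1_assoc fromE w1.
  by rewrite -(h1_assoc _ (f ⋅ j)) (h1_assoc w) fromto h1_idr w2.
have e1 : w' ⋅ (f ⋅ j) = w.
  apply: (pb_ext pb); first by rewrite h1_assoc toE w1.
  by rewrite h1_assoc w2.
by rewrite -e1 h1_assoc tofrom h1_idr.
Qed.

(** Full faithfulness of [El] in terms of elements: a map of sets is determined by,
    and may be prescribed through, its value [y] at the generic element of [s]. *)
Lemma El_cell {A : C} (s t : hc A (cl_base S)) (y : hc (dof_dom (El A s)) (cl_total S)) :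
  y ⋅ p = dof_map (El A s) ⋅ t ->
  exists! c : s ⟹ t, carries p (dof_map (El A s) ◃ c) (El_proj (El A) s) y.
Proof.
move=> e; have [g [g1 g2]] := pb_ex (strict_pb (El_pullback (El A) t)) (esym e).
have [c [cE U]] := cl_ff (exist _ g g1 : @hom (DOF_category A) (El A s) (El A t)).
exists c; split=> [|c' o].
  have [k kE] := El_action (El A) c; rewrite -g2.
  have <- : sval (fmap (El A) c) = g by rewrite cE.
  by exists k.
apply: U; apply: DOF_hom_eq => /=.
have [k kE] := El_action (El A) c'.
apply: (pb_ext (strict_pb (El_pullback (El A) t))).
  by rewrite g1; case: (fmap _ c').
rewrite g2; apply: (carries_fun (@cl_DOF _ S) _ o); by exists k.
Qed.

Lemma cell_of_generic {A X : C} (q : hc X A) (s t : hc A (cl_base S)) (e y : hc X (cl_total S)) :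
  pullback1 q e s p -> y ⋅ p = q ⋅ t -> exists! c : s ⟹ t, carries p (q ◃ c) e y.
Proof.
move=> pb yE; have pbs := strict_pb (El_pullback (El A) s).
have [z [z1 z2]] := pb_ex pb pbs.1; have [z' [z'1 z'2]] := pb_ex pbs pb.1.
have zE : z ⋅ y ⋅ p = dof_map (El A s) ⋅ t by rewrite h1_assoc yE -h1_assoc z1.
have z'z : z' ⋅ z = id1 X.
  by apply: (pb_ext pb); rewrite h1_assoc ?z1 ?z2 ?z'1 ?z'2 h1_idl.
have [c [o U]] := El_cell zE; exists c; split=> [|c' o'].
  by apply: carries_as (carries_pre z' o) _ z'2 _; rewrite ?wl_assoc ?z'1 // -h1_assoc z'z h1_idl.
by apply: U; apply: carries_as (carries_pre z o') _ z2 erefl; rewrite wl_assoc z1.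
Qed.

Lemma cell_ext {A : C} (s t : hc A (cl_base S)) (c c' : s ⟹ t) :
  (forall (B : C) (f : hc B A) (x y : hc B (cl_total S)),
     carries p (f ◃ c) x y -> carries p (f ◃ c') x y) -> c = c'.
Proof.
move=> H; pose q := dof_map (El A s).
have pbs := strict_pb (El_pullback (El A) s).
have [y o] := carries_ex (@cl_DOF _ S) (q ◃ c) (esym pbs.1).
have [_ yE] := carries_ends o.
have [d [_ U]] := El_cell yE.
by rewrite -(U c o) -(U c' (H _ _ _ _ o)).
Qed.

(** One value of the generic element of [s] suffices: by stability of [P], its
    restrictions are values of all the other elements. *)
Lemma cell_of_relation {A : C} (s t : hc A (cl_base S))
    (P : forall B : C, hc B A -> hc B (cl_total S) -> hc B (cl_total S) -> Prop) :
  (forall (B D : C) (g : hc D B) (f : hc B A) x y, P B f x y -> P D (g ⋅ f) (g ⋅ x) (g ⋅ y)) ->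
  (forall (B : C) (f : hc B A) x, x ⋅ p = f ⋅ s -> exists y, y ⋅ p = f ⋅ t /\ P B f x y) ->
  exists c : s ⟹ t, forall (B : C) (f : hc B A) x, x ⋅ p = f ⋅ s ->
    exists y, carries p (f ◃ c) x y /\ P B f x y.
Proof.
move=> stab tot; pose q := dof_map (El A s).
have pbs := strict_pb (El_pullback (El A) s).
have [y [yE Py]] := tot _ q _ (esym pbs.1).
have [c [o _]] := El_cell yE; exists c => B f x xE.
have [w [w1 w2]] := pb_ex pbs (esym xE).
exists (w ⋅ y); split.
  by apply: carries_as (carries_pre w o) _ w2 erefl; rewrite wl_assoc w1.
by rewrite -w1 -w2; apply: stab.
Qed.

(** The inverse is the 2-cell defined by the converse relation. *)
Lemma cell_iso {A : C} (s t : hc A (cl_base S)) (c : s ⟹ t) :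
  (forall (B : C) (f : hc B A) y, y ⋅ p = f ⋅ t -> exists! x, carries p (f ◃ c) x y) ->
  is_iso c.
Proof.
move=> bij.
have dofp := @cl_DOF _ S.
have [||d dE] := @cell_of_relation A t s (fun B f y x => carries p (f ◃ c) x y).
- move=> B D g f x y o; apply: carries_arr (carries_pre g o); exact: wl_assoc.
- move=> B f y yE; have [x [o _]] := bij B f y yE.
  by exists x; split=> //; have [] := carries_ends o.
have cd (B : C) (f : hc B A) x y : carries p (f ◃ c) x y -> carries p (f ◃ d) y x.
  move=> o; have [_ yE] := carries_ends o; have [x' [o1 o2]] := dE B f y yE.
  have [z [_ Z]] := bij B f y yE.
  by rewrite -(Z x o) (Z x' o2).
exists d; split; apply: cell_ext => B f x y; rewrite wl_cmp wl_id => o; have [xE _] := carries_ends o.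
  have [z oz] := carries_ex dofp (f ◃ c) xE.
  rewrite (carries_fun dofp o (carries_cmp oz (cd _ _ _ _ oz))); exact: carries_id.
have [z oz] := carries_ex dofp (f ◃ d) xE.
have [z' [o1 o2]] := dE B f x xE; have ez := carries_fun dofp o1 oz; subst z'.
rewrite (carries_fun dofp o (carries_cmp oz o2)); exact: carries_id.
Qed.

End Classifier.

(** * Cores *)

Section Core.
Context {C : two_category} {X Xi : C} {i : hc Xi X} (core_i : is_core i).

Lemma arrowwise_iso_of_groupoidal {A : C} (f : hc A X) : is_groupoidal A -> is_arrowwise_iso f.
Proof. by move=> gA B a b t; apply: wr_iso; apply: gA. Qed.

(** Whiskering with a 1-cell into the core only sees 2-cells of the core. *)
Lemma arrowwise_iso_core {A : C} (f : hc A Xi) : is_arrowwise_iso (f ⋅ i).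
Proof.
case: core_i => _ ai _ _ B a b t.
by apply: is_iso_arr (wr_assoc t f i) _; apply: ai.
Qed.

Lemma core_lift {A : C} (f : hc A X) : is_groupoidal A -> exists f' : hc A Xi, f' ⋅ i = f.
Proof.
case: core_i => _ _ U _ gA; have [f' [? _]] := U A f (arrowwise_iso_of_groupoidal f gA).
by exists f'.
Qed.

Lemma core_monic : monic i.
Proof.
case: core_i => _ _ U _ A f g e.
by have [k [_ K]] := U A (g ⋅ i) (arrowwise_iso_core g); rewrite -(K f e) -(K g erefl).
Qed.

(** The ends are allowed to differ because [i] is monic. *)
Lemma core_faithful {A : C} {f g f' g' : hc A Xi} (c : f ⟹ g) (c' : f' ⟹ g') :
  c ▹ i ≈ c' ▹ i -> c ≈ c'.
Proof.
case: core_i => gXi _ _ V e.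
have iso_c : is_iso (c ▹ i) by apply: wr_iso; apply: gXi.
have [k [_ K]] := V A _ _ (c ▹ i) (arrowwise_iso_core f) (arrowwise_iso_core g) iso_c.
by rewrite -(K (arr c)) // -(K (arr c')).
Qed.

Lemma core_cell {A : C} {f g : hc A Xi} (c : f ⋅ i ⟹ g ⋅ i) : is_iso c ->
  exists c' : f ⟹ g, c' ▹ i ≈ c.
Proof.
case: core_i => _ _ _ V iso_c.
have [[f' g' k] [/= kE _]] := V A _ _ c (arrowwise_iso_core f) (arrowwise_iso_core g) iso_c.
have [/= /core_monic ef /core_monic eg] := arr_srcE kE; subst f' g'.
by exists k.
Qed.

End Core.

(** * Subobjects defined by universal quantification *)

Section Locus.
Context {C : two_category} (HC : corepita C) (S : DOF_classifier C).
Context (small : forall (A X : C) (q : hc X A), is_SOF q -> SOF_small S q).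
Local Notation p := (cl_map S).

(** [l] is the subobject of the generalized elements of [A] that satisfy [Q].  Being
    a DOF, it is closed under 2-cells out of its elements. *)
Definition locus {A L : C} (l : hc L A) (Q : forall B : C, hc B A -> Prop) : Prop :=
  [/\ is_DOF l, monic l & forall (B : C) (f : hc B A), (exists g : hc B L, g ⋅ l = f) <-> Q B f].

Lemma classified_map {A X Y : C} (q : hc X A) (u : hc Y X) (s t : hc A (cl_base S))
    (eX : hc X (cl_total S)) (eY : hc Y (cl_total S)) :
  pullback1 q eX s p -> pullback1 (u ⋅ q) eY t p ->
  exists c : t ⟹ s, forall (B : C) (f : hc B A) (w : hc B Y), w ⋅ u ⋅ q = f ->
    carries p (f ◃ c) (w ⋅ eY) (w ⋅ u ⋅ eX).
Proof.
move=> pbX pbY; have yE : u ⋅ eX ⋅ p = u ⋅ q ⋅ s by rewrite !h1_assoc pbX.1.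
have [c [o _]] := cell_of_generic pbY yE; exists c => B f w <-.
apply: carries_as (carries_pre w o) _ erefl _; last by rewrite !h1_assoc.
by rewrite wl_assoc; apply: wl_eq; rewrite h1_assoc.
Qed.

(** The elements of the sets classified by [s] and [t] are those of [X] and [Y], on which
    [c] acts as [u]. *)
Lemma cell_iso_iff_bijective {A X Y : C} (q : hc X A) (u : hc Y X) (s t : hc A (cl_base S))
    (eX : hc X (cl_total S)) (eY : hc Y (cl_total S)) (c : t ⟹ s) :
  pullback1 q eX s p -> pullback1 (u ⋅ q) eY t p ->
  (forall (B : C) (f : hc B A) (w : hc B Y), w ⋅ u ⋅ q = f ->
    carries p (f ◃ c) (w ⋅ eY) (w ⋅ u ⋅ eX)) ->
  forall (B : C) (f : hc B A), is_iso (f ◃ c) <->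
    forall (D : C) (h : hc D B) (z : hc D X), z ⋅ q = h ⋅ f -> exists! y : hc D Y, y ⋅ u = z.
Proof.
move=> pbX pbY act B f; have dofp := @cl_DOF _ S; split=> [[d [cd dc]] D h z zE|bij].
  have xE : z ⋅ eX ⋅ p = h ⋅ (f ⋅ s) by rewrite -(pb_sq pbX) zE h1_assoc.
  have [y o] := carries_ex dofp (h ◃ d) xE.
  have [_ yE] := carries_ends o; rewrite -h1_assoc in yE.
  have [w [w1 w2]] := pb_ex pbY (esym yE); rewrite -h1_assoc in w1.
  have o1 : carries p (h ◃ (f ◃ c)) y (z ⋅ eX).
    by apply: (carries_inv dofp) o; rewrite -wl_cmp dc wl_id.
  have wz : w ⋅ u = z.
    apply: (pb_ext pbX); first by rewrite w1.
    apply: (carries_fun dofp) o1; apply: carries_as (act _ _ _ w1) _ w2 erefl; exact/esym/wl_assoc.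
  exists w; split=> // w' w'z; apply: (pb_ext pbY); first by rewrite -!h1_assoc w'z wz.
  have inv v : v ⋅ u = z -> carries p (h ◃ d) (z ⋅ eX) (v ⋅ eY).
    move=> vz; apply: (carries_inv dofp (t := h ◃ (f ◃ c))); first by rewrite -wl_cmp cd wl_id.
    have vE : v ⋅ u ⋅ q = h ⋅ f by rewrite vz.
    by apply: carries_as (act _ _ _ vE) _ erefl _; rewrite ?vz // -wl_assoc.
  exact: (carries_fun dofp (inv _ wz) (inv _ w'z)).
apply: cell_iso => // D h y yE0; have yE : y ⋅ p = h ⋅ f ⋅ s by rewrite yE0 h1_assoc.
have [z [z1 z2]] := pb_ex pbX (esym yE).
have [w [wz W]] := bij D h z z1.
have actD v : v ⋅ u ⋅ q = h ⋅ f -> carries p (h ◃ (f ◃ c)) (v ⋅ eY) (v ⋅ u ⋅ eX).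
  by move=> vE; apply: carries_arr (act _ _ _ vE); rewrite wl_assoc.
have wE : w ⋅ u ⋅ q = h ⋅ f by rewrite wz.
exists (w ⋅ eY); split=> [|x o]; first by rewrite -z2 -wz; apply: actD.
have [xE _] := carries_ends o; rewrite -h1_assoc in xE.
have [w' [w'1 w'2]] := pb_ex pbY (esym xE); rewrite -h1_assoc in w'1.
rewrite -w'2 (W w') //; apply: (pb_ext pbX); first by rewrite w'1 z1.
rewrite z2; apply: (carries_fun dofp) o; rewrite -w'2; exact: actD.
Qed.

(** Classify [X] and [Y] by 1-cells into [S], so that [u] becomes a 2-cell [c], which
    is a section [g] of the set of 2-cells in [S].  The 2-cells in the core of [S]
    map to it by some [j], whose image consists of the invertible 2-cells; the locus
    is the pullback of [j] along [g]. *)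
Lemma bijectivity_locus {A X Y : C} (q : hc X A) (u : hc Y X) :
  is_groupoidal A -> is_DOF q -> is_DOF u ->
  exists (L : C) (l : hc L A), locus l (fun B f =>
    forall (D : C) (h : hc D B) (z : hc D X), z ⋅ q = h ⋅ f -> exists! y : hc D Y, y ⋅ u = z).
Proof.
move=> gA dofq dofu; have [s [eX pbX]] := classify small dofq.
have [t [eY pbY]] := classify small (dof_comp dofu dofq).
have [c act] := classified_map pbX pbY.
case: (HC) => _ _ _ /(_ (cl_base S))[Si [i core_i]].
have [s' s'E] := core_lift core_i s gA; have [t' t'E] := core_lift core_i t gA.
have [H [h [eta rH]]] := cell_object HC t s gA.
have [P [k [theta rP]]] := cell_object HC t' s' gA.
have [c1 c1E] := arr_cast c (esym (h1_idl t)) (esym (h1_idl s)).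
(* [g] is the map [c], as an element of the set of maps. *)
have [g [gh gE]] := represents_cells_ex rH c1.
have kt : k ⋅ t' ⋅ i = k ⋅ t by rewrite h1_assoc t'E.
have ks : k ⋅ s' ⋅ i = k ⋅ s by rewrite h1_assoc s'E.
have [th thE] := arr_cast (theta ▹ i) kt ks.
(* [j] forgets that a map is invertible. *)
have [j [jk jE]] := represents_cells_ex rH th.
have dofj : is_DOF j.
  by apply: (@dof_cancel _ _ _ _ j h); [rewrite jk; case: rP | case: rH].
have [L [l [l2 [dofl pbL]]]] := dof_pb HC g dofj.
have gcE (B : C) (f : hc B A) : (f ⋅ g) ◃ eta ≈ f ◃ c.
  by rewrite -wl_assoc; apply: wl_arr; rewrite gE c1E.
have jcE (B : C) (w : hc B P) : (w ⋅ j) ◃ eta ≈ (w ◃ theta) ▹ i.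
  by rewrite -wl_assoc (wl_arr _ jE) (wl_arr _ thE) wlr_assoc.
have lk (B : C) (v : hc B L) : v ⋅ l2 ⋅ k = v ⋅ l.
  by rewrite -jk -(h1_assoc _ j) -(pb_sq pbL) h1_assoc gh h1_idr.
exists L, l; split=> // [B v v' e|B f].
  apply: (pb_ext pbL) => //; apply: (represents_cells_ext rP); first by rewrite !lk.
  apply: (core_faithful core_i); rewrite -!jcE -!(pb_sq pbL); by rewrite e.
rewrite -(cell_iso_iff_bijective pbX pbY act f); split=> [[v vf]|iso_fc].
  have e : ((v ⋅ l2) ◃ theta) ▹ i ≈ f ◃ c by rewrite -jcE -(pb_sq pbL) gcE vf.
  by apply: is_iso_arr e _; apply: wr_iso; case: core_i => gSi _ _ _; apply: gSi.
have ft : f ⋅ t = f ⋅ t' ⋅ i by rewrite h1_assoc t'E.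
have fs : f ⋅ s = f ⋅ s' ⋅ i by rewrite h1_assoc s'E.
have [fc fcE] := arr_cast (f ◃ c) ft fs.
have [c' c'E] := core_cell core_i (is_iso_arr (esym fcE) iso_fc).
have [w [wk wE]] := represents_cells_ex rP c'.
have e : f ⋅ g = w ⋅ j.
  apply: (represents_cells_ext rH); first by rewrite !h1_assoc gh jk h1_idr wk.
  by rewrite gcE jcE (wr_arr _ wE) c'E fcE.
by have [v [v1 _]] := pb_ex pbL e; exists v.
Qed.

End Locus.

(** * The classifier of graphs *)

Section Correspondence.
Context {C : two_category}.

(** A bijection, natural in the stage, between the elements of [X] over [a] and those
    over [b].  A relation is used in place of a function so that the values need only
    exist uniquely. *)
Definition correspondence {G X A : C} (q : hc X G) (a b : hc A G)
    (P : forall B : C, hc B A -> hc B X -> hc B X -> Prop) : Prop :=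
  [/\ forall (B D : C) (g : hc D B) (f : hc B A) x y, P B f x y -> P D (g ⋅ f) (g ⋅ x) (g ⋅ y),
      forall (B : C) (f : hc B A) x y, P B f x y -> x ⋅ q = f ⋅ a /\ y ⋅ q = f ⋅ b,
      forall (B : C) (f : hc B A) x, x ⋅ q = f ⋅ a -> exists! y, P B f x y
    & forall (B : C) (f : hc B A) y, y ⋅ q = f ⋅ b -> exists! x, P B f x y].

Lemma pb_unpaste {X Y G B T S : C} (q : hc X G) (e : hc X T) (s : hc G S) (p : hc T S)
    (r : hc Y B) (a : hc B G) (u : hc Y X) :
  pullback1 q e s p -> pullback1 r (u ⋅ e) (a ⋅ s) p -> u ⋅ q = r ⋅ a -> pullback1 r u a q.
Proof.
move=> pb pbr sq; split=> // D v x e1.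
have e2 : v ⋅ (a ⋅ s) = x ⋅ e ⋅ p by rewrite -h1_assoc e1 (pb_sq pb).
have [w [w1 w2]] := pb_ex pbr e2.
have wu : w ⋅ u = x.
  by apply: (pb_ext pb); rewrite h1_assoc ?w2 // sq -h1_assoc w1.
exists w; split=> // w' [w'1 w'u]; apply: (pb_ext pbr); first by rewrite w1.
by rewrite -!h1_assoc wu w'u.
Qed.

End Correspondence.

(** [graphs] classifies pairs of parallel maps of sets, [vert] and [edge] are the sets
    of vertices and edges of the generic graph.  By the last two fields, a 2-cell is
    the same as an isomorphism of graphs. *)
Record graph_classifier (C : two_category) : Type := GraphClassifier {
  graphs : C;
  vert : C;
  edge : C;
  vmap : hc vert graphs;
  emap : hc edge graphs;
  src : hc edge vert;
  tgt : hc edge vert;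
  gr_gpd : is_groupoidal graphs;
  vmap_dof : is_DOF vmap;
  emap_dof : is_DOF emap;
  src_vmap : src ⋅ vmap = emap;
  tgt_vmap : tgt ⋅ vmap = emap;
  gr_classifies : forall (B X R : C) (q : hc X B) (r : hc R B) (d c : hc R X),
    is_groupoidal B -> is_DOF q -> is_DOF r -> d ⋅ q = r -> c ⋅ q = r ->
    exists (a : hc B graphs) (u : hc X vert) (v : hc R edge),
      [/\ pullback1 q u a vmap, pullback1 r v a emap, d ⋅ u = v ⋅ src & c ⋅ u = v ⋅ tgt];
  gr_cell : forall (A : C) (a b : hc A graphs)
      (P : forall B : C, hc B A -> hc B vert -> hc B vert -> Prop)
      (Q : forall B : C, hc B A -> hc B edge -> hc B edge -> Prop),
    correspondence vmap a b P -> correspondence emap a b Q ->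
    (forall (B : C) (f : hc B A) r r', Q B f r r' ->
       P B f (r ⋅ src) (r' ⋅ src) /\ P B f (r ⋅ tgt) (r' ⋅ tgt)) ->
    inhabited (a ⟹ b);
  gr_cell_ext : forall (A : C) (a b : hc A graphs) (c c' : a ⟹ b),
    (forall (B : C) (f : hc B A) x y, carries vmap (f ◃ c) x y -> carries vmap (f ◃ c') x y) ->
    (forall (B : C) (f : hc B A) x y, carries emap (f ◃ c) x y -> carries emap (f ◃ c') x y) ->
    c = c'
}.

Section GraphClassifier.
Context {C : two_category} (HC : corepita C) (S : DOF_classifier C).
Context (small : forall (A X : C) (q : hc X A), is_SOF q -> SOF_small S q).
Local Notation p := (cl_map S).

(** A bijection between the elements of two base changes of one set is induced by an
    invertible 2-cell between their classifying 1-cells. *)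
Lemma cell_of_correspondence {G X A : C} (q : hc X G) (s : hc G (cl_base S)) (e : hc X (cl_total S))
    (a b : hc A G) P : pullback1 q e s p -> correspondence q a b P ->
  exists c : a ⋅ s ⟹ b ⋅ s, is_iso c /\
    forall (B : C) (f : hc B A) x y, P B f x y -> carries p (f ◃ c) (x ⋅ e) (y ⋅ e).
Proof.
move=> pb [stab ends fwd bwd].
pose Pe (B : C) (f : hc B A) x' y' := exists x y, [/\ P B f x y, x ⋅ e = x' & y ⋅ e = y'].
have lift (B : C) (f : hc B A) (k : hc A G) x' : x' ⋅ p = f ⋅ (k ⋅ s) ->
    exists x, x ⋅ q = f ⋅ k /\ x ⋅ e = x'.
  by rewrite -h1_assoc => /esym/(pb_ex pb).
have [||c cE] := @cell_of_relation _ S A (a ⋅ s) (b ⋅ s) Pe.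
- move=> B D g f _ _ [x [y [Pxy <- <-]]]; exists (g ⋅ x), (g ⋅ y).
  by rewrite !h1_assoc; split=> //; apply: stab.
- move=> B f x' /lift[x [xq xe]]; have [y [Pxy _]] := fwd B f x xq.
  have [_ yq] := ends _ _ _ _ Pxy.
  exists (y ⋅ e); split; first by rewrite -(pb_sq pb) yq h1_assoc.
  by exists x, y.
have cP (B : C) (f : hc B A) x y : P B f x y -> carries p (f ◃ c) (x ⋅ e) (y ⋅ e).
  move=> Pxy; have [xq yq] := ends _ _ _ _ Pxy.
  have xE : x ⋅ e ⋅ p = f ⋅ (a ⋅ s) by rewrite -(pb_sq pb) xq h1_assoc.
  have [y' [o [x1 [y1 [Pxy1 x1e y1e]]]]] := cE B f _ xE.
  have [x1q _] := ends _ _ _ _ Pxy1.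
  have ex : x1 = x by apply: (pb_ext pb); rewrite ?x1e // x1q xq.
  subst x1; have [z [_ Z]] := fwd B f x xq.
  by rewrite -(Z y Pxy) (Z y1 Pxy1) y1e.
exists c; split=> //; apply: cell_iso => B f y' yE'.
have [y [yq ye]] := lift _ _ _ _ yE'; have [x [Pxy X']] := bwd B f y yq.
exists (x ⋅ e); split=> [|x' o]; first by rewrite -ye; apply: cP.
have [xE' _] := carries_ends o; have [y2 [o2 [x1 [y1 [Pxy1 x1e y1e]]]]] := cE B f _ xE'.
have e2 : y2 = y' := carries_fun (@cl_DOF _ S) o2 o; subst y2.
have [_ y1q] := ends _ _ _ _ Pxy1.
have ey : y1 = y by apply: (pb_ext pb); rewrite ?ye // y1q yq.
by subst y1; rewrite -x1e (X' x1 Pxy1).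
Qed.

Lemma carries_pb {G X A : C} (q : hc X G) (s : hc G (cl_base S)) (e : hc X (cl_total S))
    (a b : hc A G) (c : a ⟹ b) x y : pullback1 q e s p ->
  carries q c x y -> carries p (c ▹ s) (x ⋅ e) (y ⋅ e).
Proof.
move=> pb [d dE]; exists (d ▹ e).
by rewrite wr_assoc -pb.1 -wr_assoc; apply: wr_arr.
Qed.

(** Since [X] is a base change of the universal DOF, transport in [X] along [c]
    determines transport in the universal DOF along [c ▹ s]. *)
Lemma whisker_ext {G X A : C} (q : hc X G) (s : hc G (cl_base S)) (e : hc X (cl_total S))
    (a b : hc A G) (c c' : a ⟹ b) : is_DOF q -> pullback1 q e s p ->
  (forall (B : C) (f : hc B A) x y, carries q (f ◃ c) x y -> carries q (f ◃ c') x y) ->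
  c ▹ s = c' ▹ s.
Proof.
move=> dofq pb H; apply: (cell_ext (S := S)) => B f x y o.
have [xE _] := carries_ends o; rewrite -h1_assoc in xE.
have [u [uq ue]] := pb_ex pb (esym xE).
have [v ov] := carries_ex dofq (f ◃ c) uq.
have o1 := carries_pb pb ov; have o2 := carries_pb pb (H _ _ _ _ ov).
have {}o1 : carries p (f ◃ (c ▹ s)) x (v ⋅ e).
  by apply: carries_as o1 _ ue erefl; rewrite wlr_assoc.
rewrite (carries_fun (@cl_DOF _ S) o o1).
by apply: carries_as o2 _ ue erefl; rewrite wlr_assoc.
Qed.

Lemma map_of_cell {A X Y : C} (q : hc X A) (r : hc Y A) (s t : hc A (cl_base S))
    (eX : hc X (cl_total S)) (eY : hc Y (cl_total S)) (c : t ⟹ s) :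
  pullback1 q eX s p -> pullback1 r eY t p ->
  exists u : hc Y X, u ⋅ q = r /\ forall (B : C) (f : hc B A) (w : hc B Y), w ⋅ r = f ->
    carries p (f ◃ c) (w ⋅ eY) (w ⋅ u ⋅ eX).
Proof.
move=> pbX pbY; have [y o] := carries_ex (@cl_DOF _ S) (r ◃ c) (esym pbY.1).
have [_ yE] := carries_ends o; have [u [u1 u2]] := pb_ex pbX (esym yE).
exists u; split=> // B f w <-.
by apply: carries_as (carries_pre w o) _ erefl _; rewrite ?wl_assoc // h1_assoc u2.
Qed.

(** Over the product of two copies of the core of [S], take the set of maps between
    the two generic sets, and then the product of this set with itself. *)
Lemma graph_classifier_ex : inhabited (graph_classifier C).
Proof.
have dofp := @cl_DOF _ S.
case: (HC) => _ _ _ /(_ (cl_base S))[Si [i core_i]].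
have gSi : is_groupoidal Si by case: core_i.
(* [W0] classifies a set of edges, first, and a set of vertices. *)
have [W0 [w1 [w2 pr]]] := product_ex HC Si Si.
have gW0 : is_groupoidal W0 := prod_groupoidal pr gSi gSi.
pose tR := w1 ⋅ i; pose sX := w2 ⋅ i.
have [H [h [eta rH]]] := cell_object HC tR sX gW0.
have [G [m1 [m2 [dofm1 pbG]]]] := dof_pb HC h rH.1.
pose b0 := m1 ⋅ h; have b0E : m2 ⋅ h = b0 by rewrite /b0 pbG.1.
have dofb0 : is_DOF b0 by apply: dof_comp dofm1 rH.1.
have gG : is_groupoidal G := dof_groupoidal dofb0 gW0.
pose s := b0 ⋅ sX; pose t := b0 ⋅ tR.
have [X [qX [eX [dofX pbX]]]] := dof_pb HC s dofp.
have [R [qR [eR [dofR pbR]]]] := dof_pb HC t dofp.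
have cast m : m ⋅ h = b0 -> exists c : t ⟹ s, c ≈ m ◃ eta.
  by move=> mE; apply: arr_cast; rewrite -h1_assoc mE.
have [d1 d1E] := cast m1 erefl; have [d2 d2E] := cast m2 b0E.
have [sd [sdq sdE]] := map_of_cell d1 pbX pbR.
have [td [tdq tdE]] := map_of_cell d2 pbX pbR.
split; refine (@GraphClassifier C G X R qX qR sd td gG dofX dofR sdq tdq _ _ _).
- move=> B Y Q q r d c gB dofq dofr dq cq.
  have [sB [eB pbB]] := classify small dofq; have [tB [fB pbQ]] := classify small dofr.
  have [s' s'E] := core_lift core_i sB gB; have [t' t'E] := core_lift core_i tB gB.
  have [w [ww1 ww2]] := prod_ex pr t' s'.
  have wtR : w ⋅ tR = tB by rewrite /tR -h1_assoc ww1.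
  have wsX : w ⋅ sX = sB by rewrite /sX -h1_assoc ww2.
  (* Each of the maps [d] and [c] of the given graph is an element of [H]. *)
  have leg (k : hc Q Y) : k ⋅ q = r -> exists g : hc B H, g ⋅ h = w /\
      forall D (z : hc D Q) (j : hc D B), z ⋅ r = j ->
      carries p (j ◃ (g ◃ eta)) (z ⋅ fB) (z ⋅ k ⋅ eB).
    move=> kq; have pbk : pullback1 (k ⋅ q) fB tB p by rewrite kq.
    have [e act] := classified_map pbB pbk.
    have [e' e'E] := arr_cast e (esym wtR) (esym wsX).
    have [g [gh gE]] := represents_cells_ex rH e'.
    exists g; split=> // D z j zr.
    apply: carries_arr (act D j z _); last by rewrite h1_assoc kq.
    by apply: wl_arr; rewrite gE e'E.
  have [g1 [g1h g1E]] := leg d dq; have [g2 [g2h g2E]] := leg c cq.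
  have [a [am1 am2]] := pb_ex pbG (etrans g1h (esym g2h)).
  have ab0 : a ⋅ b0 = w by rewrite /b0 -h1_assoc am1.
  have as_ : a ⋅ s = sB by rewrite /s -h1_assoc ab0.
  have at_ : a ⋅ t = tB by rewrite /t -h1_assoc ab0.
  have uE : q ⋅ a ⋅ s = eB ⋅ p by rewrite h1_assoc as_ pbB.1.
  have vE : r ⋅ a ⋅ t = fB ⋅ p by rewrite h1_assoc at_ pbQ.1.
  have [u [u1 u2]] := pb_ex pbX uE; have [v [v1 v2]] := pb_ex pbR vE.
  have comm (k : hc Q Y) (k' : hc R X) (g : hc B H) (m : hc G H) (e : t ⟹ s) :
      k ⋅ q = r -> k' ⋅ qX = qR -> a ⋅ m = g -> e ≈ m ◃ eta ->
      (forall D (z : hc D Q) (j : hc D B), z ⋅ r = j ->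
        carries p (j ◃ (g ◃ eta)) (z ⋅ fB) (z ⋅ k ⋅ eB)) ->
      (forall (B : C) (f : hc B G) (w : hc B R), w ⋅ qR = f ->
        carries p (f ◃ e) (w ⋅ eR) (w ⋅ k' ⋅ eX)) -> k ⋅ u = v ⋅ k'.
    move=> kq k'q amE eE gE k'E; apply: (pb_ext pbX).
      by rewrite !h1_assoc u1 k'q v1 -h1_assoc kq.
    rewrite h1_assoc u2.
    have o1 := gE _ _ _ (h1_idl r); have o2 := k'E _ _ _ v1; rewrite !h1_idl v2 in o1 o2.
    apply: (carries_fun dofp) o1 _; apply: carries_arr o2.
    rewrite -wl_assoc; apply: wl_arr; rewrite -amE -wl_assoc; exact: wl_arr.
  exists a, u, v; split.
  + by apply: (pb_unpaste pbX) => //; rewrite u2 as_.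
  + by apply: (pb_unpaste pbR) => //; rewrite v2 at_.
  + exact: comm d1E g1E sdE.
  + exact: comm d2E g2E tdE.
- move=> A a b P Q PP QQ PQ.
  have [cX [iso_cX cXE]] := cell_of_correspondence pbX PP.
  have [cR [iso_cR cRE]] := cell_of_correspondence pbR QQ.
  (* The isomorphisms of edges and vertices commute with the maps of the graphs. *)
  have sq (k : hc R X) (e : t ⟹ s) : k ⋅ qX = qR ->
      (forall (B : C) (f : hc B G) (w : hc B R), w ⋅ qR = f ->
        carries p (f ◃ e) (w ⋅ eR) (w ⋅ k ⋅ eX)) ->
      (forall (B : C) (f : hc B A) r r', Q B f r r' -> P B f (r ⋅ k) (r' ⋅ k)) ->
      cR • (b ◃ e) = (a ◃ e) • cX.
    move=> kq kE kP; apply: (cell_ext (S := S)) => B f x y o.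
    have [xE _] := carries_ends o; rewrite -h1_assoc in xE.
    have [r [rq re]] := pb_ex pbR (esym xE).
    case: QQ => _ ends /(_ B f r rq)[r' [Qr _]] _.
    have [_ r'q] := ends _ _ _ _ Qr.
    have o1 := carries_cmp (cRE _ _ _ _ Qr) (carries_arr (esym (wl_assoc f b e)) (kE _ _ _ r'q)).
    have o2 := carries_cmp (carries_arr (esym (wl_assoc f a e)) (kE _ _ _ rq)) (cXE _ _ _ _ (kP _ _ _ _ Qr)).
    rewrite wl_cmp in o *; rewrite -re in o *.
    by rewrite (carries_fun dofp o o1) wl_cmp.
  have sq1 := sq _ _ sdq sdE (fun B f r r' Qr => (PQ B f r r' Qr).1).
  have sq2 := sq _ _ tdq tdE (fun B f r r' Qr => (PQ B f r r' Qr).2).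
  have tE (k : hc A G) : k ⋅ t = k ⋅ b0 ⋅ w1 ⋅ i by rewrite /t /tR !h1_assoc.
  have sE (k : hc A G) : k ⋅ s = k ⋅ b0 ⋅ w2 ⋅ i by rewrite /s /sX !h1_assoc.
  have [cR1 cR1E] := arr_cast cR (tE a) (tE b); have [cX1 cX1E] := arr_cast cX (sE a) (sE b).
  have [cR2 cR2E] := core_cell core_i (is_iso_arr (esym cR1E) iso_cR).
  have [cX2 cX2E] := core_cell core_i (is_iso_arr (esym cX1E) iso_cX).
  (* The 2-cell between the underlying pairs of sets; it remains to lift it along [b0]. *)
  have [th [th1 th2]] := prod_cell pr cR2 cX2 erefl erefl erefl erefl.
  have thR : th ▹ tR ≈ cR by rewrite -wr_assoc (wr_arr _ th1) cR2E.
  have thX : th ▹ sX ≈ cX by rewrite -wr_assoc (wr_arr _ th2) cX2E.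
  have iso_th : is_iso th by apply: gW0.
  have leg m (e : t ⟹ s) : m ⋅ h = b0 -> e ≈ m ◃ eta -> cR • (b ◃ e) = (a ◃ e) • cX ->
      carries h th (a ⋅ m) (b ⋅ m).
    move=> mh eE sqe.
    have castk (k : hc A G) : exists e' : k ⋅ b0 ⋅ tR ⟹ k ⋅ b0 ⋅ sX, e' ≈ k ◃ e.
      by apply: arr_cast; rewrite h1_assoc.
    have [ea eaE] := castk a; have [eb ebE] := castk b.
    have mE (k : hc A G) (e' : k ⋅ b0 ⋅ tR ⟹ k ⋅ b0 ⋅ sX) : e' ≈ k ◃ e -> (k ⋅ m) ◃ eta ≈ e'.
      by move=> ->; rewrite -wl_assoc; apply: wl_arr.
    apply: (represents_cells_carries rH iso_th _ (mE _ _ eaE) _ (mE _ _ ebE)).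
    + by rewrite h1_assoc mh.
    + by rewrite h1_assoc mh.
    + by apply: arr_inj; rewrite (arr_cmp thR ebE) (arr_cmp eaE thX) sqe.
  have [c1 c1E] := leg _ _ erefl d1E sq1.
  have o2 := leg _ _ b0E d2E sq2.
  have [z [c cE]] := carries_ex dofm1 c1 erefl.
  have [_ zm1] := arr_srcE cE.
  have o2' : carries h th (a ⋅ m2) (z ⋅ m2).
    exists (c ▹ m2); rewrite wr_assoc b0E -wr_assoc -c1E; exact: wr_arr.
  have -> : b = z by apply: (pb_ext pbG) => //; apply: (carries_fun rH.1 o2 o2').
  by split.
move=> A a b c c' HX HR.
have eX' := whisker_ext dofX pbX HX; have eR' := whisker_ext dofR pbR HR.
apply: (dof_faithful dofb0); apply: arr_inj; apply: (prod_cell_ext pr); apply: (core_faithful core_i).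
  by rewrite !wr_assoc -/tR -/t eR'.
by rewrite !wr_assoc -/sX -/s eX'.
Qed.

End GraphClassifier.

(** * Graphs and their segments *)

Section Graphs.
Context {C : two_category} (G : graph_classifier C).
Local Notation M := (graphs G).
Local Notation V := (vert G).
Local Notation E := (edge G).
Local Notation vm := (vmap G).
Local Notation em := (emap G).

Definition precedes {A : C} (y x : hc A V) : Prop := exists r : hc A E, r ⋅ src G = y /\ r ⋅ tgt G = x.

Definition graph_iso {A : C} (a b : hc A M) : Prop := inhabited (a ⟹ b).

(** No parallel edges: the graph is a relation on its vertices. *)
Definition simple {A : C} (a : hc A M) : Prop :=
  forall (B : C) (f : hc B A) (r r' : hc B E), r ⋅ em = f ⋅ a ->
    r ⋅ src G = r' ⋅ src G -> r ⋅ tgt G = r' ⋅ tgt G -> r = r'.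

Lemma src_vm {A : C} (r : hc A E) : r ⋅ src G ⋅ vm = r ⋅ em.
Proof. by rewrite h1_assoc src_vmap. Qed.

Lemma tgt_vm {A : C} (r : hc A E) : r ⋅ tgt G ⋅ vm = r ⋅ em.
Proof. by rewrite h1_assoc tgt_vmap. Qed.

Lemma precedes_vm {A : C} (y x : hc A V) : precedes y x -> y ⋅ vm = x ⋅ vm.
Proof. by move=> [r [<- <-]]; rewrite src_vm tgt_vm. Qed.

Lemma precedes_pre {A B : C} (f : hc B A) (y x : hc A V) : precedes y x -> precedes (f ⋅ y) (f ⋅ x).
Proof. by move=> [r [<- <-]]; exists (f ⋅ r); rewrite !h1_assoc. Qed.

Lemma graph_iso_sym {A : C} (a b : hc A M) : graph_iso a b -> graph_iso b a.
Proof. by move=> [c]; have [c' _] := @gr_gpd _ G _ _ _ c. Qed.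

Lemma graph_iso_trans {A : C} (a b c : hc A M) : graph_iso a b -> graph_iso b c -> graph_iso a c.
Proof. by move=> [u] [v]; split; apply: cmp u v. Qed.

Lemma graph_iso_pre {A B : C} (f : hc B A) (a b : hc A M) : graph_iso a b -> graph_iso (f ⋅ a) (f ⋅ b).
Proof. by move=> [c]; split; apply: wl. Qed.

Lemma simple_pre {A B : C} (f : hc B A) (a : hc A M) : simple a -> simple (f ⋅ a).
Proof. by move=> sa D g r r' rE; apply: (sa _ (g ⋅ f)); rewrite h1_assoc. Qed.

(** Between simple graphs, an isomorphism is a bijection of vertices that preserves
    and reflects the relation; edges correspond through their ends. *)
Lemma graph_iso_of_order {A : C} (a b : hc A M) P : simple a -> simple b ->
  correspondence vm a b P ->
  (forall (B : C) (f : hc B A) x y x' y', P B f x x' -> P B f y y' -> precedes x y <-> precedes x' y') ->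
  graph_iso a b.
Proof.
move=> sa sb PP ord; have [stab ends fwd bwd] := PP.
pose Q (B : C) (f : hc B A) (r r' : hc B E) :=
  P B f (r ⋅ src G) (r' ⋅ src G) /\ P B f (r ⋅ tgt G) (r' ⋅ tgt G).
apply: (gr_cell PP (Q := Q)); last by [].
split=> [B D g f r r' [Qs Qt]|B f r r' [Qs _]|B f r re|B f r' re].
- by split; rewrite !h1_assoc; apply: stab.
- by have := ends _ _ _ _ Qs; rewrite !src_vm.
- have [x [Px X]] := fwd B f (r ⋅ src G) (etrans (src_vm r) re).
  have [y [Py Y]] := fwd B f (r ⋅ tgt G) (etrans (tgt_vm r) re).
  have [r' [r's r't]] : precedes x y.
    by apply/(ord _ _ _ _ _ _ Px Py); exists r.
  have r'e : r' ⋅ em = f ⋅ b by rewrite -src_vm r's; have [] := ends _ _ _ _ Px.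
  exists r'; split=> [|r2 [Qs Qt]]; first by split; rewrite ?r's ?r't.
  by apply: (sb _ _ _ _ r'e); rewrite ?r's ?r't; [apply: X | apply: Y].
have [x [Px X]] := bwd B f (r' ⋅ src G) (etrans (src_vm r') re).
have [y [Py Y]] := bwd B f (r' ⋅ tgt G) (etrans (tgt_vm r') re).
have [r [rs rt]] : precedes x y.
  by apply/(ord _ _ _ _ _ _ Px Py); exists r'.
have r'e : r ⋅ em = f ⋅ a by rewrite -src_vm rs; have [] := ends _ _ _ _ Px.
exists r; split=> [|r2 [Qs Qt]]; first by split; rewrite ?rs ?rt.
by apply: (sa _ _ _ _ r'e); rewrite ?rs ?rt; [apply: X | apply: Y].
Qed.

(** An edge of a simple graph is transported along with its ends. *)
Lemma gcell_ext_simple {A : C} (a b : hc A M) (c c' : a ⟹ b) : simple b ->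
  (forall (B : C) (f : hc B A) x y, carries vm (f ◃ c) x y -> carries vm (f ◃ c') x y) ->
  c = c'.
Proof.
move=> sb H; apply: gr_cell_ext => // B f r r' o.
have [re r'e] := carries_ends o.
have [r2 o2] := carries_ex (@emap_dof _ G) (f ◃ c') re.
have same k : k ⋅ vm = em -> r' ⋅ k = r2 ⋅ k.
  move=> kE; have o3 := H _ _ _ _ (carries_post kE o).
  exact: (carries_fun (@vmap_dof _ G) o3 (carries_post kE o2)).
by have -> : r' = r2 by apply: (sb _ _ _ _ r'e); apply: same; rewrite ?src_vmap ?tgt_vmap.
Qed.

Lemma src_dof : is_DOF (src G).
Proof. by apply: (@dof_cancel _ _ _ _ _ vm); rewrite ?src_vmap; [apply: emap_dof | apply: vmap_dof]. Qed.

Lemma tgt_dof : is_DOF (tgt G).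
Proof. by apply: (@dof_cancel _ _ _ _ _ vm); rewrite ?tgt_vmap; [apply: emap_dof | apply: vmap_dof]. Qed.

Lemma vert_gpd : is_groupoidal V.
Proof. exact: dof_groupoidal (@vmap_dof _ G) (gr_gpd (g := G)). Qed.

(** The finite limits of the generic graph in terms of which segments and transitivity
    are expressed: pairs of vertices of one graph, with the ends of an edge and the
    diagonal; paths of length two; and triangles, which are such paths together with
    an edge from the source to the target. *)
Record triangles : Type := Triangles {
  vpair : C;
  vfst : hc vpair V;
  vsnd : hc vpair V;
  vfst_dof : is_DOF vfst;
  vpair_pb : pullback1 vfst vsnd vm vm;
  ends : hc E vpair;
  ends_fst : ends ⋅ vfst = src G;
  ends_snd : ends ⋅ vsnd = tgt G;
  ends_dof : is_DOF ends;
  vdiag : hc V vpair;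
  vdiag_fst : vdiag ⋅ vfst = id1 V;
  vdiag_snd : vdiag ⋅ vsnd = id1 V;
  vdiag_dof : is_DOF vdiag;
  path2 : C;
  path_fst : hc path2 E;
  path_snd : hc path2 E;
  path_fst_dof : is_DOF path_fst;
  path_pb : pullback1 path_fst path_snd (tgt G) (src G);
  path_ends : hc path2 vpair;
  path_ends_fst : path_ends ⋅ vfst = path_fst ⋅ src G;
  path_ends_snd : path_ends ⋅ vsnd = path_snd ⋅ tgt G;
  tri : C;
  tri_path : hc tri path2;
  tri_edge : hc tri E;
  tri_path_dof : is_DOF tri_path;
  tri_pb : pullback1 tri_path tri_edge path_ends ends
}.

Lemma triangles_ex : corepita C -> inhabited triangles.
Proof.
move=> HC.
have [VV [v1 [v2 [dofv1 pbV]]]] := dof_pb HC vm (@vmap_dof _ G).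
have [ed [ed1 ed2]] := pb_ex pbV (etrans (src_vmap G) (esym (tgt_vmap G))).
have [dg [dg1 dg2]] := pb_ex pbV (erefl (id1 V ⋅ vm)).
have [Q [q1 [q2 [dofq1 pbQ]]]] := dof_pb HC (tgt G) src_dof.
have pe : q1 ⋅ src G ⋅ vm = q2 ⋅ tgt G ⋅ vm.
  by rewrite src_vm tgt_vm -(tgt_vm q1) -(src_vm q2) pbQ.1.
have [g [g1 g2]] := pb_ex pbV pe.
have dofed : is_DOF ed by apply: (@dof_cancel _ _ _ _ _ v1); rewrite ?ed1 //; apply: src_dof.
have dofdg : is_DOF dg by apply: (@dof_cancel _ _ _ _ _ v1); rewrite ?dg1 //; apply: dof_id.
have [T [t1 [t2 [doft1 pbT]]]] := dof_pb HC g dofed.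
by split; apply: (Triangles dofv1 pbV ed1 ed2 dofed dg1 dg2 dofdg dofq1 pbQ g1 g2 doft1 pbT).
Qed.

Section Triangles.
Context (T : triangles).

Lemma vdiag_monic : monic (vdiag T).
Proof. by move=> B u v e; rewrite -[u]h1_idr -[v]h1_idr -(vdiag_fst T) -!h1_assoc e. Qed.

Lemma path_snd_dof : is_DOF (path_snd T).
Proof.
apply: (@dof_cancel _ _ _ _ _ (src G)); last exact: src_dof.
rewrite -(path_pb T).1; apply: dof_comp tgt_dof; exact: path_fst_dof.
Qed.

Lemma tri_ex {A : C} (r1 r2 r3 : hc A E) :
  r1 ⋅ tgt G = r2 ⋅ src G -> r3 ⋅ src G = r1 ⋅ src G -> r3 ⋅ tgt G = r2 ⋅ tgt G ->
  exists w : hc A (tri T), [/\ w ⋅ tri_path T ⋅ path_fst T = r1, w ⋅ tri_path T ⋅ path_snd T = r2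
    & w ⋅ tri_edge T = r3].
Proof.
move=> e12 e31 e32; have [w [w1 w2]] := pb_ex (path_pb T) e12.
have e : w ⋅ path_ends T = r3 ⋅ ends T.
  apply: (pb_ext (vpair_pb T)); rewrite !h1_assoc.
    by rewrite path_ends_fst ends_fst -h1_assoc w1.
  by rewrite path_ends_snd ends_snd -h1_assoc w2.
have [v [v1 v2]] := pb_ex (tri_pb T) e.
by exists v; rewrite v1.
Qed.

Lemma tri_eq {A : C} (w : hc A (tri T)) :
  [/\ w ⋅ tri_path T ⋅ path_fst T ⋅ tgt G = w ⋅ tri_path T ⋅ path_snd T ⋅ src G,
      w ⋅ tri_edge T ⋅ src G = w ⋅ tri_path T ⋅ path_fst T ⋅ src G
    & w ⋅ tri_edge T ⋅ tgt G = w ⋅ tri_path T ⋅ path_snd T ⋅ tgt G].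
Proof.
have e := pb_sq (tri_pb T) w.
have e1 k : w ⋅ tri_edge T ⋅ (ends T ⋅ k) = w ⋅ tri_path T ⋅ (path_ends T ⋅ k).
  by rewrite -!(h1_assoc _ _ k) e.
have := e1 _ (vsnd T); have := e1 _ (vfst T).
rewrite ends_fst ends_snd path_ends_fst path_ends_snd -!(h1_assoc (w ⋅ tri_path T)) => e2 e3.
by split=> //; apply: (pb_sq (path_pb T)).
Qed.

Lemma tri_ext {A : C} (w w' : hc A (tri T)) :
  w ⋅ tri_path T ⋅ path_fst T = w' ⋅ tri_path T ⋅ path_fst T ->
  w ⋅ tri_path T ⋅ path_snd T = w' ⋅ tri_path T ⋅ path_snd T ->
  w ⋅ tri_edge T = w' ⋅ tri_edge T -> w = w'.
Proof.
move=> e1 e2 e3; apply: (pb_ext (tri_pb T)) => //; exact: (pb_ext (path_pb T)).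
Qed.

End Triangles.

(** The segment of the vertex [x] has the edges into [x] as vertices, [seg_elt]
    being the vertex of the segment given by such an edge.  Its edges are the
    triangles [r1 : z -> w], [r2 : w -> x], [r3 : z -> x], seen as edges from [r3] to
    [r2]. *)
Record segments : Type := Segments {
  seg : hc V M;
  seg_elt : hc E V;
  seg_pb : pullback1 (tgt G) seg_elt seg vm;
  seg_edge : forall (A : C) (x : hc A V) (r : hc A E), r ⋅ em = x ⋅ seg ->
    exists r1 r2 r3, [/\ r1 ⋅ tgt G = r2 ⋅ src G, r3 ⋅ src G = r1 ⋅ src G, r3 ⋅ tgt G = r2 ⋅ tgt G,
      r2 ⋅ tgt G = x & r3 ⋅ seg_elt = r ⋅ src G /\ r2 ⋅ seg_elt = r ⋅ tgt G];
  seg_precedes : forall (A : C) (r1 r2 r3 : hc A E),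
    r1 ⋅ tgt G = r2 ⋅ src G -> r3 ⋅ src G = r1 ⋅ src G -> r3 ⋅ tgt G = r2 ⋅ tgt G ->
    precedes (r3 ⋅ seg_elt) (r2 ⋅ seg_elt);
  seg_simple : forall (A : C) (x : hc A V), simple (x ⋅ vm) -> simple (x ⋅ seg)
}.

(** The fibration of edges over their targets is the family of all the segments, and
    a single 1-cell [seg] classifies it. *)
Lemma segments_ex : corepita C -> inhabited segments.
Proof.
move=> HC; have [T] := triangles_ex HC.
pose d := tri_edge T; pose c := tri_path T ⋅ path_snd T.
have dc : d ⋅ tgt G = c ⋅ tgt G by have [_ _] := tri_eq (id1 (tri T)); rewrite !h1_idl.
have dofr : is_DOF (c ⋅ tgt G).
  by apply: (dof_comp _ tgt_dof); rewrite /c; apply: (dof_comp (@tri_path_dof T) (@path_snd_dof T)).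
have [a [u [v [pbu pbv du cu]]]] := @gr_classifies _ G _ _ _ (tgt G) _ d c vert_gpd tgt_dof dofr dc erefl.
have edgeE (A : C) (x : hc A V) (r : hc A E) : r ⋅ em = x ⋅ a ->
    exists w : hc A (tri T), w ⋅ v = r /\ w ⋅ c ⋅ tgt G = x.
  by move=> /esym/(pb_ex pbv)[w [w1 w2]]; exists w; rewrite h1_assoc.
have wS (A : C) (w : hc A (tri T)) : w ⋅ d ⋅ u = w ⋅ v ⋅ src G by rewrite h1_assoc du h1_assoc.
have wT (A : C) (w : hc A (tri T)) : w ⋅ c ⋅ u = w ⋅ v ⋅ tgt G by rewrite h1_assoc cu h1_assoc.
split; apply: (@Segments a u pbu) => [A x r|A r1 r2 r3 e12 e31 e32|A x sx B f r r' rE].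
- move=> /edgeE[w [<- wx]]; have [e12 e31 e32] := tri_eq w.
  exists (w ⋅ tri_path T ⋅ path_fst T), (w ⋅ tri_path T ⋅ path_snd T), (w ⋅ d).
  by split=> //; rewrite ?wS -?wT /c -?h1_assoc // -wx /c -h1_assoc.
- have [w [w1 w2 w3]] := tri_ex T e12 e31 e32.
  by exists (w ⋅ v); rewrite -wS -wT w3 /c -h1_assoc w2.
rewrite -h1_assoc in rE; have [w [wr wx]] := edgeE _ _ _ rE => es et.
have r'E : r' ⋅ em = f ⋅ x ⋅ a by rewrite -src_vm -es src_vm.
have [w' [w'r w'x]] := edgeE _ _ _ r'E.
rewrite -wr -w'r -?wS -?wT in es et *; congr (_ ⋅ _).
have [e12 e31 e32] := tri_eq w; have [e12' e31' e32'] := tri_eq w'.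
have dx (k : hc B (tri T)) : k ⋅ d ⋅ tgt G = k ⋅ c ⋅ tgt G by rewrite h1_assoc dc h1_assoc.
have d_eq : w ⋅ d = w' ⋅ d by apply: (pb_ext pbu); rewrite // !dx wx w'x.
have c_eq : w ⋅ c = w' ⋅ c by apply: (pb_ext pbu); rewrite // wx w'x.
rewrite /d /c -?h1_assoc in d_eq c_eq wx.
apply: tri_ext => //; apply: (sx _ f).
- by rewrite -h1_assoc -wx tgt_vm -tgt_vm e12 src_vm.
- by rewrite -e31 -e31' d_eq.
by rewrite e12 e12' c_eq.
Qed.

End Graphs.

(** * Good graphs *)

Section Segments.
Context {C : two_category} (G : graph_classifier C) (Sg : segments G).
Local Notation M := (graphs G).
Local Notation V := (vert G).
Local Notation E := (edge G).
Local Notation vm := (vmap G).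
Local Notation em := (emap G).
Local Notation sg := (seg Sg).

(** [y] is a vertex of the segment of [x], and [z] is the vertex of the ambient graph
    that it stands for. *)
Definition included {A : C} (x y z : hc A V) : Prop :=
  exists r : hc A E, [/\ r ⋅ tgt G = x, r ⋅ seg_elt Sg = y & r ⋅ src G = z].

Lemma included_ends {A : C} (x y z : hc A V) : included x y z ->
  [/\ y ⋅ vm = x ⋅ sg, z ⋅ vm = x ⋅ vm & precedes z x].
Proof.
move=> [r [<- <- <-]]; split; first by rewrite (pb_sq (seg_pb Sg)).
  by rewrite src_vm tgt_vm.
by exists r.
Qed.

Lemma included_pre {A B : C} (f : hc B A) (x y z : hc A V) :
  included x y z -> included (f ⋅ x) (f ⋅ y) (f ⋅ z).
Proof. by move=> [r [<- <- <-]]; exists (f ⋅ r); rewrite !h1_assoc. Qed.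

Lemma included_ex {A : C} (x y : hc A V) : y ⋅ vm = x ⋅ sg -> exists z, included x y z.
Proof.
move=> /esym/(pb_ex (seg_pb Sg))[r [rx ry]].
by exists (r ⋅ src G), r.
Qed.

Lemma included_of_precedes {A : C} (x z : hc A V) : precedes z x -> exists y, included x y z.
Proof. by move=> [r [<- <-]]; exists (r ⋅ seg_elt Sg), r. Qed.

Lemma included_fun {A : C} (x y z z' : hc A V) : included x y z -> included x y z' -> z = z'.
Proof.
move=> [r [rx ry <-]] [r' [r'x r'y <-]].
by have -> : r = r' by apply: (pb_ext (seg_pb Sg)); rewrite ?rx ?ry.
Qed.

Lemma included_inj {A : C} (x y y' z : hc A V) : simple (x ⋅ vm) ->
  included x y z -> included x y' z -> y = y'.
Proof.
move=> sx [r [rx <- rz]] [r' [r'x <- r'z]].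
have -> // : r = r'; apply: (sx _ (id1 A)); rewrite ?rz ?rx //.
by rewrite h1_idl -rx tgt_vm.
Qed.

(** An edge of the segment is a triangle, whose first side is an edge of the ambient
    graph between the vertices in question. *)
Lemma included_precedes {A : C} (x y z y' z' : hc A V) :
  included x y z -> included x y' z' -> precedes y y' <-> precedes z z'.
Proof.
move=> [r [rx ry rz]] [r' [r'x r'y r'z]]; split=> [[w [wy wy']]|[r1 [r1z r1z']]].
  have we : w ⋅ em = x ⋅ sg by rewrite -src_vm wy -ry -(pb_sq (seg_pb Sg)) rx.
  have [r1 [r2 [r3 [e12 e31 e32 e2 [e3y e2y]]]]] := seg_edge we.
  have e3 : r3 = r by apply: (pb_ext (seg_pb Sg)); rewrite ?e3y ?wy ?ry // e32 e2 rx.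
  have e2' : r2 = r' by apply: (pb_ext (seg_pb Sg)); rewrite ?e2y ?wy' ?r'y // e2 r'x.
  by exists r1; rewrite -e31 e3 rz e12 e2' r'z.
by rewrite -ry -r'y; apply: (@seg_precedes _ _ Sg _ r1 r' r); rewrite ?r1z' ?r'z ?r1z ?rz ?rx ?r'x.
Qed.

(** The segment of [y] in the segment of [x] consists of the [w < y] with [w < x];
    transitivity makes these all the [w < y]. *)
Lemma seg_included {A : C} (x y z : hc A V) : simple (x ⋅ vm) ->
  (forall (B : C) (f : hc B A) u v, v ⋅ vm = f ⋅ (x ⋅ vm) ->
     precedes u v -> precedes v (f ⋅ x) -> precedes u (f ⋅ x)) ->
  included x y z -> graph_iso (y ⋅ sg) (z ⋅ sg).
Proof.
move=> sx tr Ixyz; have [yE zE zx] := included_ends Ixyz.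
have sxs := @seg_simple _ _ Sg _ _ sx.
have sy : simple (y ⋅ vm) by rewrite yE.
have sz : simple (z ⋅ vm) by rewrite zE.
pose P (B : C) (f : hc B A) u v :=
  exists w w', [/\ included (f ⋅ y) u w, included (f ⋅ x) w w' & included (f ⋅ z) v w'].
have spre (k : hc A V) (B : C) (f : hc B A) : simple (k ⋅ vm) -> simple (f ⋅ k ⋅ vm).
  by move=> sk; rewrite h1_assoc; apply: simple_pre.
have Ipre (B : C) (f : hc B A) := included_pre f Ixyz.
apply: (@graph_iso_of_order _ _ _ _ _ P); [exact: seg_simple|exact: seg_simple| |].
  split=> [B D g f u v [w [w' [I1 I2 I3]]]|B f u v [w [w' [I1 I2 I3]]]|B f u uE|B f v vE].
  - exists (g ⋅ w), (g ⋅ w'); rewrite !h1_assoc.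
    by split; apply: included_pre.
  - by have [-> _ _] := included_ends I1; have [-> _ _] := included_ends I3; rewrite !h1_assoc.
  - rewrite -h1_assoc in uE; have [w I1] := included_ex uE; have [_ wE wy] := included_ends I1.
    have wE' : w ⋅ vm = f ⋅ x ⋅ sg by rewrite wE h1_assoc yE -h1_assoc.
    have [w' I2] := included_ex wE'.
    have w'z : precedes w' (f ⋅ z) by apply/(included_precedes I2 (Ipre B f)).
    have [v I3] := included_of_precedes w'z.
    exists v; split=> [|v' [w1 [w1' [J1 J2 J3]]]]; first by exists w, w'.
    have ew := included_fun I1 J1; subst w1; have ew' := included_fun I2 J2; subst w1'.
    by apply: included_inj I3 J3; apply: spre.
  rewrite -h1_assoc in vE; have [w' I3] := included_ex vE; have [_ w'E w'z] := included_ends I3.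
  have zf : f ⋅ z ⋅ vm = f ⋅ (x ⋅ vm) by rewrite h1_assoc zE.
  have w'x := tr B f _ _ zf w'z (precedes_pre f zx).
  have [w I2] := included_of_precedes w'x.
  have wy : precedes w (f ⋅ y) by apply/(included_precedes I2 (Ipre B f)).
  have [u I1] := included_of_precedes wy.
  exists u; split=> [|u' [w1 [w1' [J1 J2 J3]]]]; first by exists w, w'.
  have ew' := included_fun I3 J3; subst w1'.
  have ew : w = w1 by apply: included_inj I2 J2; apply: spre.
  by subst w1; apply: included_inj I1 J1; apply: spre.
move=> B f u1 u2 v1 v2 [w1 [w1' [I1 I2 I3]]] [w2 [w2' [J1 J2 J3]]].
by rewrite (included_precedes I1 J1) (included_precedes I2 J2) (included_precedes I3 J3).
Qed.

Section Good.
Context {K F : C} (phi : hc F K).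

(** The proposition [phi], which is a subobject of [K], at the generalized element
    [k]. *)
Definition holds {A : C} (k : hc A K) : Prop := exists g : hc A F, g ⋅ phi = k.

(** [seg] being injective up to isomorphism replaces extensionality and
    well-foundedness of ordinals.  The last two fields are negative statements, with
    the proposition [phi] in the place of falsity. *)
Record good {A : C} (a : hc A M) (k : hc A K) : Prop := Good {
  good_simple : simple a;
  good_trans : forall (B : C) (f : hc B A) (x y z : hc B V), z ⋅ vm = f ⋅ a ->
    precedes x y -> precedes y z -> precedes x z;
  good_inj : forall (B : C) (f : hc B A) (x y : hc B V), x ⋅ vm = f ⋅ a -> y ⋅ vm = f ⋅ a ->
    graph_iso (x ⋅ sg) (y ⋅ sg) -> x = y;
  good_irr : forall (B : C) (f : hc B A) (x : hc B V), x ⋅ vm = f ⋅ a -> precedes x x -> holds (f ⋅ k);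
  good_proper : forall (B : C) (f : hc B A) (x : hc B V), x ⋅ vm = f ⋅ a ->
    graph_iso (f ⋅ a) (x ⋅ sg) -> holds (f ⋅ k)
}.

Lemma good_pre {A B : C} (f : hc B A) (a : hc A M) (k : hc A K) : good a k -> good (f ⋅ a) (f ⋅ k).
Proof.
move=> ga; split=> [|D g x y z|D g x y|D g x|D g x]; rewrite -?h1_assoc.
- exact: simple_pre (good_simple ga).
- exact: good_trans ga _ _ _ _ _.
- exact: good_inj ga _ _ _ _.
- exact: good_irr ga _ _ _.
- exact: good_proper ga _ _ _.
Qed.

Lemma good_seg_included {A : C} (a : hc A M) (k : hc A K) (x y z : hc A V) :
  good a k -> x ⋅ vm = a -> included x y z -> graph_iso (y ⋅ sg) (z ⋅ sg).
Proof.
move=> ga xE; apply: seg_included; first by rewrite xE; apply: good_simple ga.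
move=> B f u v vE uv vx; apply: (good_trans ga (f := f)) uv vx.
by rewrite h1_assoc xE.
Qed.

(** Everything is transported along the inclusion into the ambient graph, which
    preserves segments.  If the segment of [x] is isomorphic to one of its own
    segments, at [z < x] say, then [x = z] by injectivity and so [x < x]. *)
Lemma good_seg {A : C} (a : hc A M) (k : hc A K) (x : hc A V) :
  good a k -> x ⋅ vm = a -> good (x ⋅ sg) k.
Proof.
move=> ga xE.
have sx : simple (x ⋅ vm) by rewrite xE; apply: good_simple ga.
have fE (B : C) (f : hc B A) : f ⋅ x ⋅ vm = f ⋅ a by rewrite h1_assoc xE.
have inc (B : C) (f : hc B A) y : y ⋅ vm = f ⋅ (x ⋅ sg) -> exists z,
    [/\ included (f ⋅ x) y z, z ⋅ vm = f ⋅ a, precedes z (f ⋅ x) & graph_iso (y ⋅ sg) (z ⋅ sg)].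
  rewrite -h1_assoc => /included_ex[z I]; have [_ zE zx] := included_ends I.
  exists z; split=> //; first by rewrite zE fE.
  exact: good_seg_included (good_pre f ga) (fE B f) I.
split=> [|B f y1 y2 y3 y3E|B f y1 y2 y1E y2E|B f y yE|B f y yE].
- exact: seg_simple.
- move=> l12 l23; have y2E : y2 ⋅ vm = f ⋅ (x ⋅ sg) by rewrite (precedes_vm l23).
  have y1E : y1 ⋅ vm = f ⋅ (x ⋅ sg) by rewrite (precedes_vm l12).
  have [z1 [I1 _ _ _]] := inc _ _ _ y1E; have [z2 [I2 _ _ _]] := inc _ _ _ y2E.
  have [z3 [I3 z3E _ _]] := inc _ _ _ y3E.
  apply/(included_precedes I1 I3); apply: (good_trans ga z3E (y := z2)).
    by apply/(included_precedes I1 I2).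
  by apply/(included_precedes I2 I3).
- have [z1 [I1 z1E _ g1]] := inc _ _ _ y1E; have [z2 [I2 z2E _ g2]] := inc _ _ _ y2E.
  move=> g12; have ez : z1 = z2.
    apply: (good_inj ga z1E z2E); apply: graph_iso_trans (graph_iso_sym g1) _; exact: graph_iso_trans g12 g2.
  subst z2; apply: included_inj I1 I2; rewrite h1_assoc; exact: simple_pre.
- have [z [I zE _ _]] := inc _ _ _ yE => l.
  by apply: (good_irr ga zE); apply/(included_precedes I I).
have [z [I zE zx g]] := inc _ _ _ yE => g'.
have e : f ⋅ x = z.
  apply: (good_inj ga (fE B f) zE); rewrite h1_assoc; exact: graph_iso_trans g' g.
by apply: (good_irr ga zE); rewrite -{2}e.
Qed.

(** If two isomorphisms send [x] to [y] and to [y'], then [y] and [y'] have segments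
    isomorphic to that of [x], hence are equal. *)
Lemma good_rigid {A : C} (a b : hc A M) (k : hc A K) (c c' : a ⟹ b) : good b k -> c = c'.
Proof.
move=> gb; apply: gcell_ext_simple; first exact: good_simple gb.
move=> B f x y o; have [xE yE] := carries_ends o.
have [y' o'] := carries_ex (@vmap_dof _ G) (f ◃ c') xE.
have [_ y'E] := carries_ends o'.
suff -> : y = y' by [].
apply: (good_inj gb yE y'E); apply: (@graph_iso_trans _ _ _ _ (x ⋅ sg)).
  by apply: graph_iso_sym; case: o => d _; split; apply: (d ▹ sg).
by case: o' => d _; split; apply: (d ▹ sg).
Qed.

End Good.
End Segments.

(** * Definability of goodness *)

Section Loci.
Context {C : two_category} (HC : corepita C).

Lemma locus_ext {A L : C} (l : hc L A) Q Q' :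
  (forall (B : C) (f : hc B A), Q B f <-> Q' B f) -> locus l Q -> locus l Q'.
Proof. by move=> e [dl ml lQ]; split=> // B f; rewrite lQ e. Qed.

Lemma locus_pull {A B L : C} (l : hc L A) Q (g : hc B A) : locus l Q ->
  exists (L' : C) (l' : hc L' B), locus l' (fun D f => Q D (f ⋅ g)).
Proof.
move=> [dl ml lQ]; have [L' [l' [k [dl' pb]]]] := dof_pb HC g dl.
exists L', l'; split=> // [D u v e|D f].
  by apply: (pb_ext pb) => //; apply: ml; rewrite -!(pb_sq pb) e.
rewrite -lQ; split=> [[u <-]|[u e]]; first by exists (u ⋅ k); rewrite (pb_sq pb).
by have [w [wl _]] := pb_ex pb (esym e); exists w.
Qed.

Lemma locus_and {A L L' : C} (l : hc L A) (l' : hc L' A) Q Q' : locus l Q -> locus l' Q' ->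
  exists (N : C) (n : hc N A), locus n (fun B f => Q B f /\ Q' B f).
Proof.
move=> [dl ml lQ] lQ'; have [N [n [dn mn nQ]]] := locus_pull l lQ'.
exists N, (n ⋅ l); split=> [|B u v|B f]; first exact: dof_comp.
  by rewrite -!h1_assoc => /ml/mn.
rewrite -lQ; split=> [[u uE]|[[v vE] Qf]].
  by rewrite -uE; split; [exists (u ⋅ n) | rewrite -h1_assoc; apply/nQ; exists u]; rewrite ?h1_assoc.
by have [|u uE] := (nQ _ v).2; rewrite ?vE //; exists u; rewrite -h1_assoc uE.
Qed.

Context (S : DOF_classifier C).
Context (small : forall (A X : C) (q : hc X A), is_SOF q -> SOF_small S q).

(** The special case of [bijectivity_locus] for the inclusion of the part of [X]
    where [phi] holds. *)
Lemma implication_locus {A X K F : C} (q : hc X A) (k : hc X K) (phi : hc F K) :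
  is_groupoidal A -> is_DOF q -> is_DOF phi -> monic phi ->
  exists (L : C) (l : hc L A), locus l (fun B f =>
    forall (D : C) (h : hc D B) (z : hc D X), z ⋅ q = h ⋅ f -> holds phi (z ⋅ k)).
Proof.
move=> gA dq dphi mphi; have [Y [y1 [y2 [dy1 pb]]]] := dof_pb HC k dphi.
have [L [l lQ]] := bijectivity_locus HC small gA dq dy1.
exists L, l; apply: locus_ext lQ => B f; split=> H D h z zE; have := H D h z zE.
  by move=> [y [<- _]]; exists (y ⋅ y2); rewrite (pb_sq pb).
move=> [w wE]; have [y [y1E y2E]] := pb_ex pb (esym wE).
exists y; split=> // y' y'1; apply: (pb_ext pb); first by rewrite y1E y'1.
by apply: mphi; rewrite -!(pb_sq pb) y1E y'1.
Qed.

Context (G : graph_classifier C) (Sg : segments G).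
Local Notation M := (graphs G).
Local Notation V := (vert G).
Local Notation E := (edge G).
Local Notation vm := (vmap G).
Local Notation em := (emap G).
Local Notation sg := (seg Sg).

(** Quantification over pairs of parallel edges, of the proposition that they are
    equal. *)
Lemma simple_locus : exists (L : C) (l : hc L M), locus l (fun B f => simple f).
Proof.
have [T] := triangles_ex G HC.
have [X [k1 [k2 [dk1 pb]]]] := dof_pb HC (ends T) (@ends_dof _ _ T).
have [dg [dg1 dg2]] := pb_ex pb (erefl (id1 E ⋅ ends T)).
have ddg : is_DOF dg by apply: (@dof_cancel _ _ _ _ dg k1); rewrite ?dg1 //; apply: dof_id.
have mdg : monic dg by move=> B u v e; rewrite -[u]h1_idr -[v]h1_idr -dg1 -!h1_assoc e.
have [L [l lQ]] := implication_locus (id1 X) (@gr_gpd _ G) (dof_comp dk1 (@emap_dof _ G)) ddg mdg.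
exists L, l; apply: locus_ext lQ => B f; split=> H.
  move=> D h r r' rE es et; have e : r ⋅ ends T = r' ⋅ ends T.
    by apply: (pb_ext (vpair_pb T)); rewrite !h1_assoc ?ends_fst ?ends_snd.
  have [z [z1 z2]] := pb_ex pb e.
  have [|w] := H D h z; first by rewrite -h1_assoc z1.
  by rewrite h1_idr -z1 -z2 => <-; rewrite !h1_assoc dg1 dg2.
move=> D h z; rewrite -h1_assoc => zE; exists (z ⋅ k1); rewrite h1_idr.
have ee : z ⋅ k1 = z ⋅ k2.
  have ez := pb_sq pb z; apply: (H _ h) => //.
    by rewrite -(ends_fst T) -!(h1_assoc _ (ends T)) ez.
  by rewrite -(ends_snd T) -!(h1_assoc _ (ends T)) ez.
by apply: (pb_ext pb); rewrite h1_assoc ?dg1 ?dg2 h1_idr.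
Qed.

(** Transitivity is bijectivity of the map from triangles to paths, since in a simple
    graph a path is completed to a triangle in at most one way. *)
Lemma simple_trans_locus : exists (L : C) (l : hc L M), locus l (fun B f => simple f /\
  forall (D : C) (h : hc D B) (x y z : hc D V), z ⋅ vm = h ⋅ f -> precedes x y -> precedes y z -> precedes x z).
Proof.
have [T] := triangles_ex G HC; have [L [l lS]] := simple_locus.
have [L' [l' lT]] := bijectivity_locus HC small (@gr_gpd _ G)
  (dof_comp (@path_fst_dof _ _ T) (@emap_dof _ G)) (@tri_path_dof _ _ T).
have [N [n nQ]] := locus_and lS lT.
exists N, n; apply: locus_ext nQ => B f; split=> [[sf H]|[sf H]]; split=> //.
  move=> D h x y z zE [r1 [r1x r1y]] [r2 [r2y r2z]].
  have [w [w1 w2]] := pb_ex (path_pb T) (etrans r1y (esym r2y)).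
  have [|v [vw _]] := H D h w.
    by rewrite -h1_assoc w1 -tgt_vm r1y -r2y src_vm -tgt_vm r2z.
  have [_ e31 e32] := tri_eq v.
  by exists (v ⋅ tri_edge T); rewrite e31 e32 vw w1 w2.
move=> D h w wE; rewrite -h1_assoc in wE; have pe := pb_sq (path_pb T) w.
have [|||r3 [r3s r3t]] := H D h (w ⋅ path_fst T ⋅ src G) (w ⋅ path_fst T ⋅ tgt G) (w ⋅ path_snd T ⋅ tgt G).
- by rewrite tgt_vm -src_vm -pe tgt_vm.
- by exists (w ⋅ path_fst T).
- by exists (w ⋅ path_snd T); rewrite pe.
have [v [v1 v2 v3]] := tri_ex T pe r3s r3t.
exists v; split=> [|v' v'w]; first exact: (pb_ext (path_pb T)).
apply: tri_ext; rewrite ?v1 ?v2 ?v'w // v3.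
have [_ e31 e32] := tri_eq v'.
apply: (sf _ h); first by rewrite -src_vm r3s src_vm.
  by rewrite e31 v'w.
by rewrite e32 v'w.
Qed.

(** Quantification over pairs of vertices together with an isomorphism of their
    segments; these form a set because they are 2-cells into [graphs]. *)
Lemma inj_locus : exists (L : C) (l : hc L M), locus l (fun B f =>
  forall (D : C) (h : hc D B) (x y : hc D V), x ⋅ vm = h ⋅ f -> y ⋅ vm = h ⋅ f ->
    graph_iso (x ⋅ sg) (y ⋅ sg) -> x = y).
Proof.
have [T] := triangles_ex G HC.
have gVV : is_groupoidal (vpair T) := dof_groupoidal (@vfst_dof _ _ T) (@vert_gpd _ G).
have [H [h [eta rH]]] := cell_object HC (vfst T ⋅ sg) (vsnd T ⋅ sg) gVV.
have dq := dof_comp rH.1 (dof_comp (@vfst_dof _ _ T) (@vmap_dof _ G)).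
have [L [l lQ]] := implication_locus h (@gr_gpd _ G) dq (@vdiag_dof _ _ T) (@vdiag_monic _ _ T).
exists L, l; apply: locus_ext lQ => B f; split=> Hf D g.
  move=> x y xE yE [c]; have [w [w1 w2]] := pb_ex (vpair_pb T) (etrans xE (esym yE)).
  have e1 : x ⋅ sg = w ⋅ (vfst T ⋅ sg) by rewrite -h1_assoc w1.
  have e2 : y ⋅ sg = w ⋅ (vsnd T ⋅ sg) by rewrite -h1_assoc w2.
  have [c' _] := arr_cast c e1 e2.
  have [z [zh _]] := represents_cells_ex rH c'.
  have [|u uE] := Hf D g z; first by rewrite -h1_assoc zh -h1_assoc w1.
  by rewrite -w1 -w2 -zh -uE !h1_assoc vdiag_fst vdiag_snd.
move=> z; rewrite -!h1_assoc => zE; exists (z ⋅ h ⋅ vfst T).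
have ee : z ⋅ h ⋅ vfst T = z ⋅ h ⋅ vsnd T.
  apply: (Hf _ g) => //; first by rewrite -(pb_sq (vpair_pb T)).
  have [c _] := arr_cast (z ◃ eta) (esym (h1_assoc _ _ _)) (esym (h1_assoc _ _ _)).
  by have [c' _] := arr_cast c (esym (h1_assoc (z ⋅ h) _ _)) (esym (h1_assoc (z ⋅ h) _ _)).
by apply: (pb_ext (vpair_pb T)); rewrite h1_assoc ?vdiag_fst ?vdiag_snd h1_idr.
Qed.

Section GoodLocus.
Context {K F P : C} (phi : hc F K) (p1 : hc P M) (p2 : hc P K).
Context (gK : is_groupoidal K) (dphi : is_DOF phi) (mphi : monic phi) (pr : is_strict_product p1 p2).

Lemma irr_locus : exists (L : C) (l : hc L P), locus l (fun B f =>
  forall (D : C) (h : hc D B) (x : hc D V), x ⋅ vm = h ⋅ (f ⋅ p1) -> precedes x x ->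
    holds phi (h ⋅ (f ⋅ p2))).
Proof.
have gP : is_groupoidal P := prod_groupoidal pr (@gr_gpd _ G) gK.
have [T] := triangles_ex G HC.
have [Y [y1 [y2 [dy1 pbY]]]] := dof_pb HC (ends T) (@vdiag_dof _ _ T).
have [X [x1 [x2 [dx1 pbX]]]] := dof_pb HC p1 (dof_comp dy1 (@emap_dof _ G)).
have [L [l lQ]] := implication_locus (x1 ⋅ p2) gP dx1 dphi mphi.
exists L, l; apply: locus_ext lQ => B f; split=> H D h.
  move=> x xE [r [rs rt]]; have e : r ⋅ ends T = x ⋅ vdiag T.
    by apply: (pb_ext (vpair_pb T)); rewrite !h1_assoc ?ends_fst ?ends_snd ?vdiag_fst ?vdiag_snd h1_idr.
  have [y [yr _]] := pb_ex pbY e.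
  have e' : h ⋅ f ⋅ p1 = y ⋅ (y1 ⋅ em) by rewrite -(h1_assoc y) yr -src_vm rs xE h1_assoc.
  have [z [z1 _]] := pb_ex pbX e'.
  by have := H D h z z1; rewrite -h1_assoc z1 h1_assoc.
move=> z zE; have e := pb_sq pbX z; rewrite zE -(h1_assoc _ y1) in e.
rewrite -h1_assoc zE h1_assoc; set r := z ⋅ x2 ⋅ y1 in e.
have ey : r ⋅ ends T = z ⋅ x2 ⋅ y2 ⋅ vdiag T := pb_sq pbY (z ⋅ x2).
have es : r ⋅ src G = z ⋅ x2 ⋅ y2 by rewrite -(ends_fst T) -h1_assoc ey h1_assoc vdiag_fst h1_idr.
have et : r ⋅ tgt G = z ⋅ x2 ⋅ y2 by rewrite -(ends_snd T) -h1_assoc ey h1_assoc vdiag_snd h1_idr.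
apply: (H D h (r ⋅ src G)); first by rewrite src_vm -e h1_assoc.
by exists r; rewrite et es.
Qed.

Lemma proper_locus : exists (L : C) (l : hc L P), locus l (fun B f =>
  forall (D : C) (h : hc D B) (x : hc D V), x ⋅ vm = h ⋅ (f ⋅ p1) ->
    graph_iso (h ⋅ (f ⋅ p1)) (x ⋅ sg) -> holds phi (h ⋅ (f ⋅ p2))).
Proof.
have gP : is_groupoidal P := prod_groupoidal pr (@gr_gpd _ G) gK.
have [X [x1 [x2 [dx1 pbX]]]] := dof_pb HC p1 (@vmap_dof _ G).
have [H [h [eta rH]]] := cell_object HC (x1 ⋅ p1) (x2 ⋅ sg) (dof_groupoidal dx1 gP).
have [L [l lQ]] := implication_locus (h ⋅ (x1 ⋅ p2)) gP (dof_comp rH.1 dx1) dphi mphi.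
exists L, l; apply: locus_ext lQ => B f; split=> Hf D g.
  move=> x xE [c]; have e : g ⋅ f ⋅ p1 = x ⋅ vm by rewrite xE h1_assoc.
  have [w [w1 w2]] := pb_ex pbX e.
  have e1 : g ⋅ (f ⋅ p1) = w ⋅ (x1 ⋅ p1) by rewrite -h1_assoc -(h1_assoc w) w1.
  have e2 : x ⋅ sg = w ⋅ (x2 ⋅ sg) by rewrite -h1_assoc w2.
  have [c' _] := arr_cast c e1 e2.
  have [z [zh _]] := represents_cells_ex rH c'.
  have := Hf D g z; rewrite -!h1_assoc zh w1; exact.
move=> z; rewrite -!h1_assoc => zE; rewrite zE h1_assoc.
have e := pb_sq pbX (z ⋅ h); rewrite zE in e.
apply: (Hf _ g (z ⋅ h ⋅ x2)); first by rewrite -e h1_assoc.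
have e1 : z ⋅ (h ⋅ (x1 ⋅ p1)) = g ⋅ (f ⋅ p1) by rewrite -!h1_assoc zE.
have e2 : z ⋅ (h ⋅ (x2 ⋅ sg)) = z ⋅ h ⋅ x2 ⋅ sg by rewrite -!h1_assoc.
by have [c _] := arr_cast (z ◃ eta) e1 e2.
Qed.

Lemma good_locus : exists (L : C) (l : hc L P),
  locus l (fun B f => good Sg phi (f ⋅ p1) (f ⋅ p2)).
Proof.
have [L1 [l1 Q1]] := simple_trans_locus; have [L2 [l2 Q2]] := inj_locus.
have [L3 [l3 Q3]] := locus_and Q1 Q2; have [L4 [l4 Q4]] := locus_pull p1 Q3.
have [L5 [l5 Q5]] := irr_locus; have [L6 [l6 Q6]] := proper_locus.
have [L7 [l7 Q7]] := locus_and Q5 Q6; have [L8 [l8 Q8]] := locus_and Q4 Q7.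
exists L8, l8; apply: locus_ext Q8 => B f; split=> [[[[H1 H2] H3] [H4 H5]]|[]] //.
Qed.

End GoodLocus.
End Loci.

(** * The graph of all good graphs *)

Section Paradox.
Context {C : two_category} (G : graph_classifier C) (Sg : segments G).
Local Notation M := (graphs G).
Local Notation V := (vert G).
Local Notation E := (edge G).
Local Notation vm := (vmap G).
Local Notation em := (emap G).
Local Notation sg := (seg Sg).

Lemma graph_iso_seg {A : C} (a b : hc A M) (x : hc A V) : graph_iso a b -> x ⋅ vm = a ->
  exists x', x' ⋅ vm = b /\ graph_iso (x ⋅ sg) (x' ⋅ sg).
Proof.
move=> [c] xE; have [x' o] := carries_ex (@vmap_dof _ G) c xE.
have [_ x'E] := carries_ends o; exists x'; split=> //.
by case: o => d _; split; apply: (d ▹ sg).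
Qed.

Context {K F P N : C} {phi : hc F K} {p1 : hc P M} {p2 : hc P K} {l : hc N P}.
Context (gK : is_groupoidal K) (pr : is_strict_product p1 p2).
Context (lN : locus l (fun B f => good Sg phi (f ⋅ p1) (f ⋅ p2))).

Lemma rep_good {A : C} (n : hc A N) : good Sg phi (n ⋅ l ⋅ p1) (n ⋅ l ⋅ p2).
Proof. by case: lN => _ _ lQ; apply/(lQ _ (n ⋅ l)); exists n. Qed.

Lemma good_rep {A : C} (a : hc A M) (k : hc A K) : good Sg phi a k ->
  exists n : hc A N, n ⋅ l ⋅ p1 = a /\ n ⋅ l ⋅ p2 = k.
Proof.
case: lN => _ _ lQ ga; have [w [w1 w2]] := prod_ex pr a k.
have /lQ[n nE] : good Sg phi (w ⋅ p1) (w ⋅ p2) by rewrite w1 w2.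
by exists n; rewrite nE.
Qed.

Lemma rep_gpd : is_groupoidal N.
Proof. by case: lN => dl _ _; apply: dof_groupoidal dl (prod_groupoidal pr (@gr_gpd _ G) gK). Qed.

(** Faithfulness is rigidity of good graphs.  The other two conditions hold for any
    isofibration between groupoidal objects. *)
Lemma rep_sof : is_SOF (l ⋅ p2).
Proof.
have [dl ml lQ] := lN; move=> A; split=> [x y c c' /= e|x y f|x y f y0 y1 f0 f1 /= e0 e1].
- apply: (dof_faithful dl); apply: arr_inj; apply: (prod_cell_ext pr); rewrite !wr_assoc; last by rewrite e.
  congr arr; have := @good_rigid _ _ _ _ _ phi _ (x ⋅ l ⋅ p1) (y ⋅ l ⋅ p1) (y ⋅ l ⋅ p2) (c ▹ l ▹ p1) (c' ▹ l ▹ p1) (rep_good y).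
  move/(f_equal arr); rewrite !wr_assoc; exact: arr_inj.
- have [w [w1 w2]] := prod_ex pr (x ⋅ l ⋅ p1) y.
  have [r [_ r2]] := prod_cell pr (idm (x ⋅ l ⋅ p1)) f erefl (h1_assoc _ _ _) w1 w2.
  have [z [c cE]] := carries_ex dl r erefl.
  by exists z, c; rewrite /= -wr_assoc -r2; apply: wr_arr.
have [g0 [fg gf]] := rep_gpd f0; have [ey e0y] := arr_srcE e0; have [_ e1y] := arr_srcE e1.
(* Two lifts of [f] differ by the quotient [g0 • f1] in the groupoid. *)
have [i iE] := arr_cast (idm y) (esym e0y) (esym e1y).
exists (g0 • f1); split=> [|g' [g'E _]]; last by rewrite -g'E -cmp_assoc gf cmp_idl.
have e : f0 • (g0 • f1) = f1 by rewrite -cmp_assoc fg cmp_idl.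
split=> //=; rewrite -iE; congr arr.
apply: (@iso_epi _ _ _ _ (f0 ▹ (l ⋅ p2))); first by apply: wr_iso; apply: rep_gpd.
rewrite -wr_cmp e; apply: arr_inj; rewrite e1 (arr_cmp e0 iE) cmp_idr //.
Qed.

(** A DOF [o] over [K] that is isomorphic, in SOF(K), to the SOF of good graphs: its
    elements are the isomorphism classes of good graphs, [e] sends a good graph to its
    class, and [e'] chooses representatives. *)
Context {O : C} {o : hc O K} {e : hc N O} {e' : hc O N}.
Context (dofo : is_DOF o) (eo : e ⋅ o = l ⋅ p2) (e'o : e' ⋅ (l ⋅ p2) = o).
Context (ee' : SOF_hom_eq (l ⋅ p2) (l ⋅ p2) (e ⋅ e') (id1 N)) (e'e : e' ⋅ e = id1 O).
Local Notation gO := (e' ⋅ l ⋅ p1).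

Lemma class_graph_iso {A : C} (n : hc A N) : graph_iso (n ⋅ e ⋅ gO) (n ⋅ l ⋅ p1).
Proof.
case: ee' => c _.
have : n ⋅ (e ⋅ e') ⋅ l ⋅ p1 ⟹ n ⋅ id1 N ⋅ l ⋅ p1 := (n ◃ c) ▹ l ▹ p1.
by rewrite h1_idr -!h1_assoc.
Qed.

Lemma class_fiber {A : C} (n : hc A N) : n ⋅ e ⋅ o = n ⋅ l ⋅ p2.
Proof. by rewrite !h1_assoc eo. Qed.

(** Isomorphic good graphs in the same fibre have the same class: an isomorphism
    between them is sent to a 2-cell over an identity, which is an identity since [o]
    is a DOF. *)
Lemma class_eq {A : C} (n n' : hc A N) : n ⋅ l ⋅ p2 = n' ⋅ l ⋅ p2 ->
  graph_iso (n ⋅ l ⋅ p1) (n' ⋅ l ⋅ p1) -> n ⋅ e = n' ⋅ e.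
Proof.
have [dl ml _] := lN; move=> ek [c].
have [r [_ r2]] := prod_cell pr c (idm (n ⋅ l ⋅ p2)) erefl erefl erefl (esym ek).
have [m om] := carries_ex dl r erefl; have [_ /ml em'] := carries_ends om; subst m.
case: om => d dE.
have o1 : carries o (idm (n ⋅ e ⋅ o)) (n ⋅ e) (n' ⋅ e).
  exists (d ▹ e); rewrite wr_assoc class_fiber -r2.
  have -> : d ▹ (e ⋅ o) ≈ d ▹ (l ⋅ p2) by apply: wr_eq.
  by rewrite -wr_assoc; apply: wr_arr.
exact: (carries_fun dofo (carries_id erefl) o1).
Qed.

(** Elements of [O] are isomorphism classes: the retraction of [O] on good graphs
    turns an isomorphism of representatives into an equality. *)
Lemma elt_eq {A : C} (m m' : hc A O) : m ⋅ o = m' ⋅ o -> graph_iso (m ⋅ gO) (m' ⋅ gO) -> m = m'.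
Proof.
have fib (k : hc A O) : k ⋅ e' ⋅ l ⋅ p2 = k ⋅ o by rewrite -e'o !h1_assoc.
move=> eo' g; rewrite -[m]h1_idr -[m']h1_idr -e'e -!h1_assoc.
by apply: class_eq; rewrite ?fib //; rewrite -!h1_assoc in g.
Qed.

Lemma elt_good {A : C} (m : hc A O) : good Sg phi (m ⋅ gO) (m ⋅ o).
Proof.
have -> : m ⋅ o = m ⋅ e' ⋅ l ⋅ p2 by rewrite -e'o !h1_assoc.
have -> : m ⋅ gO = m ⋅ e' ⋅ l ⋅ p1 by rewrite !h1_assoc.
exact: rep_good.
Qed.

Lemma good_elt {A : C} (a : hc A M) (k : hc A K) : good Sg phi a k ->
  exists m : hc A O, m ⋅ o = k /\ graph_iso (m ⋅ gO) a.
Proof.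
move=> /good_rep[n [<- <-]]; exists (n ⋅ e).
by split; [apply: class_fiber | apply: class_graph_iso].
Qed.

(** [O] as a graph over [K], classified by [aO].  An edge consists of an element
    [fam] of [O] and of a vertex [pt] of the graph that it represents; its source is
    the class of the segment of [pt], and its target is [fam]. *)
Context {R : C} {fam : hc R O} {pt : hc R V} (pbR : pullback1 fam pt gO vm).
Context {below : hc R O} (belowo : below ⋅ o = fam ⋅ o) (belowg : graph_iso (below ⋅ gO) (pt ⋅ sg)).
Context {aO : hc K M} {u : hc O V} {v : hc R E}.
Context (pbu : pullback1 o u aO vm) (pbv : pullback1 (fam ⋅ o) v aO em).
Context (below_u : below ⋅ u = v ⋅ src G) (fam_u : fam ⋅ u = v ⋅ tgt G).

Lemma elt_vm {A : C} (m : hc A O) : m ⋅ u ⋅ vm = m ⋅ o ⋅ aO.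
Proof. by rewrite (pb_sq pbu). Qed.

Lemma vert_elt {A : C} (f : hc A K) (x : hc A V) : x ⋅ vm = f ⋅ aO ->
  exists m : hc A O, m ⋅ o = f /\ m ⋅ u = x.
Proof. by move=> /esym; exact: (pb_ex pbu). Qed.

Lemma edge_elt {A : C} (f : hc A K) (r : hc A E) : r ⋅ em = f ⋅ aO ->
  exists w : hc A R, [/\ w ⋅ fam ⋅ o = f, w ⋅ v = r, w ⋅ below ⋅ u = r ⋅ src G & w ⋅ fam ⋅ u = r ⋅ tgt G].
Proof.
move=> /esym/(pb_ex pbv)[w [w1 <-]]; exists w.
by rewrite -h1_assoc in w1; rewrite !h1_assoc below_u fam_u; split=> //; rewrite -h1_assoc.
Qed.

Lemma below_graph_iso {A : C} (w : hc A R) : graph_iso (w ⋅ below ⋅ gO) (w ⋅ pt ⋅ sg).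
Proof. by rewrite (h1_assoc w below) (h1_assoc w pt); apply: graph_iso_pre. Qed.

Lemma belowE {A : C} (w : hc A R) : w ⋅ below ⋅ o = w ⋅ fam ⋅ o.
Proof. by rewrite !h1_assoc belowo. Qed.

(** The order of [O], freed from the choice of [aO] and of its edges. *)
Lemma precedes_elt {A : C} (m' m : hc A O) : m' ⋅ o = m ⋅ o ->
  precedes (m' ⋅ u) (m ⋅ u) <-> exists x : hc A V, x ⋅ vm = m ⋅ gO /\ graph_iso (m' ⋅ gO) (x ⋅ sg).
Proof.
move=> eo'; split=> [[r [rs rt]]|[x [xE g]]].
  have re : r ⋅ em = m ⋅ o ⋅ aO by rewrite -tgt_vm rt elt_vm.
  have [w [w1 w2 w3 w4]] := edge_elt re.
  have wm : w ⋅ fam = m by apply: (pb_ext pbu); rewrite // w4.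
  have wm' : w ⋅ below = m' by apply: (pb_ext pbu); rewrite ?w3 // belowE w1.
  exists (w ⋅ pt); split; first by rewrite -(pb_sq pbR) wm.
  by rewrite -wm'; apply: below_graph_iso.
have [w [w1 w2]] := pb_ex pbR (esym xE).
have wm' : w ⋅ below = m'.
  apply: elt_eq; first by rewrite belowE w1.
  by apply: graph_iso_trans (below_graph_iso w) _; rewrite w2; apply: graph_iso_sym.
by exists (w ⋅ v); rewrite !h1_assoc -below_u -fam_u -!h1_assoc wm' w1.
Qed.

(** An edge of [O] with target [m] is a vertex of [m], which is recovered from its
    segment because [m] is good. *)
Lemma aO_simple : simple aO.
Proof.
move=> A f r r' re es et.
have r'e : r' ⋅ em = f ⋅ aO by rewrite -src_vm -es src_vm.
have [w [w1 w2 w3 w4]] := edge_elt re; have [w' [w'1 w'2 w'3 w'4]] := edge_elt r'e.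
rewrite -w2 -w'2; congr (_ ⋅ _).
have ef : w ⋅ fam = w' ⋅ fam by apply: (pb_ext pbu); [rewrite w1 w'1|rewrite w4 et -w'4].
have eb : w ⋅ below = w' ⋅ below by apply: (pb_ext pbu); [rewrite !belowE w1 w'1|rewrite w3 es -w'3].
apply: (pb_ext pbR) => //.
have gw := elt_good (w ⋅ fam).
have ptE (z : hc A R) : z ⋅ fam = w ⋅ fam -> z ⋅ pt ⋅ vm = id1 A ⋅ (w ⋅ fam ⋅ gO).
  by move=> <-; rewrite h1_idl (pb_sq pbR).
apply: (good_inj gw (ptE _ erefl) (ptE _ (esym ef))).
by apply: graph_iso_trans (graph_iso_sym (below_graph_iso w)) _; rewrite eb; apply: below_graph_iso.
Qed.

(** A vertex [y] of the graph [m] corresponds to the class of its segment, which is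
    an element below [m]; conversely an element below [m] is the segment of a vertex,
    unique because [m] is good. *)
Lemma elt_seg {A : C} (m : hc A O) : graph_iso (m ⋅ gO) (m ⋅ u ⋅ sg).
Proof.
have gm := elt_good m.
have sm (B : C) (f : hc B A) : simple (f ⋅ (m ⋅ u) ⋅ vm).
  by rewrite h1_assoc elt_vm; do 2!apply: simple_pre; apply: aO_simple.
have fo (B : C) (f : hc B A) : f ⋅ m ⋅ o = f ⋅ (m ⋅ o) by rewrite h1_assoc.
pose Q (B : C) (f : hc B A) y y' := exists w : hc B O,
  [/\ w ⋅ o = f ⋅ (m ⋅ o), y ⋅ vm = f ⋅ (m ⋅ gO), graph_iso (w ⋅ gO) (y ⋅ sg)
    & included Sg (f ⋅ (m ⋅ u)) y' (w ⋅ u)].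
apply: (@graph_iso_of_order _ _ _ _ _ Q); first exact: good_simple gm.
- by apply: seg_simple; have := sm _ (id1 A); rewrite h1_idl.
- split=> [B D g f y y' [w [w1 w2 w3 w4]]|B f y y' [w [w1 w2 w3 w4]]|B f y yE|B f y' y'E].
  + exists (g ⋅ w); rewrite !h1_assoc w1 w2; split=> //; rewrite ?h1_assoc //; last exact: included_pre.
    by have := graph_iso_pre g w3; rewrite !h1_assoc.
  + by split=> //; have [-> _ _] := included_ends w4; rewrite h1_assoc.
  + have [w [wo gw]] := good_elt (good_seg (good_pre f gm) yE).
    have wm : precedes (w ⋅ u) (f ⋅ m ⋅ u).
      apply/(precedes_elt (etrans wo (esym (fo B f)))); exists y; split=> //; by rewrite yE (h1_assoc f).
    rewrite h1_assoc in wm; have [y' I] := included_of_precedes Sg wm.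
    exists y'; split=> [|y2 [w2 [w2o _ g2 I2]]]; first by exists w.
    have ew : w = w2.
      apply: elt_eq; first by rewrite wo w2o.
      exact: graph_iso_trans gw (graph_iso_sym g2).
    by subst w2; apply: included_inj I I2; apply: sm.
  rewrite -h1_assoc in y'E; have [z I] := included_ex y'E; have [_ zE zm] := included_ends I.
  have [|w [wo wu]] := @vert_elt _ (f ⋅ (m ⋅ o)) z; first by rewrite zE h1_assoc elt_vm -h1_assoc.
  subst z; rewrite -h1_assoc in zm.
  have [y [yE gy]] := (precedes_elt (etrans wo (esym (fo B f)))).1 zm; rewrite (h1_assoc f) in yE.
  exists y; split=> [|y2 [w2 [w2o y2E g2 I2]]]; first by exists w.
  have ew : w = w2.
    apply: (pb_ext pbu); first by rewrite wo w2o.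
    exact: included_fun I I2.
  subst w2; apply: (good_inj gm yE y2E); exact: graph_iso_trans (graph_iso_sym gy) g2.
move=> B f y1 y2 y1' y2' [w1 [w1o y1E g1 I1]] [w2 [w2o y2E g2 I2]].
rewrite (included_precedes I1 I2) (precedes_elt (etrans w1o (esym w2o))).
have gf := good_pre f gm; split=> [l12|[x [xE gx]]].
  have [x' I] := included_of_precedes Sg l12; have [x'E _ _] := included_ends I.
  have [x [xE gx]] := graph_iso_seg (graph_iso_sym g2) x'E; exists x; split=> //.
  apply: graph_iso_trans g1 _; apply: graph_iso_trans gx; apply: graph_iso_sym.
  exact: good_seg_included gf y2E I.
have [x' [x'E gx']] := graph_iso_seg g2 xE; have [z I] := included_ex x'E.
have [_ zE zy2] := included_ends I.
have -> // : y1 = z; apply: (good_inj gm y1E); first by rewrite zE.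
apply: graph_iso_trans (graph_iso_sym g1) _; apply: graph_iso_trans gx _; apply: graph_iso_trans gx' _.
exact: good_seg_included gf y2E I.
Qed.

(** By [elt_seg], the segment of [O] at [m] can be replaced by [m], which is good.
    If [O] is isomorphic to the segment at [m] then [O] is isomorphic to [m]; under
    this isomorphism [m] goes to a vertex of the graph [m] with the same segment,
    so that the good graph [m] is isomorphic to one of its segments. *)
Lemma aO_good : good Sg phi aO (id1 K).
Proof.
split=> [|A f x y z zE|A f x y xE yE|A f x xE|A f x xE]; first exact: aO_simple.
- move=> lxy lyz; have yE : y ⋅ vm = f ⋅ aO by rewrite (precedes_vm lyz).
  have xE : x ⋅ vm = f ⋅ aO by rewrite (precedes_vm lxy).
  have [m1 [m1o m1u]] := vert_elt xE; have [m2 [m2o m2u]] := vert_elt yE.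
  have [m3 [m3o m3u]] := vert_elt zE; subst x y z.
  have [x3 [x3E g3]] := (precedes_elt (etrans m2o (esym m3o))).1 lyz.
  have [x2 [x2E g2]] := (precedes_elt (etrans m1o (esym m2o))).1 lxy.
  have [x2' [x2'E g2']] := graph_iso_seg g3 x2E.
  have [z I] := included_ex x2'E; have [_ zE' _] := included_ends I.
  apply/(precedes_elt (etrans m1o (esym m3o))); exists z; split; first by rewrite zE'.
  apply: graph_iso_trans g2 _; apply: graph_iso_trans g2' _.
  exact: good_seg_included (elt_good m3) x3E I.
- have [m1 [m1o m1u]] := vert_elt xE; have [m2 [m2o m2u]] := vert_elt yE; subst x y => g.
  have -> // : m1 = m2; apply: elt_eq; first by rewrite m1o.
  apply: graph_iso_trans (elt_seg m1) _; apply: graph_iso_trans g _; exact/graph_iso_sym/elt_seg.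
- have [m [mo mu]] := vert_elt xE; subst x; rewrite h1_idr => /(precedes_elt erefl)[x [xE' g]].
  have := good_proper (elt_good m) (f := id1 A) (x := x); rewrite !h1_idl mo; exact.
have [m [mo mu]] := vert_elt xE; subst x; rewrite h1_idr => g.
have g' := graph_iso_trans g (graph_iso_sym (elt_seg m)).
have [x [xE' gx]] := graph_iso_seg g' xE.
have := good_proper (elt_good m) (f := id1 A) (x := x); rewrite !h1_idl mo; apply=> //.
exact: graph_iso_trans (elt_seg m) gx.
Qed.

(** [O] is isomorphic to the element [m] that it represents, and hence to the
    segment of [O] at [m]: it is not a proper graph. *)
Lemma paradox_holds : holds phi (id1 K).
Proof.
have [m [mo g]] := good_elt aO_good.
have mE : m ⋅ u ⋅ vm = aO by rewrite elt_vm mo h1_idl.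
have := good_proper aO_good (f := id1 K) (x := m ⋅ u); rewrite !h1_idl; apply=> //.
exact: graph_iso_trans (graph_iso_sym g) (elt_seg m).
Qed.

End Paradox.

Lemma monic_dof_split {C : two_category} (HC : corepita C) (S : DOF_classifier C)
    (small : forall (A X : C) (q : hc X A), is_SOF q -> SOF_small S q)
    {K F : C} (phi : hc F K) :
  is_groupoidal K -> is_DOF phi -> monic phi -> exists s : hc K F, s ⋅ phi = id1 K.
Proof.
move=> gK dphi mphi.
have [G] := graph_classifier_ex HC small; have [Sg] := segments_ex G HC.
have [P [p1 [p2 pr]]] := product_ex HC (graphs G) K.
have [N [l lN]] := good_locus HC small Sg gK dphi mphi pr.
have [Y [_ [e [e' [eo e'o ee' e'e]]]]] := small _ _ _ (rep_sof gK pr lN).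
have dofo := @dof_is _ _ Y; set o := dof_map Y in eo e'o e'e dofo.
have {}e'e := sof_hom_eq_dof dofo e'e.
have [R [fam [pt [dfam pbR]]]] := dof_pb HC (e' ⋅ l ⋅ p1) (@vmap_dof _ G).
have gpt : good Sg phi (pt ⋅ seg Sg) (fam ⋅ o).
  by apply: (good_seg (elt_good lN e'o fam)); rewrite (pbR.1).
have [below [belowo belowg]] := good_elt pr lN eo ee' gpt.
have [aO [u [v [pbu pbv du cu]]]] := @gr_classifies _ G _ _ _ o (fam ⋅ o) below fam gK dofo
  (dof_comp dfam dofo) belowo erefl.
exact: (paradox_holds pr lN dofo eo e'o ee' e'e pbR belowo belowg pbu pbv du cu).
Qed.

(** * Existence of nerves *)

Section OrdinalFunctors.
Context {K : category}.

Lemma functor_eq_arr {J : category} (F F' : functor J K) :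
  (forall i j (u : @hom J i j), fmap F u ≈ fmap F' u) -> functor_eq F F'.
Proof.
move=> H; split=> [i|[i j u]]; last exact: H.
by have [] := arr_srcE (H i i (idm i)).
Qed.

Lemma ord_arr {k : nat} (F : functor (ordcat k) K) (i j i' j' : 'I_k.+1)
    (u : @hom (ordcat k) i j) (u' : @hom (ordcat k) i' j') :
  i = i' -> j = j' -> fmap F u ≈ fmap F u'.
Proof.
by move=> ei ej; subst i' j'; have -> : u = u' by apply: bool_irrelevance.
Qed.

(** All arrows of [ordcat k] are composites of steps from [i] to [i.+1]. *)
Lemma ord_functor_eq {k : nat} (F F' : functor (ordcat k) K) : F ord0 = F' ord0 ->
  (forall (i j : 'I_k.+1) (u : @hom (ordcat k) i j), j = i.+1 :> nat -> fmap F u ≈ fmap F' u) ->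
  functor_eq F F'.
Proof.
move=> e0 e1.
(* A positive object is the target of a step; induction on lengths treats arrows. *)
have eO (i : 'I_k.+1) : F i = F' i.
  have [i0|i0] := posnP i.
    by have -> : i = ord0 by apply: val_inj.
  have lt_p : (i.-1 < k.+1)%N by apply: leq_ltn_trans (leq_pred i) (ltn_ord i).
  have u : @hom (ordcat k) (Ordinal lt_p) i by apply: leq_pred.
  by have [_] := arr_srcE (e1 _ _ u (esym (prednK i0))).
have eA (n : nat) : forall (i j : 'I_k.+1) (u : @hom (ordcat k) i j), j = i + n :> nat ->
    fmap F u ≈ fmap F' u.
  elim: n => [|n IH] i j u ej.
    have ij : i = j by apply: val_inj; rewrite /= ej addn0.
    subst j; have -> : u = @idm (ordcat k) i by apply: bool_irrelevance.
    by rewrite !fmap_id eO.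
  have lt_m : (i + n < k.+1)%N by apply: leq_trans (ltn_ord j); rewrite ej addnS ltnS.
  have im : @hom (ordcat k) i (Ordinal lt_m) by apply: leq_addr.
  have mj : @hom (ordcat k) (Ordinal lt_m) j by rewrite /= ej addnS.
  have -> : u = cmp (c := ordcat k) im mj by apply: bool_irrelevance.
  rewrite !fmap_cmp; apply: arr_cmp; first exact: IH.
  by apply: e1; rewrite /= ej addnS.
by apply: functor_eq_arr => i j u; apply: (eA (j - i)); rewrite subnKC.
Qed.

Context {x y z : K} (d : hom x y) (e : hom y z).

Definition chain_ob (n : nat) : K :=
  match n with 0 => x | 1 => y | _ => z end.

(** One definition for all lengths up to two; a functor on [ordcat k] with [k < 2]
    does not reach the arrow [e], nor [d] if [k = 0]. *)
Definition chain_hom (i j : nat) : (i <= j)%N -> hom (chain_ob i) (chain_ob j) :=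
  match i, j return (i <= j)%N -> hom (chain_ob i) (chain_ob j) with
  | 0, 0 => fun _ => idm x
  | 0, 1 => fun _ => d
  | 0, _.+2 => fun _ => d • e
  | 1, 1 => fun _ => idm y
  | 1, _.+2 => fun _ => e
  | _.+2, _.+2 => fun _ => idm z
  | 1, 0 => fun le => False_rect _ (notF le)
  | _.+2, 0 => fun le => False_rect _ (notF le)
  | _.+2, 1 => fun le => False_rect _ (notF le)
  end.

Lemma chain_id (n : nat) (le : (n <= n)%N) : chain_hom le = idm (chain_ob n).
Proof. by case: n le => [|[|n]]. Qed.

Lemma chain_cmp (i j l : nat) (ij : (i <= j)%N) (jl : (j <= l)%N) (il : (i <= l)%N) :
  chain_hom il = chain_hom ij • chain_hom jl.
Proof.
case: i ij il => [|[|i]]; case: j jl => [|[|j]] jl ij il //; case: l jl il => [|[|l]] jl il //=;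
  by rewrite ?cmp_idl ?cmp_idr.
Qed.

Definition chain (k : nat) : functor (ordcat k) K :=
  @Functor (ordcat k) K (fun i => chain_ob i) (fun i j le => chain_hom le)
    (fun i => chain_id (leqnn i)) (fun i j l f g => chain_cmp f g _).

End OrdinalFunctors.

Section Cotensors.
Context {C : two_category} (HC : corepita C).

Lemma cotensorI {k : nat} {X XJ : C} (U : functor (ordcat k) (hc XJ X)) :
  (forall (A : C) (F : functor (ordcat k) (hc A X)), exists f : hc A XJ, f ⋅ U ord0 = F ord0 /\
     forall (i j : 'I_k.+1) (u : @hom (ordcat k) i j), j = i.+1 :> nat -> f ◃ fmap U u ≈ fmap F u) ->
  (forall (A : C) (f g : hc A XJ), f ⋅ U ord0 = g ⋅ U ord0 ->
     (forall (i j : 'I_k.+1) (u : @hom (ordcat k) i j), f ◃ fmap U u ≈ g ◃ fmap U u) -> f = g) ->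
  (forall (A : C) (f g : hc A XJ) (t : forall j : ordcat k, f ⋅ U j ⟹ g ⋅ U j),
     (forall (i j : ordcat k) (u : hom i j), (f ◃ fmap U u) • t j = t i • (g ◃ fmap U u)) ->
     exists! s : f ⟹ g, forall j, s ▹ U j = t j) ->
  is_strict_cotensor U.
Proof.
move=> ex ext cells A; split=> [F|f g t nat_t]; last exact: cells.
have [f [f0 f1]] := ex A F.
have fE : functor_eq (functor_comp U (pre f X)) F by apply: ord_functor_eq.
exists f; split=> // g [g0 g1].
apply: ext => [|i j u]; first by rewrite f0 -g0.
by have [_ fA] := fE; have := fA (Arrow u); have := g1 (Arrow u); rewrite /fun_arr /= => -> ->.
Qed.

Lemma cotensor0 (X : C) : exists (XJ : C) (U : functor (ordcat 0) (hc XJ X)), is_strict_cotensor U.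
Proof.
exists X, (chain (idm (id1 X)) (idm (id1 X)) 0); apply: cotensorI => [A F|A f g /=|A f g t _].
- exists (F ord0); split=> [|i j u]; first by rewrite /= h1_idr.
  by move=> ej; have := ltn_ord j; rewrite ej.
- by rewrite !h1_idr.
have [s sE] := arr_cast (t ord0) (h1_idr f) (h1_idr g).
have sT (r : f ⟹ g) : r ▹ id1 X = t ord0 <-> r = s.
  split=> [e|->]; apply: arr_inj; first by rewrite sE -e wr_unit.
  by rewrite wr_unit sE.
exists s; split=> [j|r rE]; first by rewrite (ord1 j); apply/sT.
by symmetry; apply/sT/(rE ord0).
Qed.

Section ArrowObjects.
Context {X XA : C} {d0 d1 : hc XA X} {d : d0 ⟹ d1} (AO : is_strict_arrow_object d).

(** The arrow-category form of the universal property of [d] for squares whose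
    horizontal sides agree with whiskerings of [d] up to their ends. *)
Lemma ao_square {B : C} {f g : hc B XA} {a a' b b' : hc B X} (al : a ⟹ a') (be : b ⟹ b')
    (u : a ⟹ b) (v : a' ⟹ b') :
  al ≈ f ◃ d -> be ≈ g ◃ d -> al • v = u • be -> exists t : f ⟹ g, t ▹ d0 ≈ u /\ t ▹ d1 ≈ v.
Proof.
move=> ea eb; have [ea0 ea1] := arr_srcE ea; have [eb0 eb1] := arr_srcE eb; subst a a' b b'.
rewrite (arr_inj ea) (arr_inj eb) => sq.
by have [t [t0 t1]] := ao_cell AO (esym sq); exists t; rewrite t0 t1.
Qed.

Lemma cotensor1 : exists (XJ : C) (U : functor (ordcat 1) (hc XJ X)), is_strict_cotensor U.
Proof.
pose i0 : 'I_2 := @Ordinal 2 0 isT; pose i1 : 'I_2 := @Ordinal 2 1 isT.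
have I2 (i : 'I_2) : i = i0 \/ i = i1.
  by case: i => [[|[|i]] hi] //; [left|right]; apply: val_inj.
pose u01 : @hom (ordcat 1) i0 i1 := isT.
pose U := chain d (idm d1) 1.
exists XA, U; apply: cotensorI => [A F|A f g _ e|A f g t nat_t].
- have [f fE] := ao_ex AO (fmap F u01); exists f; split.
    by have [/= -> _] := arr_srcE fE; congr (F _); apply: val_inj.
  move=> i j u ej; have i_0 : i = i0 by case: (I2 i) (I2 j) ej => [->|->] [->|->].
  have j_1 : j = i1 by apply: val_inj; rewrite /= ej i_0.
  subst i j; exact: etrans fE (ord_arr F u01 u erefl erefl).
- exact: (ao_ext AO (e _ _ u01)).
have [s [s0 s1]] := ao_square erefl erefl (nat_t i0 i1 u01).
exists s; split=> [j|r rE]; first by case: (I2 j) => ->; exact: arr_inj.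
by apply: (ao_cell_ext AO); [rewrite (arr_inj s0) -rE|rewrite (arr_inj s1) -rE].
Qed.

(** The target of the lifted 2-cell is obtained by changing the source of the arrow
    only. *)
Lemma arrow_src_isofibration : is_isofibration d0.
Proof.
have [P [p0 [p1 pr]]] := product_ex HC X X.
have [m [m0 m1]] := prod_ex pr d0 d1.
move=> B x y t iso_t; rewrite /= in t iso_t *.
have [w [w0 w1]] := prod_ex pr y (x ⋅ d1).
have [r [r0 r1]] := prod_cell pr t (idm (x ⋅ d1)) (etrans (h1_assoc x m p0) (f_equal (h1 x) m0))
  (etrans (h1_assoc x m p1) (f_equal (h1 x) m1)) w0 w1.
have iso_r : is_iso r.
  by apply: (prod_iso pr); [apply: is_iso_arr (esym r0) _|apply: is_iso_arr (esym r1) _; exact: iso_id].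
have [z [c [iso_c cE]]] := arrow_object_isofibration AO pr m0 m1 iso_r.
exists z, c; split=> //; rewrite /= -r0 -m0 -wr_assoc; exact: wr_arr.
Qed.

(** Two composable arrows: the pullback of [d1] and [d0]. *)
Lemma cotensor2 : exists (XJ : C) (U : functor (ordcat 2) (hc XJ X)), is_strict_cotensor U.
Proof.
case: (HC) => _ pbs _ _.
have [XJ [p1 [p2 pb]]] := pbs _ _ _ d1 d0 arrow_src_isofibration.
have [e eE] := arr_cast (p2 ◃ d) (esym pb.1) (erefl (p2 ⋅ d1)).
pose i0 : 'I_3 := dim0; pose i1 : 'I_3 := dim1; pose i2 : 'I_3 := dim2.
have I3 (i : 'I_3) : [\/ i = i0, i = i1 | i = i2].
  by case: i => [[|[|[|i]]] hi] //; [apply: Or31|apply: Or32|apply: Or33]; apply: val_inj.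
pose u01 : @hom (ordcat 2) i0 i1 := isT; pose u12 : @hom (ordcat 2) i1 i2 := isT.
pose U := chain (p1 ◃ d) e 2.
have eP (A : C) (f : hc A XJ) : f ◃ e ≈ (f ⋅ p2) ◃ d by rewrite -wl_assoc; apply: wl_arr.
exists XJ, U; apply: cotensorI => [A F|A f g _ fg|A f g t nat_t].
- have [f1 f1E] := ao_ex AO (fmap F u01); have [f2 f2E] := ao_ex AO (fmap F u12).
  have [e0 e1] := arr_srcE f1E; have [e1' _] := arr_srcE f2E.
  have [f [fp1 fp2]] := pb_ex (strict_pb pb) (etrans e1 (esym e1')).
  exists f; split; first by rewrite /= -h1_assoc fp1 e0; congr (F _); apply: val_inj.
  move=> i j u ej.
  case: (I3 i) => ei; first 1 last.
  + have j2 : j = i2 by apply: val_inj; rewrite /= ej ei.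
    subst i j; apply: etrans (ord_arr F u12 u erefl erefl).
    by rewrite -f2E -fp2 -eP.
  + by exfalso; move: (ltn_ord j); rewrite ej ei.
  have j1 : j = i1 by apply: val_inj; rewrite /= ej ei.
  subst i j; apply: etrans (ord_arr F u01 u erefl erefl).
  by rewrite -f1E -fp1 -wl_assoc.
- apply: (pb_ext (strict_pb pb)); apply: (ao_ext AO).
    by rewrite -!wl_assoc; apply: (fg _ _ u01).
  by rewrite -!eP; apply: (fg _ _ u12).
have [s1 [s10 s11]] := ao_square (f := f ⋅ p1) (g := g ⋅ p1) (wl_assoc _ _ _) (wl_assoc _ _ _) (nat_t i0 i1 u01).
have [s2 [s20 s21]] := ao_square (eP A f) (eP A g) (nat_t i1 i2 u12).
have [s [sp1 sp2]] := strict_pb_cell pb erefl erefl erefl erefl (etrans s11 (esym s20)).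
have s_0 : s ▹ (p1 ⋅ d0) ≈ t i0 by rewrite -wr_assoc (wr_arr _ sp1).
have s_1 : s ▹ (p1 ⋅ d1) ≈ t i1 by rewrite -wr_assoc (wr_arr _ sp1).
have s_2 : s ▹ (p2 ⋅ d1) ≈ t i2 by rewrite -wr_assoc (wr_arr _ sp2).
exists s; split=> [j|r rE]; first by case: (I3 j) => ->; exact: arr_inj.
have r_0 : r ▹ (p1 ⋅ d0) = t i0 := rE i0.
have r_1 : r ▹ (p1 ⋅ d1) = t i1 := rE i1.
have r_2 : r ▹ (p2 ⋅ d1) = t i2 := rE i2.
apply: arr_inj; apply: (strict_pb_cell_ext pb); congr arr; apply: (ao_cell_ext AO); apply: arr_inj.
- by rewrite !wr_assoc s_0 r_0.
- by rewrite !wr_assoc s_1 r_1.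
- by rewrite !wr_assoc -pb.1 s_1 r_1.
by rewrite !wr_assoc s_2 r_2.
Qed.

End ArrowObjects.
End Cotensors.

Section NerveExists.
Context {C : two_category} (HC : corepita C).

Lemma cotensor_ex (X : C) (k : 'I_3) :
  exists (XJ : C) (U : functor (ordcat k) (hc XJ X)), is_strict_cotensor U.
Proof.
case: (HC) => _ _ /(_ X)[XA [d0 [d1 [d AO]]]] _.
case: k => [[|[|[|k]]] hk] //=; [exact: cotensor0|exact: cotensor1 AO|exact: cotensor2 AO].
Qed.

Lemma cotensor_ext {J : category} {X XJ : C} {U : functor J (hc XJ X)} (cot : is_strict_cotensor U)
    {A : C} (f g : hc A XJ) :
  (forall i j (u : @hom J i j), f ◃ fmap U u ≈ g ◃ fmap U u) -> f = g.
Proof.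
move=> H; have [/(_ (functor_comp U (pre g X)))[h [_ hU]] _] := cot A.
by rewrite -(hU f) ?(hU g) //; apply: functor_eq_arr.
Qed.

(** Choice of elements in a family of types, used to turn the existence of the cotensors, cores and
    induced 1-cells of a nerve into a diagram. *)
Lemma choose {I : Type} {T : I -> Type} (P : forall i, T i -> Prop) :
  (forall i, exists x, P i x) -> exists f : forall i, T i, forall i, P i (f i).
Proof.
move=> H; exists (fun i => proj1_sig (constructive_indefinite_description _ (H i))) => i.
by case: constructive_indefinite_description.
Qed.

Lemma nerve_ex (X : C) : exists D : simplicial2 C, inhabited (nerve X D) /\ forall k, is_groupoidal (D k).
Proof.
have [cot cotH] := choose (cotensor_ex X).
have [U UP] := choose cotH.
case: (HC) => _ _ _ cores; have [D /choose[i core_i]] := choose (fun k => cores (cot k)).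
have [nmap nmapP] : exists nm : forall q : {m : 'I_3 & {n : 'I_3 & monotone_map m n}},
    hc (cot (projT1 (projT2 q))) (cot (projT1 q)), forall q,
    functor_eq (functor_comp (U (projT1 q)) (pre (nm q) X))
               (functor_comp (monotone_functor (projT2 (projT2 q))) (U (projT1 (projT2 q)))).
  apply: (@choose _ _ (fun q f => functor_eq (functor_comp (U (projT1 q)) (pre f X))
     (functor_comp (monotone_functor (projT2 (projT2 q))) (U (projT1 (projT2 q)))))) => -[m [n t]] /=.
  have [/(_ (functor_comp (monotone_functor t) (U n)))[f [fE _]] _] := UP m (cot n).
  by exists f.
pose nm (m n : 'I_3) (t : monotone_map m n) : hc (cot n) (cot m) := nmap (existT _ m (existT _ n t)).
have nmP (m n : 'I_3) (t : monotone_map m n) :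
    functor_eq (functor_comp (U m) (pre (nm m n t) X)) (functor_comp (monotone_functor t) (U n)).
  exact: (nmapP (existT _ m (existT _ n t))).
have nmA (m n : 'I_3) (t : monotone_map m n) (a b : 'I_m.+1) (u : @hom (ordcat m) a b) :
    nm m n t ◃ fmap (U m) u ≈ fmap (U n) (fmap (monotone_functor t) u).
  by have [_ /(_ (Arrow u))] := nmP m n t.
have gD k : is_groupoidal (D k) by case: (core_i k).
have [smap smapP] : exists sm : forall q : {m : 'I_3 & {n : 'I_3 & monotone_map m n}},
    hc (D (projT1 (projT2 q))) (D (projT1 q)), forall q,
    sm q ⋅ i (projT1 q) = i (projT1 (projT2 q)) ⋅ nmap q.
  apply: (@choose _ _ (fun q f => f ⋅ i (projT1 q) = i (projT1 (projT2 q)) ⋅ nmap q)) => q.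
  exact: core_lift.
pose sm (m n : 'I_3) (t : monotone_map m n) : hc (D n) (D m) := smap (existT _ m (existT _ n t)).
have smP (m n : 'I_3) (t : monotone_map m n) : sm m n t ⋅ i m = i n ⋅ nm m n t.
  exact: (smapP (existT _ m (existT _ n t))).
have sid (n : 'I_3) (t : monotone_map n n) : (forall a, t a = a) -> sm n n t = id1 (D n).
  move=> tE; apply: (core_monic (core_i n)); rewrite smP h1_idl -[RHS]h1_idr; congr (_ ⋅ _).
  apply: (cotensor_ext (UP n)) => a b u; rewrite nmA wl_unit; apply: ord_arr; apply: tE.
have scomp (a m n : 'I_3) (s : monotone_map a m) (t : monotone_map m n) (r : monotone_map a n) :
    (forall j, r j = t (s j)) -> sm a n r = sm m n t ⋅ sm a m s.
  move=> rE; apply: (core_monic (core_i a)); rewrite h1_assoc !smP -h1_assoc smP h1_assoc.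
  congr (_ ⋅ _); apply: (cotensor_ext (UP a)) => x y u.
  rewrite nmA -wl_assoc (wl_arr _ (nmA _ _ s _ _ u)) nmA; apply: ord_arr; apply: rE.
exists (@Simplicial2 C D sm sid scomp); split=> //.
by split; apply: (@Nerve C X (@Simplicial2 C D sm sid scomp) cot U UP i core_i nm nmP smP).
Qed.

End NerveExists.

(** * Triviality *)

Lemma is_composite_fun {K L : category} (F : functor K L) (a b c : arrow K) :
  is_composite a b c -> is_composite (fun_arr F a) (fun_arr F b) (fun_arr F c).
Proof.
move=> [x [y [z [f [g [-> -> ->]]]]]]; exists (F x), (F y), (F z), (fmap F f), (fmap F g).
by split=> //; rewrite -fmap_cmp.
Qed.

Section Triviality.
Context {C : two_category} (HC : corepita C) (S : DOF_classifier C).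
Context (small : forall (A X : C) (q : hc X A), is_SOF q -> SOF_small S q).

(** The diagonal of a DOF is a monic DOF over its kernel pair, so it has a section,
    which makes [q] monic; being a monic DOF, [q] itself has a section. *)
Lemma dof_split {A X : C} (q : hc X A) : is_groupoidal A -> is_DOF q ->
  monic q /\ exists r : hc A X, r ⋅ q = id1 A.
Proof.
move=> gA dq; have gX := dof_groupoidal dq gA.
have [W [w1 [w2 [dw1 pb]]]] := dof_pb HC q dq.
have [dg [dg1 dg2]] := pb_ex pb (erefl (id1 X ⋅ q)).
have ddg : is_DOF dg by apply: (@dof_cancel _ _ _ _ dg w1); rewrite ?dg1 //; apply: dof_id.
have mdg : monic dg by move=> B u v e; rewrite -[u]h1_idr -[v]h1_idr -dg1 -!h1_assoc e.
have [s sE] := monic_dof_split HC small (dof_groupoidal dw1 gX) ddg mdg.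
(* A section of the diagonal identifies the two projections of the kernel pair. *)
have e12 : w1 = w2 by rewrite -[w1]h1_idl -[w2]h1_idl -sE !h1_assoc dg1 dg2.
have mq : monic q.
  by move=> B u v /(pb_ex pb)[w [<- <-]]; rewrite e12.
by split=> //; apply: (monic_dof_split HC small gA dq mq).
Qed.

(** The set of 2-cells from [a] to [b] is a DOF over [B], and a section of it is a
    2-cell. *)
Lemma cell_from_gpd {B W : C} (a b : hc B W) : is_groupoidal B ->
  inhabited (a ⟹ b) /\ forall c c' : a ⟹ b, c = c'.
Proof.
move=> gB; have [H [h [eta rH]]] := cell_object HC a b gB.
have [mh [r rE]] := dof_split gB rH.1; split=> [|c c'].
  have [c _] := arr_cast (r ◃ eta) (esym (h1_assoc r h a)) (esym (h1_assoc r h b)).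
  by move: c; rewrite rE !h1_idl => c; split.
have rep (d : a ⟹ b) : exists g, g ⋅ h = id1 B /\ g ◃ eta ≈ d.
  have [d' d'E] := arr_cast d (esym (h1_idl a)) (esym (h1_idl b)).
  by have [g [gh gE]] := represents_cells_ex rH d'; exists g; rewrite gE.
have [g [gh gE]] := rep c; have [g' [g'h g'E]] := rep c'.
have e : g = g' by apply: mh; rewrite gh.
by apply: arr_inj; rewrite -gE e.
Qed.

Context (quot : forall (X : C) (D : simplicial2 C) (N : nerve X D),
        exists c : cocone D X, is_canonical_cocone N c /\ is_quotient c).

(** Out of the groupoidal objects of the nerve of [A], parallel 2-cells are equal and
    always exist, so the cocones induced by [f] and [f'] are related by exactly one
    morphism. *)
Lemma cell_from_any {A Z : C} (f f' : hc A Z) : inhabited (f ⟹ f') /\ forall c c' : f ⟹ f', c = c'.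
Proof.
have [D [[Nv] gD]] := nerve_ex HC A; have [c [_ [_ U]]] := quot Nv.
have img (k : hc A Z) : exists h : cocone D Z, coc1 h = coc1 c ⋅ k /\ induces c k h.
  have [g gE] := arr_cast (coc2 c ▹ k) (h1_assoc _ _ _) (h1_assoc _ _ _).
  have wE B (w : hc B (D dim1)) : w ◃ g ≈ (w ◃ coc2 c) ▹ k by rewrite (wl_arr _ gE) wlr_assoc.
  have gu : unit1 D ◃ g ≈ idm (coc1 c ⋅ k).
    by rewrite wE (wr_arr _ (coc_unit c)) wr_id.
  have gc : is_composite (arr (pi01 D ◃ g)) (arr (pi12 D ◃ g)) (arr (pi02 D ◃ g)).
    by rewrite !wE; apply: (is_composite_fun (post _ k)) (coc_comp c).
  by exists (Cocone gu gc); split=> //; split.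
(* Between the cocones, one 2-cell exists, and it is a morphism since 2-cells are equal. *)
have [h [h1E hI]] := img f; have [h' [h1'E h'I]] := img f'.
have [[a] _] := cell_from_gpd (coc1 h) (coc1 h') (gD dim0).
have am : is_cocone_morphism a by have [_] := cell_from_gpd (pi0 D ⋅ coc1 h) (pi1 D ⋅ coc1 h') (gD dim1); apply.
have [b [bE bU]] := U Z h h' a am f f' hI h'I.
split=> // d d'.
have all (e : f ⟹ f') : coc1 c ◃ e ≈ a.
  have [e' e'E] := arr_cast (coc1 c ◃ e) (esym h1E) (esym h1'E).
  by rewrite -e'E; congr arr; have [_] := cell_from_gpd (coc1 h) (coc1 h') (gD dim0); apply.
by rewrite -(bU d) // -(bU d').
Qed.

Lemma terminal_gpd {T : C} : is_strict_terminal T -> is_groupoidal T.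
Proof.
move=> TT A x y f; have [[z [_ Z]] [a [_ Wa]]] := TT A.
have exy : y = x by rewrite -(Z x) // -(Z y).
subst y; exists (idm x); rewrite cmp_idl cmp_idr.
by split; apply: arr_inj; rewrite -(Wa (arr f)) // -(Wa (arr (idm x))).
Qed.

(** Uniqueness and existence of 2-cells make [Z] a SOF over [T]; a DOF over [T]
    to which it is equivalent has a section. *)
Lemma point_ex {T : C} (Z : C) : is_strict_terminal T -> exists z : hc T Z, True.
Proof.
move=> TT; have [[t [_ _]] _] := TT Z.
have tE A (a b : arrow (hc A T)) : a = b.
  by have [_ [c [_ W]]] := TT A; rewrite -(W a) // -(W b).
have sof_t : is_SOF t.
  move=> A; split=> [x y c c' _|x y f|x y f y0 y1 f0 f1 _ _].
  - by have [_] := cell_from_any x y; apply.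
  - by exists x, (idm x); apply: tE.
  have [[g] gU] := cell_from_any y0 y1; exists g; split=> [|g' _]; last exact: gU.
  by split; [have [_] := cell_from_any x y1; apply | apply: tE].
have [Y [_ [_ [g _]]]] := small sof_t.
have [_ [r _]] := dof_split (terminal_gpd TT) (@dof_is _ _ Y).
by exists (r ⋅ g).
Qed.

Lemma biequivalent_terminal : biequivalent C terminal_two_category.
Proof.
case: (HC) => -[T TT] _ _ _.
have iso_tt (x y : terminal_category) (f : hom x y) : is_iso f by exists tt; case: f; case: x; case: y.
pose F (X Y : C) : functor (hc X Y) terminal_category :=
  @Functor (hc X Y) terminal_category (fun _ => tt) (fun _ _ _ => tt) (fun _ => erefl) (fun _ _ _ _ _ => erefl).
unshelve eexists (@Pseudofunctor C terminal_two_category (fun _ => tt) F (fun _ => tt) (fun _ _ _ _ _ => tt)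
  _ _ _ _ _ _ _) => //.
split=> [X Y|[]]; last first.
  by exists T, tt, tt; split; exists tt; apply: iso_tt.
have [y _] := point_ex Y TT; have [[t [_ _]] _] := TT X.
pose f0 : hc X Y := t ⋅ y.
exists (@Functor terminal_category (hc X Y) (fun _ => f0) (fun _ _ _ => idm f0) (fun _ => erefl)
  (fun _ _ _ _ _ => esym (cmp_idl (idm f0)))).
split; last by exists (fun _ => tt); split=> // x; apply: iso_tt.
have [c _] := @choose _ (fun f : hc X Y => f ⟹ f0) (fun _ _ => True)
  (fun f => let: conj (inhabits c) _ := cell_from_any f f0 in ex_intro _ c I).
exists c; split=> [f g u|f]; first by have [_] := cell_from_any f f0; apply.
have [[d] _] := cell_from_any f0 f; exists d.
by split; [have [_] := cell_from_any f f|have [_] := cell_from_any f0 f0]; apply.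
Qed.

End Triviality.

Theorem theoremA (C : two_category)
    (HC : groupoidant C)
    (HS : exists S : DOF_classifier C,
        forall (A X : C) (q : hc X A), is_SOF q -> SOF_small S q) :
  biequivalent C terminal_two_category.
Proof. by case: HC HS => HC quot _ [S small]; apply: biequivalent_terminal HC S small quot. Qed.
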